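(* Let $C\subset A$ be a curve obtained by the construction described in the context, from an abelian surface $A$ with polarizing line bundle $L$ of type $(1,d)$ and a subgroup $X\le K(L)$ of order $d$, and assume that $X=\langle x\rangle$ is cyclic. Then the following isogeny relations hold: (a) If $d$ is odd, then $J_C\sim A\times J_{C/\langle [-1]\rangle}^2$. (b) If $d$ is even, then $J_C\sim A\times J_{C/\langle [-1]\rangle}\times J_{C/\langle [-1]\circ t_x\rangle}$.
   Context: Everything is over $\mathbb{C}$. For a smooth projective curve $Y$, $J_Y$ is its Jacobian (trivial if $Y$ has genus $0$), $J_Y^n$ is the $n$-fold product, and $\sim$ denotes isogeny of abelian varieties. On an abelian variety, $t_x$ is translation by $x$ and $[-1]$ is the inverse map, so $[-1]\circ t_x$ is the map $a\mapsto -a-x$. Construction of $C$. Let $d\ge 1$ and let $A=V/\Lambda$ be an abelian surface with a polarization of type $(1,d)$, with alternating form $E:V\times V\to\mathbb{R}$ (integer valued on $\Lambda$). For an ample line bundle $L$ in this class, put $\varphi_L:A\to A^\vee$, $a\mapsto t_a^*L\otimes L^{-1}$, and $K(L)=\ker\varphi_L\cong(\mathbb{Z}/d\mathbb{Z})^2$ (depending only on the class). Let $X\le K(L)$ be a subgroup of order $d$ and $\pi:A\to A/X=V/\Lambda'$ the quotient isogeny, $\Lambda\subseteq\Lambda'$. Then $E$ also defines a principal polarization on $A/X$. Choose a real decomposition $V=V_1\oplus V_2$ into $E$-isotropic subspaces with $\Lambda=(\Lambda\cap V_1)\oplus(\Lambda\cap V_2)$ and $\Lambda'=(\Lambda'\cap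 V_1)\oplus(\Lambda'\cap V_2)$ (such a choice exists). Let $L$ on $A$ and $M$ on $A/X$ be the line bundles of characteristic $0$ for this decomposition, i.e. those with first Chern class $E$ and semicharacter $\chi_0(v_1+v_2)=\exp(\pi i E(v_1,v_2))$ for $v_i\in V_i$; they are symmetric and $\pi^*M\cong L$. Assume $(A/X,M)$ is the Jacobian of a smooth genus $2$ curve, i.e. the unique effective divisor $H\in|M|$ is a smooth curve of genus $2$. Set $C:=\pi^{-1}(H)\in|L|$. Then $C$ is a smooth curve, $\pi|_C:C\to H$ is an unramified covering with group $X$, and the maps $t_x$ and $[-1]\circ t_x$ for $x\in X$ restrict to automorphisms of $C$. *)

(* Defs.v *)
From HB Require Import structures.
From mathcomp Require Import all_boot all_order all_algebra.
From mathcomp Require Import all_classical all_reals all_analysis.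
From mathcomp Require Import complex.

Set Implicit Arguments.
Unset Strict Implicit.
Unset Printing Implicit Defensive.

Import Order.TTheory GRing.Theory Num.Theory.
Import numFieldNormedType.Exports.

Local Open Scope classical_set_scope.
Local Open Scope complex_scope.
Local Open Scope ring_scope.

(* For R : realType, R[i] is the field of complex numbers.  With this instance
   [derivable], [is_derive] and [differentiable] on R[i] or 'rV[R[i]]_n mean
   differentiability over the complex field, i.e. holomorphy. *)
HB.instance Definition _ (R : rcfType) := NormedModule.copy R[i] R[i]^o.

Definition expC (R : realType) (z : R[i]) : R[i] :=
  let: a +i* b := z in (expR a * cos b) +i* (expR a * sin b).

Section LinearDual.
Variables (K : comNzRingType) (U : lmodType K).

Definition linform_pred : {pred U -> K^o} :=
  fun f => `[< forall a u v, f (a *: u + v) = a * f u + f v >].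

Lemma linform_submod_closed : submod_closed linform_pred.
Proof.
split.
  by apply/asboolP => a u v; rewrite -[RHS]/(a * 0 + 0) mulr0 addr0.
move=> c f g /asboolP Hf /asboolP Hg; apply/asboolP => a u v.
rewrite -[LHS]/(c * f (a *: u + v) + g (a *: u + v)) Hf Hg.
rewrite -[RHS]/(a * (c * f u + g u) + (c * f v + g v)).
by rewrite !mulrDr !mulrA (mulrC c a) -!addrA; congr (_ + _); rewrite addrCA.
Qed.

HB.instance Definition _ :=
  GRing.isSubmodClosed.Build K (U -> K^o) linform_pred linform_submod_closed.

Record linform := LinForm {
  linform_val :> U -> K^o;
  _ : linform_val \in linform_pred }.

HB.instance Definition _ := [isSub for linform_val].
HB.instance Definition _ := [Choice of linform by <:].
HB.instance Definition _ := [SubChoice_isSubLmodule of linform by <:].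

End LinearDual.

Section HolomorphicGerms.
Variables (R : realType) (T : topologicalType) (W : normedModType R[i]).

(* Near p the map f is a holomorphic function of the coordinate phi, and
   df/dphi (p) = d. *)
Definition chart_deriv (phi : T -> R[i]) (f : T -> W) (p : T) (d : W) : Prop :=
  exists g : R[i] -> W,
    [/\ \forall z \near phi p, derivable g z 1,
        \forall q \near p, f q = g (phi q) &
        is_derive (phi p) 1 g d].

Lemma chart_deriv0 phi p : chart_deriv phi (cst 0) p 0.
Proof.
exists (cst 0); split; last exact: is_derive_cst.
- by near=> z; exact: derivable_cst.
- by near=> q.
Unshelve. all: by end_near. Qed.

Lemma chart_derivD phi (a : R[i]) f h p d e :
  chart_deriv phi f p d -> chart_deriv phi h p e ->
  chart_deriv phi (fun q => a *: f q + h q) p (a *: d + e).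
Proof.
move=> [F [F1 F2 F3]] [G [G1 G2 G3]].
exists (fun z => a *: F z + G z); split.
- apply: filterS2 F1 G1 => z Fz Gz.
  exact: (derivableD (derivableZ (k := a) Fz) Gz).
- by apply: filterS2 F2 G2 => q -> ->.
- exact: (is_deriveD (is_deriveZ a F3) G3).
Unshelve. all: by end_near. Qed.

End HolomorphicGerms.

(* Smooth projective curves over the complex numbers, as compact connected
   Riemann surfaces. *)
Record riemannSurface (R : realType) := RiemannSurface {
  rs_space :> topologicalType;
  rs_index : Type;
  rs_dom : rs_index -> set rs_space;
  rs_chart : rs_index -> rs_space -> R[i];
  rs_hausdorff : hausdorff_space rs_space;
  rs_compact : compact [set: rs_space];
  rs_connected : connected [set: rs_space];
  rs_nonempty : [set: rs_space] !=set0;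
  rs_open : forall i, open (rs_dom i);
  rs_cover : forall p, exists i, rs_dom i p;
  rs_inj : forall i p q,
    rs_dom i p -> rs_dom i q -> rs_chart i p = rs_chart i q -> p = q;
  (* together with rs_inj: each chart is a homeomorphism from its domain onto
     an open subset of the complex plane *)
  rs_homeo : forall i (U : set rs_space),
    U `<=` rs_dom i -> (open U <-> open (rs_chart i @` U));
  rs_compat : forall i j p, rs_dom i p -> rs_dom j p ->
    exists d, chart_deriv (rs_chart i) (rs_chart j) p d }.

Arguments rs_dom {R} r i _.
Arguments rs_chart {R} r i _.

Definition holomorphic_map (R : realType) (Y Z : riemannSurface R)
    (f : Y -> Z) : Prop :=
  continuous f /\
  forall i j p, rs_dom Y i p -> rs_dom Z j (f p) ->
    exists d, chart_deriv (rs_chart Y i) (rs_chart Z j \o f) p d.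

(* f : Y -> Z is the quotient of Y by the cyclic group generated by the
   automorphism s. *)
Definition is_quotient_by (R : realType) (Y Z : riemannSurface R)
    (s : Y -> Y) (f : Y -> Z) : Prop :=
  [/\ holomorphic_map f,
      forall z, exists p, f p = z &
      forall p q, f p = f q <->
        exists n : nat, q = iter n s p \/ p = iter n s q].

Section Differentials.
Variables (R : realType) (Y : riemannSurface R).

(* A holomorphic 1-form is given by its coefficients w i with respect to the
   d(rs_chart Y i), each extended by 0 outside rs_dom Y i so that a form has
   only one such presentation. *)
Definition diff_pred : {pred rs_index Y -> Y -> R[i]} :=
  fun w => `[<
    [/\ forall i p, ~ rs_dom Y i p -> w i p = 0,
        forall i p, rs_dom Y i p ->
          exists d, chart_deriv (rs_chart Y i) (w i) p d &
        forall i j p d, rs_dom Y i p -> rs_dom Y j p ->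
          chart_deriv (rs_chart Y i) (rs_chart Y j) p d ->
          w i p = w j p * d] >].

Lemma diff_submod_closed : submod_closed diff_pred.
Proof.
split.
  apply/asboolP; split => //.
  - by move=> i p _; exists 0; exact: chart_deriv0.
  - by move=> i j p d _ _ _; rewrite -[RHS]/(0 * d) mul0r.
move=> c f g /asboolP[f0 fh fc] /asboolP[g0 gh gc]; apply/asboolP; split.
- move=> i p ip; rewrite -[LHS]/(c * f i p + g i p) f0// g0//.
  by rewrite mulr0 addr0.
- move=> i p ip.
  have [d Hd] := fh i p ip; have [e He] := gh i p ip.
  by exists (c * d + e); exact: (chart_derivD c Hd He).
- move=> i j p d ip jp H; rewrite -[LHS]/(c * f i p + g i p).
  rewrite (fc i j p d)// (gc i j p d)//.
  by rewrite -[RHS]/((c * f j p + g j p) * d) mulrDl mulrA.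
Qed.

HB.instance Definition _ :=
  GRing.isSubmodClosed.Build R[i] (rs_index Y -> Y -> R[i])
    diff_pred diff_submod_closed.

Record differential := Differential {
  diff_coef :> rs_index Y -> Y -> R[i];
  _ : diff_coef \in diff_pred }.

HB.instance Definition _ := [isSub for diff_coef].
HB.instance Definition _ := [Choice of differential by <:].
HB.instance Definition _ := [SubChoice_isSubLmodule of differential by <:].

(* The space of holomorphic differentials has dimension g. *)
Definition has_genus (g : nat) : Prop :=
  exists b : 'I_g -> differential, forall w : differential,
    exists! c : 'rV[R[i]]_g, w = \sum_(k < g) c 0 k *: b k.

(* df = w in a neighbourhood of p *)
Definition primitive_near (w : differential) (p : Y) (f : Y -> R[i]) : Prop :=
  \forall q \near p, forall i, rs_dom Y i q ->
    chart_deriv (rs_chart Y i) f q (w i q).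

(* The integral of w along the path c : [0, 1] -> Y is I: there is a function
   F on [0, 1] that is locally the composition of c with a primitive of w, and
   I = F 1 - F 0. *)
Definition path_integral (c : R -> Y) (w : differential) (I : R[i]) : Prop :=
  exists F : R -> R[i],
    (forall t : R, 0 <= t <= 1 ->
       exists f : Y -> R[i], primitive_near w (c t) f /\
         \forall s \near t, 0 <= s <= 1 -> F s = f (c s)) /\
    I = F 1 - F 0.

(* The image of H_1(Y, Z) in the dual of the space of holomorphic
   differentials; as Y is connected, every class is that of one loop. *)
Definition periods : set (linform differential) :=
  [set l | exists c : R -> Y,
     [/\ {within `[0, 1]%classic, continuous c}, c 0 = c 1 &
         forall w : differential, path_integral c w (l w)]].

End Differentials.

(* The complex torus V / L is presented by the pair (V, L). *)
Record complexTorus (R : realType) := ComplexTorus {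
  ct_univ : lmodType R[i];
  ct_lattice : set ct_univ }.

Definition torus_prod (R : realType) (S T : complexTorus R) : complexTorus R :=
  @ComplexTorus R (ct_univ S * ct_univ T)%type
    (@ct_lattice R S `*` @ct_lattice R T).

Definition curve_jacobian (R : realType) (Y : riemannSurface R) : complexTorus R :=
  ComplexTorus (@periods R Y).

(* A homomorphism of complex tori is induced by a unique linear map F of the
   universal covers that maps lattice to lattice; it is an isogeny if it is
   surjective with finite kernel. *)
Definition is_isogeny (R : realType) (S T : complexTorus R)
    (F : {linear ct_univ S -> ct_univ T}) : Prop :=
  [/\ forall v, ct_lattice v -> ct_lattice (F v),
      forall w, exists v, ct_lattice (F v - w) &
      exists s : seq (ct_univ S), forall v, ct_lattice (F v) ->
        exists2 a, a \in s & ct_lattice (v - a)].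

Definition isogenous (R : realType) (S T : complexTorus R) : Prop :=
  exists F : {linear ct_univ S -> ct_univ T}, is_isogeny F.

Section AbelianSurface.
Variable R : realType.
Local Notation V := 'rV[R[i]]_2.

Definition is_subgroup (L : set V) : Prop :=
  L 0 /\ forall u v, L u -> L v -> L (u - v).

Definition is_lattice (L : set V) : Prop :=
  exists b : 'I_4 -> V,
    (forall v, exists! c : 'rV[R]_4, v = \sum_(k < 4) (c 0 k)%:C *: b k) /\
    (forall v, L v <-> exists n : 'I_4 -> int, v = \sum_(k < 4) b k *~ n k).

(* L <= L' and L' / L has order d *)
Definition is_extension_of_order (L L' : set V) (d : nat) : Prop :=
  [/\ is_subgroup L', L `<=` L' &
      exists r : 'I_d -> V, (forall k, L' (r k)) /\
        forall v, L' v -> exists! k, L (v - r k)].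

(* The Riemann form E of a polarization, i.e. the imaginary part of the
   positive definite Hermitian form [hermitian_of E] below. *)
Definition is_riemann_form (E : V -> V -> R) : Prop :=
  [/\ forall (a : R) u v w, E (a%:C *: u + v) w = a * E u w + E v w,
      forall (a : R) u v w, E w (a%:C *: u + v) = a * E w u + E w v,
      forall v, E v v = 0,
      forall u v, E ('i *: u) ('i *: v) = E u v &
      forall v, v != 0 -> 0 < E ('i *: v) v].

(* E is integral of type (d1, d2) on L: symplectic basis e0, e1, f0, f1. *)
Definition has_type (E : V -> V -> R) (L : set V) (d1 d2 : nat) : Prop :=
  exists e f : 'I_2 -> V,
    [/\ forall v, L v <-> exists m n : 'I_2 -> int,
          v = \sum_(k < 2) (e k *~ m k + f k *~ n k),
        forall j k, E (e j) (e k) = 0,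
        forall j k, E (f j) (f k) = 0 &
        forall j k, E (e j) (f k) =
          if j == k then (if j == 0 then d1 else d2)%:R else 0].

Definition hermitian_of (E : V -> V -> R) (u v : V) : R[i] :=
  E ('i *: u) v +i* E u v.

(* Line bundles on V / L are given by factors of automorphy a : L * V -> C^*,
   i.e. a (l + m) v = a l (v + m) * a m v; only the values at l in L matter. *)
Definition lb_translate (x : V) (a : V -> V -> R[i]) : V -> V -> R[i] :=
  fun l v => a l (v + x).

Definition lb_isomorphic (L : set V) (a b : V -> V -> R[i]) : Prop :=
  exists h : V -> R[i],
    [/\ forall v, differentiable h v, forall v, h v != 0 &
        forall l v, L l -> a l v = b l v * (h (v + l) / h v)].

(* The preimage in V of K(a) = {x | t_x^* a is isomorphic to a}. *)
Definition lb_kernel (L : set V) (a : V -> V -> R[i]) : set V :=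
  [set x | lb_isomorphic L (lb_translate x a) a].

(* Global sections, as theta functions. *)
Definition lb_section (L : set V) (a : V -> V -> R[i]) (th : V -> R[i]) : Prop :=
  (forall v, differentiable th v) /\
  forall l v, L l -> th (v + l) = a l v * th v.

(* The Appell-Humbert bundle with first Chern class E and semicharacter chi. *)
Definition appell_humbert (E : V -> V -> R) (chi : V -> R[i]) :
    V -> V -> R[i] :=
  fun l v => chi l *
    expC (pi%:C * hermitian_of E v l + (pi / 2)%:C * hermitian_of E l l).

Definition is_real_subspace (W : set V) : Prop :=
  W 0 /\ forall (a : R) u v, W u -> W v -> W (a%:C *: u + v).

Definition is_isotropic_decomposition (E : V -> V -> R) (V1 V2 : set V) : Prop :=
  [/\ is_real_subspace V1 /\ is_real_subspace V2,
      forall v, exists v1 v2, [/\ V1 v1, V2 v2 & v = v1 + v2],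
      V1 `&` V2 `<=` [set 0],
      forall u v, V1 u -> V1 v -> E u v = 0 &
      forall u v, V2 u -> V2 v -> E u v = 0].

(* L is the sum of its intersections with V1 and V2. *)
Definition decomposes (V1 V2 L : set V) : Prop :=
  forall v, L v -> exists v1 v2,
    [/\ V1 v1 /\ L v1, V2 v2 /\ L v2 & v = v1 + v2].

(* chi (v1 + v2) = exp (pi i E (v1, v2)) *)
Definition is_semicharacter0 (E : V -> V -> R) (V1 V2 : set V)
    (chi : V -> R[i]) : Prop :=
  forall v1 v2, V1 v1 -> V2 v2 -> chi (v1 + v2) = expC (0 +i* (pi * E v1 v2)).

(* The zero divisor of th is reduced and smooth. *)
Definition smooth_divisor (th : V -> R[i]) : Prop :=
  forall v, th v = 0 -> exists h, 'd th v h != 0.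

(* For D the preimage in V of a smooth curve in V / L, the map u : D -> Y
   identifies Y with that curve D / L, with the complex structure for which the
   inclusion Y -> V / L is a holomorphic immersion: near each point it lifts to
   a holomorphic immersion s : Y -> V.  The values of u off D are irrelevant. *)
Definition is_curve_in_torus (L D : set V) (Y : riemannSurface R)
    (u : V -> Y) : Prop :=
  [/\ forall p, exists2 v, D v & u v = p,
      forall v w, D v -> D w -> (u v = u w <-> L (v - w)) &
      forall v i, D v -> rs_dom Y i (u v) ->
        exists (s : Y -> V) (d : V),
          [/\ s (u v) = v, \forall q \near u v, D (s q) /\ u (s q) = q,
              chart_deriv (rs_chart Y i) s (u v) d & d != 0]].

(* The affine map g of V / L preserves the curve, and s is its restriction. *)
Definition restricts_to (D : set V) (Y : riemannSurface R) (u : V -> Y)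
    (g : V -> V) (s : Y -> Y) : Prop :=
  forall v, D v -> D (g v) /\ s (u v) = u (g v).

End AbelianSurface.

(* Main.v *)
Require Import Defs.
From HB Require Import structures.
From mathcomp Require Import all_boot all_order all_algebra.
From mathcomp Require Import all_classical all_reals all_analysis.
From mathcomp Require Import complex.
From mathcomp Require Import ring lra.

Set Implicit Arguments.
Unset Strict Implicit.
Unset Printing Implicit Defensive.

Import Order.TTheory GRing.Theory Num.Theory.
Import numFieldNormedType.Exports.

Local Open Scope classical_set_scope.
Local Open Scope complex_scope.
Local Open Scope ring_scope.

(* Let S and S' be the pullbacks by the involutions s = [-1] and
   s' = [-1] o t_x on the holomorphic differentials of C.  Then T = S S' is the
   pullback by a deck transformation of C -> H, so that T^d = 1, and from
   1 - T = (1 + S') - (1 + S) S' every differential w is written as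
     d w = (sum of the T^k w) + (1 + S) a w + (1 + S') b w.
   The first term is T-invariant, hence comes from H, hence is a combination of
   the two coordinate differentials dz_0, dz_1 of A, on which S and S' act as
   -1; the other two terms come from Q = C/s and Q' = C/s'.  This makes
   l |-> (l(dz_0), l(dz_1)), l o q^*, l o q'^* an isomorphism from the dual of
   the differentials of C onto C^2 x (dual for Q) x (dual for Q').  It maps
   periods to periods.  Conversely, a loop of Q lifts to a path on C which
   becomes closed after adding its image under s, so if the image of l consists
   of periods then a fixed multiple of l is a period; the period group being
   finitely generated, the kernel is finite.  The term of A needs that the
   periods of dz_0, dz_1 have finite index in the lattice, because a real
   functional vanishing on them is the real part of a differential with
   imaginary periods, which is 0 by the maximum principle.
   If d is odd and y = ((d+1)/2) x, then t_y conjugates s' into s, so Q' may be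
   taken to be Q, with q' = q o t_y. *)

(** * Cousin's lemma and the modulus on R[i] *)

(** The periods are integrals over actual loops, so everything about them has to pass from small
    open sets to whole paths. A path is cut into pieces on which every form has a primitive, and
    only the functional sending a form to its integral is remembered; homotopies and
    reparametrisations never appear. The maps C -> Q and C -> Q' may ramify at fixed points of the
    involutions. Around such a point an invariant form descends only because a continuous function,
    differentiable off one point, is differentiable there too. This and the maximum principle are
    what the complex analysis below is built for. On universal covers the inverse of the isogeny is
    given by an explicit formula with denominator d. Finiteness of the kernel rests on finite
    generation of the period group: the elements v with M v a period fall into finitely many classes
    modulo periods. *)

Section Cousin.
Variable R : realType.

(** The supremum of the points reachable from [a] is itself reachable and cannot lie below [b]. In
    [loc] the short interval always contains its tag [t], the form in which estimates at [t] come
    from a derivative or a local primitive at [t]. *)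
Lemma cousin (P : R -> R -> Prop) (a b : R) : a <= b ->
  (forall t, a <= t <= b -> exists2 e : R, 0 < e &
     forall x y, a <= x <= t -> t <= y <= b -> t - e < x -> y < t + e -> P x y) ->
  (forall x y z, a <= x -> x <= y -> y <= z -> z <= b -> P x y -> P y z -> P x z) ->
  P a b.
Proof.
move=> ab loc tr.
pose S := [set x | a <= x <= b /\ P a x].
have Sa : S a.
  split; first by rewrite lexx.
  by have [|e e0 He] := loc a; [rewrite lexx|apply: He; rewrite ?lexx ?ab//; lra].
have hS : has_sup S by split; [exists a|exists b => x [/andP[]]].
have at_ : a <= sup S by apply: ub_le_sup => //; case: hS.
have tb : sup S <= b by apply: ge_sup; [exists a|move=> x [/andP[]]].
set t := sup S in at_ tb *.
have [|e e0 He] := loc t; first by rewrite at_.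
have [x [/andP[ax xb] Px] tx] := sup_adherent e0 hS.
have xt : x <= t by apply: ub_le_sup; [case: hS|split => //; rewrite ax].
have Pt y : t <= y <= b -> y < t + e -> P a y.
  move=> /andP[ty yb] yte; apply: (tr a x y) => //; first exact: le_trans xt ty.
  by apply: He => //; rewrite ?ax ?ty ?yb ?xt.
have [tlb|] := ltP t b; last first.
  by move=> bt; apply: Pt; rewrite ?lexx ?andbT//; lra.
pose y := Num.min b (t + e / 2).
have yb : y <= b by rewrite ge_min lexx.
have ty : t < y by rewrite lt_min tlb; lra.
have yt : y < t + e.
  have : y <= t + e / 2 by rewrite ge_min lexx orbT.
  by lra.
have Sy : S y by split; [apply/andP; split => //; lra|apply: Pt => //; rewrite (ltW ty)].
have : y <= t by apply: ub_le_sup => //; case: hS.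
by move=> /(lt_le_trans ty); rewrite ltxx.
Qed.

End Cousin.

Section Modulus.
Variable R : realType.
Local Notation C := R[i].

(** The norm of [R[i]] has its values in [R[i]]; the real-valued modulus makes estimates accessible
    to [lra]. *)
Definition ab (z : C) : R := complex.Re `|z|.

Lemma abE z : `|z| = (ab z)%:C.
Proof. by rewrite /ab normc_def. Qed.

Lemma ab_ge0 z : 0 <= ab z.
Proof. by rewrite -lecR -abE normr_ge0. Qed.

Lemma ab0 : ab 0 = 0. Proof. by apply: complexI; rewrite -abE normr0. Qed.
Lemma ab1 : ab 1 = 1. Proof. by apply: complexI; rewrite -abE normr1. Qed.

Lemma abM z w : ab (z * w) = ab z * ab w.
Proof. by apply: complexI; rewrite rmorphM/= -!abE normrM. Qed.

Lemma abN z : ab (- z) = ab z.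
Proof. by apply: complexI; rewrite -!abE normrN. Qed.

Lemma abD z w : ab (z + w) <= ab z + ab w.
Proof. by rewrite -lecR rmorphD/= -!abE ler_normD. Qed.

Lemma abV z : ab z^-1 = (ab z)^-1.
Proof. by apply: complexI; rewrite fmorphV/= -!abE normfV. Qed.

Lemma abX z n : ab (z ^+ n) = ab z ^+ n.
Proof. by apply: complexI; rewrite rmorphXn/= -!abE normrX. Qed.

Lemma ab_eq0 z : (ab z == 0) = (z == 0).
Proof. by rewrite -(inj_eq (@complexI R)) -abE normr_eq0. Qed.

Lemma ab_gt0 z : (0 < ab z) = (z != 0).
Proof. by rewrite lt_def ab_ge0 andbT ab_eq0. Qed.

Lemma abC (x : R) : ab x%:C = `|x|.
Proof. by rewrite /ab normc_def/= expr0n/= addr0 sqrtr_sqr. Qed.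

Lemma abi : ab 'i = 1.
Proof. by rewrite /ab normc_def/= expr0n/= add0r expr1n sqrtr1. Qed.

Lemma ab_sym z w : ab (z - w) = ab (w - z).
Proof. by rewrite -abN opprB. Qed.

Lemma abB3 z w y : ab (z - y) <= ab (z - w) + ab (w - y).
Proof. by have := abD (z - w) (w - y); rewrite addrA subrK. Qed.

Lemma abB z w : ab z - ab w <= ab (z - w).
Proof. by have := abD (z - w) w; rewrite subrK; lra. Qed.

Lemma Re_ab z : `|complex.Re z| <= ab z.
Proof. by rewrite -lecR -abE normc_ge_Re. Qed.

Lemma Im_ab z : `|complex.Im z| <= ab z.
Proof. by have := Re_ab (z * 'i); rewrite ReiNIm normrN abM abi mulr1. Qed.

Lemma ab_ReIm z : ab z <= `|complex.Re z| + `|complex.Im z|.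
Proof.
rewrite {1}[z]complexE (le_trans (abD _ _))// abM abi mul1r !abC//.
Qed.

Lemma ReD (z w : C) : complex.Re (z + w) = complex.Re z + complex.Re w.
Proof. by case: z w => [? ?] [? ?]. Qed.
Lemma ImD (z w : C) : complex.Im (z + w) = complex.Im z + complex.Im w.
Proof. by case: z w => [? ?] [? ?]. Qed.
Lemma ReN (z : C) : complex.Re (- z) = - complex.Re z.
Proof. by case: z => [? ?]. Qed.
Lemma ImN (z : C) : complex.Im (- z) = - complex.Im z.
Proof. by case: z => [? ?]. Qed.

Lemma nbhs_ab (z : C) (P : set C) :
  nbhs z P <-> exists2 r : R, 0 < r & forall w, ab (w - z) < r -> P w.
Proof.
split=> [/nbhs_ballP[r r0 rP]|[r r0 rP]].
  have rR : r = (complex.Re r)%:C by rewrite RRe_real// gtr0_real.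
  exists (complex.Re r); first by rewrite -ltcR -rR.
  by move=> w wz; apply: rP; rewrite /ball/= distrC abE rR ltcR.
apply/nbhs_ballP; exists r%:C; first by rewrite /= ltcR.
by move=> w; rewrite /ball/= distrC abE ltcR => /rP.
Qed.

Lemma near_ab (z : C) (r : R) : 0 < r -> \forall w \near z, ab (w - z) < r.
Proof. by move=> r0; apply/nbhs_ab; exists r. Qed.

Lemma cvg_ab T (F : set_system T) (f : T -> C) (l : C) : Filter F ->
  f @ F --> l <-> forall e : R, 0 < e -> \forall t \near F, ab (f t - l) < e.
Proof.
move=> FF; split=> [fl e e0|H].
  have := @near_ab l e e0.
  exact: fl.
move=> A /nbhs_ab[r r0 rA].
by apply: filterS (H _ r0) => t /rA.
Qed.

Lemma nbhs_R (x : R) (P : set R) :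
  nbhs x P <-> exists2 r : R, 0 < r & forall y, `|y - x| < r -> P y.
Proof.
split=> [/nbhs_ballP[r r0 rP]|[r r0 rP]].
  by exists r => // w wz; apply: rP; rewrite /ball/= distrC.
apply/nbhs_ballP; exists r => // w; rewrite /ball/= distrC => /rP; exact.
Qed.

Lemma continuous_ab : continuous ab.
Proof.
move=> z A /nbhs_R[r r0 rA]; apply/nbhs_ab; exists r => // w wz; apply: rA.
have := abB w z; have := abB z w; rewrite (ab_sym z w) => h1 h2.
by rewrite ltr_norml; apply/andP; split; lra.
Qed.

Lemma continuous_Re : continuous (@complex.Re R).
Proof.
move=> z A /nbhs_R[r r0 rA]; apply/nbhs_ab; exists r => // w wz; apply: rA.
by apply: le_lt_trans wz; rewrite -ReN -ReD Re_ab.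
Qed.

Lemma continuous_Im : continuous (@complex.Im R).
Proof.
move=> z A /nbhs_R[r r0 rA]; apply/nbhs_ab; exists r => // w wz; apply: rA.
by apply: le_lt_trans wz; rewrite -ImN -ImD Im_ab.
Qed.

Lemma continuous_real_complex : continuous (real_complex R : R -> C).
Proof.
move=> z A /nbhs_ab[r r0 rA]; apply/nbhs_R; exists r => // w wz; apply: rA.
by rewrite -rmorphB/= abC.
Qed.

Section CvgC.
Variables (T : Type) (F : set_system T).
Context {FF : Filter F}.
Implicit Types (f g : T -> C) (a b : C).

Lemma cvgCD f g a b : f @ F --> a -> g @ F --> b ->
  (fun x => f x + g x) @ F --> a + b.
Proof. by move=> fa gb; exact: (cvgD fa gb). Qed.

Lemma cvgCN f a : f @ F --> a -> (fun x => - f x) @ F --> - a.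
Proof. by move=> fa; exact: (cvgN fa). Qed.

Lemma cvgCB f g a b : f @ F --> a -> g @ F --> b ->
  (fun x => f x - g x) @ F --> a - b.
Proof. by move=> fa gb; exact: (cvgB fa gb). Qed.

Lemma cvgCM f g a b : f @ F --> a -> g @ F --> b ->
  (fun x => f x * g x) @ F --> a * b.
Proof. by move=> fa gb; exact: (cvgM fa gb). Qed.

Lemma cvgCV f a : a != 0 -> f @ F --> a -> (fun x => (f x)^-1) @ F --> a^-1.
Proof. by move=> a0 fa; exact: (cvgV a0 fa). Qed.

End CvgC.

Section ContC.
Variable (T : topologicalType).
Implicit Types (f g : T -> C) (p : T).

Lemma contP f p : {for p, continuous f} <->
  forall e : R, 0 < e -> \forall q \near p, ab (f q - f p) < e.
Proof. exact: cvg_ab. Qed.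

Lemma cont_cst (c : C) p : {for p, continuous (fun _ : T => c)}.
Proof. exact: cvg_cst. Qed.

Lemma contD f g p : {for p, continuous f} -> {for p, continuous g} ->
  {for p, continuous (fun x => f x + g x)}.
Proof. by move=> fa gb; exact: (cvgCD fa gb). Qed.

Lemma contB f g p : {for p, continuous f} -> {for p, continuous g} ->
  {for p, continuous (fun x => f x - g x)}.
Proof. by move=> fa gb; exact: (cvgCB fa gb). Qed.

Lemma contM f g p : {for p, continuous f} -> {for p, continuous g} ->
  {for p, continuous (fun x => f x * g x)}.
Proof. by move=> fa gb; exact: (cvgCM fa gb). Qed.

Lemma contV f p : f p != 0 -> {for p, continuous f} ->
  {for p, continuous (fun x => (f x)^-1)}.
Proof. by move=> a0 fa; exact: (cvgCV a0 fa). Qed.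

End ContC.

End Modulus.

Arguments cont_cst {R T} c p.

(** * Derivatives with respect to a coordinate *)

Section Der.
Variables (R : realType) (T : topologicalType).
Local Notation C := R[i].
Implicit Types (i : T -> C) (f g : T -> C).

(** Caratheodory's form of df/di = d: the difference of values factors through that of [i], with a
    factor tending to [d]. Product and chain rules become algebra, and one notion serves for real,
    complex and chart coordinates. *)
Definition der i f (p : T) (d : C) : Prop :=
  exists2 k : T -> C, \forall q \near p, f q - f p = k q * (i q - i p)
                    & k @ nbhs p --> d.

Lemma der_ext i f g p d : (\forall q \near p, f q = g q) -> der i f p d -> der i g p d.
Proof.
move=> fg [k fk kd]; exists k => //.
have fgp := nbhs_singleton fg.
by apply: filterS2 fg fk => q <- <-; rewrite fgp.
Qed.

Lemma eq_der i f g p d : f =1 g -> der i f p d -> der i g p d.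
Proof. by move=> /funext ->. Qed.

Lemma der_epsP i f p d : der i f p d <->
  forall e : R, 0 < e ->
  \forall q \near p, ab (f q - f p - d * (i q - i p)) <= e * ab (i q - i p).
Proof.
split=> [[k fk /cvg_ab kd] e e0|H].
  apply: filterS2 fk (kd e e0) => q -> kq.
  by rewrite -mulrBl abM ler_wpM2r ?ab_ge0// ltW.
(* Where [i q = i p] the estimate forces [f q = f p], so the factor is free there; the value [d]
   keeps its limit right. *)
exists (fun q => if i q == i p then d else (f q - f p) / (i q - i p)).
  apply: filterS (H _ (@ltr01 _)) => q; case: eqP => [->|/eqP qp _].
    rewrite subrr => h; rewrite mulr0; apply/eqP; rewrite -ab_eq0 eq_le ab_ge0 andbT.
    by move: h; rewrite mulr0 subr0 ab0 mulr0.
  by rewrite divfK// subr_eq0.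
apply/cvg_ab => e e0; have e20 : 0 < e / 2 by rewrite divr_gt0.
apply: filterS (H _ e20) => q; case: eqP => [_ _|/eqP qp].
  by rewrite subrr ab0.
have qp' : i q - i p != 0 by rewrite subr_eq0.
rewrite -{1}(divfK qp' (f q - f p)) -mulrBl abM ler_pM2r ?ab_gt0// => h.
by apply: le_lt_trans h _; lra.
Qed.

Lemma der_cont i f p d : {for p, continuous i} -> der i f p d -> {for p, continuous f}.
Proof.
move=> ci [k fk kd]; rewrite /continuous_at.
have : (fun q => f p + k q * (i q - i p)) @ nbhs p --> f p + d * (i p - i p).
  exact: cvgCD (cvg_cst _) (cvgCM kd (cvgCB ci (cvg_cst _))).
rewrite subrr mulr0 addr0; apply: cvg_trans; apply: near_eq_cvg.
by apply: filterS fk => q <-; rewrite addrC subrK.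
Qed.

Lemma der_cst i c p : der i (fun=> c) p 0.
Proof.
by exists (fun=> 0); [apply: nearW => q; rewrite subrr mul0r|exact: cvg_cst].
Qed.

Lemma der_id i p : der i i p 1.
Proof.
by exists (fun=> 1); [apply: nearW => q; rewrite mul1r|exact: cvg_cst].
Qed.

Lemma derD i f g p d e : der i f p d -> der i g p e ->
  der i (fun q => f q + g q) p (d + e).
Proof.
move=> [k fk kd] [l gl le]; exists (fun q => k q + l q); last exact: cvgCD kd le.
by apply: filterS2 fk gl => q h1 h2; rewrite mulrDl -h1 -h2; ring.
Qed.

Lemma derN i f p d : der i f p d -> der i (fun q => - f q) p (- d).
Proof.
move=> [k fk kd]; exists (fun q => - k q); last exact: cvgCN kd.
by apply: filterS fk => q h1; rewrite mulNr -h1; ring.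
Qed.

Lemma derB i f g p d e : der i f p d -> der i g p e ->
  der i (fun q => f q - g q) p (d - e).
Proof. by move=> df dg; exact: derD df (derN dg). Qed.

Lemma derM i f g (p : T) (d e : C) : {for p, continuous g} -> der i f p d -> der i g p e ->
  der i (fun q => f q * g q) p (d * g p + f p * e).
Proof.
move=> cg [k fk kd] [l gl le]; exists (fun q => k q * g q + f p * l q).
  apply: filterS2 fk gl => q h1 h2.
  have -> : f q * g q - f p * g p = (f q - f p) * g q + f p * (g q - g p) by ring.
  by rewrite h1 h2; ring.
exact: cvgCD (cvgCM kd cg) (cvgCM (cvg_cst _) le).
Qed.

Lemma derZ i f c p d : der i f p d -> der i (fun q => c * f q) p (c * d).
Proof.
move=> [k fk kd]; exists (fun q => c * k q).
  by apply: filterS fk => q h1; rewrite -mulrBr h1 mulrA.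
exact: cvgCM (cvg_cst _) kd.
Qed.

Lemma derV i f p d : {for p, continuous f} -> f p != 0 -> der i f p d ->
  der i (fun q => (f q)^-1) p (- d / f p ^+ 2).
Proof.
move=> cf fp0 [k fk kd]; exists (fun q => - k q / (f p * f q)).
  have f0 : \forall q \near p, f q != 0.
    move/cvg_ab : cf => /(_ (ab (f p))); rewrite ab_gt0 => /(_ fp0).
    apply: filterS => q; apply: contraTneq => ->.
    by rewrite sub0r abN ltxx.
  apply: filterS2 fk f0 => q h1 h2.
  rewrite mulrAC mulNr -h1; field; exact/andP.
rewrite expr2; apply: cvgCM; first exact: cvgCN kd.
apply: cvgCV; first by rewrite mulf_neq0.
exact: cvgCM (cvg_cst _) cf.
Qed.

(** The first premise says that [i] is not constant near [p]. Both estimates at such a point [q]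
    bound the factor [d - e] by half of its own modulus. *)
Lemma der_unique i f p d e :
  (forall U, nbhs p U -> exists2 q, U q & i q != i p) ->
  der i f p d -> der i f p e -> d = e.
Proof.
move=> iso /der_epsP fd /der_epsP fe; apply/eqP; rewrite -subr_eq0.
apply/negP => /negP de; pose r := ab (d - e) / 4.
have r0 : 0 < r by rewrite divr_gt0// ab_gt0.
have [q [/= h1 h2] qp] := iso _ (filterI (fd _ r0) (fe _ r0)).
have : ab ((d - e) * (i q - i p)) <= 2 * r * ab (i q - i p).
  have -> : (d - e) * (i q - i p) =
    (f q - f p - e * (i q - i p)) - (f q - f p - d * (i q - i p)) by ring.
  by apply: le_trans (abD _ _) _; rewrite abN; lra.
rewrite abM ler_pM2r ?ab_gt0 ?subr_eq0// /r.
have : 0 < ab (d - e) by rewrite ab_gt0.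
by lra.
Qed.

End Der.

Lemma der_comp (R : realType) (T T' : topologicalType) (i : T -> R[i])
    (j : T' -> R[i]) (f : T -> T') (g : T' -> R[i]) p d e :
  {for p, continuous f} ->
  der i (j \o f) p d -> der j g (f p) e -> der i (g \o f) p (e * d).
Proof.
move=> cf [k fk kd] [l gl le]; exists (fun q => l (f q) * k q).
  have gl' := cf _ gl.
  by apply: filterS2 fk gl' => q /= h1 ->; rewrite h1 mulrA.
have lf : (fun q => l (f q)) @ nbhs p --> e := @cvg_comp _ _ _ f l _ _ _ cf le.
exact: cvgCM lf kd.
Qed.

(** Both coordinates live on the same space, so no inverse function theorem is involved: the factor
    is inverted where it is nonzero. *)
Lemma der_inv (R : realType) (T : topologicalType) (i j : T -> R[i]) p d :
  d != 0 -> der i j p d -> der j i p d^-1.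
Proof.
move=> d0 [k fk kd]; exists (fun q => (k q)^-1); last exact: cvgCV d0 kd.
have k0 : \forall q \near p, k q != 0.
  move/cvg_ab : kd => /(_ (ab d)); rewrite ab_gt0 => /(_ d0).
  apply: filterS => q; apply: contraTneq => ->.
  by rewrite sub0r abN ltxx.
by apply: filterS2 fk k0 => q h1 h2; rewrite h1 mulrA mulVf// mul1r.
Qed.

Section RealAndComplexDer.
Variable R : realType.
Local Notation C := R[i].

Definition cd (f : C -> C) := der id f.
Definition rd (f : R -> C) := der (real_complex R) f.

Lemma cd_cont (f : C -> C) (z d : C) : cd f z d -> {for z, continuous f}.
Proof. by apply: der_cont; exact: cvg_id. Qed.

Lemma rd_cont f z d : rd f z d -> {for z, continuous f}.
Proof. by apply: der_cont; exact: continuous_real_complex. Qed.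

Lemma cd_unique (f : C -> C) (z d e : C) : cd f z d -> cd f z e -> d = e.
Proof.
apply: der_unique => U /nbhs_ab[r r0 rU]; exists (z + (r / 2)%:C).
  by apply: rU; rewrite addrC addKr abC gtr0_norm; lra.
rewrite -subr_eq0 addrC addKr -ab_eq0 abC gtr0_norm; first by rewrite gt_eqF; lra.
by lra.
Qed.

Lemma cdP (f : C -> C) (z d : C) : is_derive z 1 f d <-> cd f z d.
Proof.
have eps (h : C -> C) : h @ nbhs 0^' --> d <-> forall e : R, 0 < e ->
   exists2 r : R, 0 < r & forall w, ab w < r -> w != 0 -> ab (h w - d) < e.
  split=> [/cvg_ab H e /H|H].
    move=> /nbhs_ab[r r0 rH]; exists r => // w wr w0.
    by apply: (rH w) => //; rewrite subr0.
  apply/cvg_ab => e /H[r r0 rH]; apply/nbhs_ab; exists r => // w.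
  by rewrite subr0 => wr w0; exact: rH.
have eps2 : (fun h => h^-1 *: (f (h *: 1 + z) - f z)) @ 0^' --> d <-> cd f z d.
  rewrite eps; split=> H.
    apply/der_epsP => e e0; have [r r0 rH] := H _ e0.
    apply/nbhs_ab; exists r => // w wz; have [->|wz0] := eqVneq w z.
      by rewrite !subrr mulr0 subr0 ab0 mulr0.
    have wz0' : w - z != 0 by rewrite subr_eq0.
    have := rH _ wz wz0'; rewrite -[_ *: 1]/(_ * 1) mulr1 subrK -[_ *: _]/(_ * _) => h.
    have -> : f w - f z - d * (w - z) = ((w - z)^-1 * (f w - f z) - d) * (w - z).
      by field.
    by rewrite abM ler_wpM2r ?ab_ge0// ltW.
  move/der_epsP : H => H e e0; have e20 : 0 < e / 2 by rewrite divr_gt0.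
  have /nbhs_ab[r r0 rH] := H _ e20.
  exists r => // w wr w0; rewrite -[_ *: 1]/(_ * 1) mulr1 -[_ *: _]/(_ * _).
  have := rH (w + z); rewrite addrK => /(_ wr) => h.
  have -> : w^-1 * (f (w + z) - f z) - d = (f (w + z) - f z - d * w) * w^-1.
    by field.
  rewrite abM abV ltr_pdivrMr ?ab_gt0//.
  apply: le_lt_trans h _; rewrite ltr_pM2r ?ab_gt0//; lra.
split=> [[df Df]|/eps2 H].
  apply/eps2; rewrite -Df.
  move: df; rewrite /derivable /derive => /cvg_ex[l hl].
  by rewrite (cvg_lim _ hl).
split; first by rewrite /derivable; apply/cvg_ex; exists d; exact: H.
by rewrite /derive; apply: cvg_lim => //; exact: H.
Qed.

Lemma derivable_cd (f : C -> C) (z : C) : derivable f z 1 <-> exists d, cd f z d.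
Proof.
split=> [df|[d /cdP[]]]//.
by exists ('D_1 f z); apply/cdP; split.
Qed.

End RealAndComplexDer.

(** * Primitives of continuous functions on the line *)

Section RealPrimitives.
Variable R : realType.
Local Notation C := R[i].

(** For complex values only the mean value inequality holds. A slack [d] added to [M] makes it true
    on short intervals by differentiability, Cousin's lemma adds these up, and the slack then tends
    to 0. *)
Lemma rd_mvt (G g : R -> C) (a b M : R) : a <= b ->
  (forall x, a <= x <= b -> rd G x (g x)) ->
  (forall x, a <= x <= b -> ab (g x) <= M) -> ab (G b - G a) <= M * (b - a).
Proof.
move=> leab dG gM; apply/ler_addgt0Pr => e e0.
have k0 : 0 < b - a + 1 by lra.
(* The summand 1 keeps the denominator positive when [a = b]. *)
pose d := e / (b - a + 1).
have d0 : 0 < d by rewrite divr_gt0.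
suff : ab (G b - G a) <= (M + d) * (b - a).
  move/le_trans; apply; rewrite mulrDl lerD2l /d mulrAC ler_pdivrMr//.
  by rewrite ler_wpM2l ?ltW//; lra.
apply: (@cousin R (fun x y => ab (G y - G x) <= (M + d) * (y - x))) => //.
  move=> t tab; have /der_epsP/(_ d d0)/nbhs_R[r r0 rH] := dG t tab.
  exists r => // x y /andP[ax xt] /andP[ty yb] tx yt.
  have key z : `|z - t| < r -> ab (G z - G t) <= (M + d) * `|z - t|.
    move=> /rH; rewrite -rmorphB/= abC => h.
    have -> : G z - G t = (G z - G t - g t * (z - t)%:C) + g t * (z - t)%:C by ring.
    apply: le_trans (abD _ _) _; rewrite abM abC mulrDl addrC lerD//.
    by rewrite ler_wpM2r// gM.
  have kx : ab (G x - G t) <= (M + d) * (t - x).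
    have := key x; rewrite distrC ger0_norm; last by lra.
    by apply; lra.
  have ky : ab (G y - G t) <= (M + d) * (y - t).
    have := key y; rewrite ger0_norm; last by lra.
    by apply; lra.
  apply: le_trans (abB3 _ (G t) _) _; rewrite (ab_sym (G t)).
  by apply: le_trans (lerD ky kx) _; lra.
move=> x y z _ _ _ _ h1 h2; apply: le_trans (abB3 _ (G y) _) _.
by apply: le_trans (lerD h2 h1) _; lra.
Qed.

Lemma rd_cst (G : R -> C) (a b : R) :
  (forall x, Num.min a b <= x <= Num.max a b -> rd G x 0) -> G a = G b.
Proof.
wlog leab : a b / a <= b.
  move=> H h; have [leab|/ltW ba] := leP a b; first exact: H.
  apply/esym; apply: H => // x xab; apply: h.
  by move: xab; rewrite (min_l ba) (max_r ba) (min_r ba) (max_l ba).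
rewrite (min_l leab) (max_r leab) => dG.
have := @rd_mvt G (fun=> 0) a b 0 leab dG.
rewrite mul0r => h; apply/esym/eqP; rewrite -subr_eq0 -ab_eq0 eq_le ab_ge0 andbT.
by apply: h => x _; rewrite ab0.
Qed.

Lemma is_derive_rd (A : R -> R) (x l : R) :
  is_derive x 1 A l -> rd (fun y => (A y)%:C) x l%:C.
Proof.
move=> [dA Al]; apply/der_epsP => e e0.
move: dA Al; rewrite /derivable /derive => /cvg_ex[/= k kP].
rewrite (cvg_lim _ kP)// => kl; rewrite {k}kl in kP.
move/cvgrPdist_lt : kP => /(_ e e0) /nbhs_R[r r0 rH].
apply/nbhs_R; exists r => // y yx; have [->|yx0] := eqVneq y x.
  by rewrite !subrr mulr0 subr0 ab0 mulr0.
have yx0' : y - x != 0 by rewrite subr_eq0.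
have := rH (y - x); rewrite /= subr0 => /(_ yx yx0').
rewrite [_ *: 1]mulr1 subrK => h; rewrite -!rmorphB -rmorphM -rmorphB/= !abC.
have -> : A y - A x - l * (y - x) = - (l - (y - x)^-1 *: (A y - A x)) * (y - x).
  by rewrite -[_ *: _]/(_ * _); field.
by rewrite normrM normrN ler_wpM2r// ltW.
Qed.

(** The measure integral supplies a primitive to the right of its base point, here -1; a base point
    left of 0 leaves an overlap for the gluing in [rd_prim]. *)
Lemma half_primR (g : R -> R) : continuous g ->
  exists A : R -> C, forall x : R, -1 < x -> rd A x (g x)%:C.
Proof.
move=> cg; pose mu := @lebesgue_measure R.
exists (fun x => (\int[mu]_(t in [set` Interval (BLeft (-1 : R)) (BRight x)]) (g t))%R%:C).
move=> x x1; apply: is_derive_rd.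
have xu : x < x + 1 by lra.
have int : mu.-integrable [set` Interval (BLeft (-1)) (BRight (x + 1))] (EFin \o g).
  apply: continuous_compact_integrable; first exact: segment_compact.
  by apply: continuous_subspaceT.
have [|d1 d2] := continuous_FTC1 xu int _ (cg x).
  by rewrite ?bnd_simp ?lte_fin; lra.
by split; [exact: d1|rewrite -derive1E; exact: d2].
Qed.

Lemma half_prim (g : R -> C) : continuous g ->
  exists A : R -> C, forall x : R, -1 < x -> rd A x (g x).
Proof.
move=> cg.
have cr : continuous (fun x => complex.Re (g x)).
  by move=> x; apply: (@continuous_comp _ _ _ g (@complex.Re R)); [exact: cg|exact: continuous_Re].
have ci : continuous (fun x => complex.Im (g x)).
  by move=> x; apply: (@continuous_comp _ _ _ g (@complex.Im R)); [exact: cg|exact: continuous_Im].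
have [A dA] := half_primR cr; have [B dB] := half_primR ci.
exists (fun x => A x + 'i * B x) => x x1.
by rewrite [g x]complexE; exact: derD (dA x x1) (derZ 'i (dB x x1)).
Qed.

Lemma continuous_oppR : continuous (-%R : R -> R).
Proof.
move=> x U /nbhs_R[r r0 rU]; apply/nbhs_R; exists r => // y yx; apply: rU.
by rewrite opprK addrC distrC.
Qed.

(** A primitive to the right of -1 and the reflection of one for [g (- x)], valid to the left of 1,
    differ by a constant on the overlap; both are normalised to vanish at 0 and glued there. *)
Lemma rd_prim (g : R -> C) : continuous g -> exists G : R -> C, forall x, rd G x (g x).
Proof.
move=> cg; have [A dA] := half_prim cg.
have cg' : continuous (fun x => g (- x)).
  by move=> x; apply: (@continuous_comp _ _ _ -%R g); [exact: continuous_oppR|exact: cg].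
have [B dB] := half_prim cg'.
pose B' x := - B (- x).
have dB' x : x < 1 -> rd B' x (g x).
  move=> x1; have dBx : rd B (- x) (g x).
    by rewrite -{2}(opprK x); apply: dB; lra.
  have dn : der (real_complex R) (real_complex R \o -%R) x (-1).
    by apply: eq_der (derN (der_id (real_complex R) x)) => y; rewrite /= rmorphN.
  have cn := @continuous_oppR x.
  have := derN (der_comp cn dn dBx).
  by rewrite mulrN1 opprK.
have AB x : -1 < x < 1 -> A x - A 0 = B' x - B' 0.
  move=> /andP[x1 x2].
  have : A 0 - B' 0 = A x - B' x.
    apply: (@rd_cst (fun y => A y - B' y)) => y /andP[y1 y2].
    rewrite -(subrr (g y)); apply: derB; [apply: dA|apply: dB'].
      by apply: lt_le_trans y1; rewrite lt_min x1 andbT; lra.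
    by apply: le_lt_trans y2 _; rewrite gt_max x2 andbT; lra.
  move=> h; have -> : A x = A x - B' x + B' x by ring.
  by rewrite -h; ring.
exists (fun x => if 0 <= x then A x - A 0 else B' x - B' 0) => x.
have [x0|x0] := leP 0 x.
  have : rd (fun y => A y - A 0) x (g x).
    by rewrite -[g x]subr0; apply: derB (der_cst _ _ _); apply: dA; lra.
  apply: der_ext; apply/nbhs_R; exists 1 => // y; rewrite ltr_norml => /andP[y1 y2].
  by have [//|y0] := leP 0 y; apply: AB; lra.
have : rd (fun y => B' y - B' 0) x (g x).
  by rewrite -[g x]subr0; apply: derB (der_cst _ _ _); apply: dB'; lra.
apply: der_ext; apply/nbhs_R; exists 1 => // y; rewrite ltr_norml => /andP[y1 y2].
by have [y0|//] := leP 0 y; apply/esym/AB; lra.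
Qed.

End RealPrimitives.

(** Integrals of complex functions are differences of a chosen primitive, so linearity and
    substitution reduce to uniqueness of primitives, and reversed bounds need no separate
    treatment. *)
HB.lock Definition prim (R : realType) (g : R -> R[i]) : R -> R[i] :=
  xget (fun=> 0) [set G : R -> R[i] | forall x, rd G x (g x)].

Section Integral.
Variable R : realType.
Local Notation C := R[i].

Lemma primP (g : R -> C) : continuous g -> forall x, rd (prim g) x (g x).
Proof. by move=> /rd_prim[G dG]; rewrite prim.unlock; case: xgetP => // /(_ G). Qed.

Definition itg (a b : R) (g : R -> C) : C := prim g b - prim g a.

Lemma itgE (G g : R -> C) a b : continuous g ->
  (forall x, Num.min a b <= x <= Num.max a b -> rd G x (g x)) -> itg a b g = G b - G a.
Proof.
move=> cg dG; have : prim g a - G a = prim g b - G b.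
  apply: (@rd_cst R (fun y => prim g y - G y)) => y y1.
  by rewrite -(subrr (g y)); apply: derB; [exact: primP|exact: dG].
move=> h; rewrite /itg; have -> : prim g b = prim g b - G b + G b by ring.
by rewrite -h; ring.
Qed.

Lemma itgD a b (g h : R -> C) : continuous g -> continuous h ->
  itg a b (fun x => g x + h x) = itg a b g + itg a b h.
Proof.
move=> cg ch.
have c : continuous (fun x => g x + h x) by move=> x; exact: cvgCD (cg x) (ch x).
have d x : rd (fun x => prim g x + prim h x) x (g x + h x).
  exact: derD (primP cg x) (primP ch x).
rewrite [LHS](itgE c (fun x _ => d x)).
rewrite /itg; cbv beta.
by ring.
Qed.

Lemma itgB a b (g h : R -> C) : continuous g -> continuous h ->
  itg a b (fun x => g x - h x) = itg a b g - itg a b h.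
Proof.
move=> cg ch.
have c : continuous (fun x => g x - h x) by move=> x; exact: cvgCB (cg x) (ch x).
have d x : rd (fun x => prim g x - prim h x) x (g x - h x).
  exact: derB (primP cg x) (primP ch x).
rewrite [LHS](itgE c (fun x _ => d x)).
rewrite /itg; cbv beta.
by ring.
Qed.

Lemma itgZ a b c (g : R -> C) : continuous g -> itg a b (fun x => c * g x) = c * itg a b g.
Proof.
move=> cg.
have c' : continuous (fun x => c * g x) by move=> x; exact: cvgCM (cvg_cst _) (cg x).
have d x : rd (fun x => c * prim g x) x (c * g x) by exact: derZ (primP cg x).
rewrite [LHS](itgE c' (fun x _ => d x)).
rewrite /itg; cbv beta.
by ring.
Qed.

Lemma itg_chasles a b c (g : R -> C) : itg a b g + itg b c g = itg a c g.
Proof. by rewrite /itg; ring. Qed.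

Lemma itg_cst a b (c : C) : itg a b (fun=> c) = (b - a)%:C * c.
Proof.
have c' : continuous (fun _ : R => c) by move=> x; exact: cvg_cst.
have d x : rd (fun x => c * x%:C) x c.
  by rewrite -{2}(mulr1 c); exact: derZ (der_id _ _).
rewrite [LHS](itgE c' (fun x _ => d x)) rmorphB/=; ring.
Qed.

Lemma itg_bound a b (g : R -> C) M : a <= b -> continuous g ->
  (forall x, a <= x <= b -> ab (g x) <= M) -> ab (itg a b g) <= M * (b - a).
Proof. by move=> leab cg; apply: rd_mvt => // x _; exact: primP. Qed.

Lemma itg_bound' a b (g : R -> C) M : continuous g ->
  (forall x, Num.min a b <= x <= Num.max a b -> ab (g x) <= M) ->
  ab (itg a b g) <= M * `|b - a|.
Proof.
move=> cg; have [leab|/ltW ba] := leP a b.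
  by rewrite ger0_norm ?subr_ge0//; exact: itg_bound.
rewrite distrC ger0_norm ?subr_ge0// /itg ab_sym.
exact: itg_bound.
Qed.

Lemma eq_itg a b (g h : R -> C) : g =1 h -> itg a b g = itg a b h.
Proof. by move=> /funext ->. Qed.

End Integral.

(** * Goursat's lemma and local primitives *)

Section Cousin2.
Variables (R : realType) (P : R -> R -> R -> Prop) (a c w v : R).
Hypotheses (w0 : 0 < w) (v0 : 0 < v).
Hypothesis loc : forall x y, a <= x <= a + w -> c <= y <= c + v ->
  exists2 r : R, 0 < r & forall a' c' t, 0 < t -> t < r ->
    a' <= x <= a' + t * w -> c' <= y <= c' + t * v -> P a' c' t.
Hypothesis split4 : forall a' c' t, 0 < t ->
  P a' c' (t / 2) -> P (a' + t / 2 * w) c' (t / 2) ->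
  P a' (c' + t / 2 * v) (t / 2) -> P (a' + t / 2 * w) (c' + t / 2 * v) (t / 2) ->
  P a' c' t.

(** Goursat's bisection. [P a' c' t] speaks of the rectangle with lower left corner (a', c') and
    sides t w and t v. A failing rectangle has a failing quarter, and the nested quarters shrink to
    a point that contradicts [loc]. *)
Lemma cousin2 : P a c 1.
Proof.
apply: contrapT => nP.
pose good t (p q : R * R) := [/\ ~ P q.1 q.2 (t / 2),
  p.1 <= q.1, q.1 + t / 2 * w <= p.1 + t * w,
  p.2 <= q.2 & q.2 + t / 2 * v <= p.2 + t * v].
have goodP t p : 0 < t -> ~ P p.1 p.2 t -> exists q, good t p q.
  move=> t0 npt; apply: contrapT => nq; apply: npt.
  have tw : 0 < t / 2 * w by rewrite mulr_gt0// divr_gt0.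
  have tv : 0 < t / 2 * v by rewrite mulr_gt0// divr_gt0.
  apply: split4 => //; apply: contrapT => nPq; apply: nq.
  - by exists (p.1, p.2); split => //=; lra.
  - by exists (p.1 + t / 2 * w, p.2); split => //=; lra.
  - by exists (p.1, p.2 + t / 2 * v); split => //=; lra.
  - by exists (p.1 + t / 2 * w, p.2 + t / 2 * v); split => //=; lra.
pose t n : R := 2^-1 ^+ n.
have t0 n : 0 < t n by rewrite exprn_gt0// invr_gt0.
have tS n : t n / 2 = t n.+1 by rewrite /t exprSr.
pose u := fix u n : R * R := if n is m.+1 then xget (u m) (good (t m) (u m)) else (a, c).
have uP n : ~ P (u n).1 (u n).2 (t n).
  elim: n => [|n IH]; first by rewrite /t expr0.
  rewrite /= -tS; have [q qg] := goodP _ _ (t0 n) IH.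
  by case: xgetP => [q' _ []|/(_ q)/(_ qg)].
have ug n : good (t n) (u n) (u n.+1).
  have [q qg] := goodP _ _ (t0 n) (uP n).
  by rewrite /=; case: xgetP => [q' _ //|/(_ q)/(_ qg)].
have mono n m : (n <= m)%N -> [/\ (u n).1 <= (u m).1,
    (u m).1 + t m * w <= (u n).1 + t n * w, (u n).2 <= (u m).2 &
    (u m).2 + t m * v <= (u n).2 + t n * v].
  elim: m => [|m IH]; first by rewrite leqn0 => /eqP ->.
  rewrite leq_eqVlt => /orP[/eqP ->//|]; rewrite ltnS => /IH[h1 h2 h3 h4].
  have [_ g1 g2 g3 g4] := ug m; rewrite tS in g2 g4.
  by split; lra.
(* Every left end lies below every right end, so the suprema of the left ends lie in all the
   rectangles. *)
have cross n m : (u m).1 <= (u n).1 + t n * w /\ (u m).2 <= (u n).2 + t n * v.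
  have hw k : 0 < t k * w by rewrite mulr_gt0.
  have hv k : 0 < t k * v by rewrite mulr_gt0.
  have [/mono[h1 h2 h3 h4]|/ltnW/mono[h1 h2 h3 h4]] := leqP n m.
    by have := hw m; have := hv m; split; lra.
  by have := hw n; have := hv n; split; lra.
pose X := range (fun n => (u n).1); pose Y := range (fun n => (u n).2).
have X0 n : X (u n).1 by exists n.
have Y0 n : Y (u n).2 by exists n.
have hX : has_sup X by split; [exists (u 0%N).1|exists ((u 0%N).1 + t 0%N * w) => _ [m _ <-]; case: (cross 0%N m)].
have hY : has_sup Y by split; [exists (u 0%N).2|exists ((u 0%N).2 + t 0%N * v) => _ [m _ <-]; case: (cross 0%N m)].
have bX n : (u n).1 <= sup X <= (u n).1 + t n * w.
  apply/andP; split; first by apply: ub_le_sup => //; case: hX.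
  by apply: ge_sup; [exists (u 0%N).1|move=> _ [m _ <-]; case: (cross n m)].
have bY n : (u n).2 <= sup Y <= (u n).2 + t n * v.
  apply/andP; split; first by apply: ub_le_sup => //; case: hY.
  by apply: ge_sup; [exists (u 0%N).2|move=> _ [m _ <-]; case: (cross n m)].
have [||r r0 rP] := loc (x := sup X) (y := sup Y).
- by have := bX 0%N; rewrite /t expr0 mul1r.
- by have := bY 0%N; rewrite /t expr0 mul1r.
have [n nr] : exists n, t n < r.
  have [n _ nP'] : \forall n \near \oo, t n < r.
    have : t @ \oo --> (0 : R).
      by apply: cvg_expr; rewrite ger0_norm ?invr_ge0// invf_lt1// ltr1n.
    move/cvgrPdist_lt => /(_ _ r0); apply: filterS => n.
    by rewrite sub0r normrN gtr0_norm.
  by exists n; apply: nP' => /=.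
by apply: (uP n); apply: rP.
Qed.

End Cousin2.

Lemma cont_id (R : realType) (z : R[i]) : {for z, continuous (fun z : R[i] => z)}.
Proof. exact: cvg_id. Qed.
Arguments cont_id {R} z.

Section Goursat.
Variable R : realType.
Local Notation C := R[i].

(** The integral of f dz along the boundary of [a, b] x [c, e], counterclockwise; exchanging two
    bounds changes the sign. *)
Definition rect (f : C -> C) (a b c e : R) : C :=
  itg a b (fun s => f (s +i* c)) + 'i * itg c e (fun s => f (b +i* s))
  - itg a b (fun s => f (s +i* e)) - 'i * itg c e (fun s => f (a +i* s)).

Lemma Re_lin (x y : R) : x +i* y = x%:C + 'i * y%:C.
Proof. by rewrite [LHS]complexE. Qed.

Lemma cont_hor (y : R) : continuous (fun s : R => s +i* y : C).
Proof.
move=> s; have -> : (fun s : R => s +i* y : C) = (fun s => s%:C + 'i * y%:C).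
  by apply/funext => x; exact: Re_lin.
have h := (cvgCD (@continuous_real_complex R s) (@cvg_cst _ ('i * y%:C) _ _ _)).
exact: h.
Qed.

Lemma cont_ver (x : R) : continuous (fun s : R => x +i* s : C).
Proof.
move=> s; have -> : (fun s : R => x +i* s : C) = (fun s => x%:C + 'i * s%:C).
  by apply/funext => y; exact: Re_lin.
have h := (cvgCD (@cvg_cst _ x%:C _ _ _) (cvgCM (@cvg_cst _ 'i _ _ _) (@continuous_real_complex R s))).
exact: h.
Qed.

Lemma cont_fhor (f : C -> C) (y : R) : continuous f -> continuous (fun s => f (s +i* y)).
Proof. by move=> cf s; apply: continuous_comp; [exact: cont_hor|exact: cf]. Qed.

Lemma cont_fver (f : C -> C) (x : R) : continuous f -> continuous (fun s => f (x +i* s)).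
Proof. by move=> cf s; apply: continuous_comp; [exact: cont_ver|exact: cf]. Qed.

Lemma rd_hor (y s : R) : rd (fun s => s +i* y) s 1.
Proof.
rewrite -(addr0 1); apply: eq_der (derD (der_id _ s) (der_cst _ ('i * y%:C) s)) => x.
by rewrite Re_lin.
Qed.

Lemma rd_ver (x s : R) : rd (fun s => x +i* s) s 'i.
Proof.
rewrite -(mulr1 'i) -(add0r ('i * 1)).
apply: eq_der (derD (der_cst _ x%:C s) (derZ 'i (der_id _ s))) => y.
by rewrite Re_lin.
Qed.

Lemma rd_fhor (F : C -> C) (y s : R) d : cd F (s +i* y) d -> rd (fun s => F (s +i* y)) s d.
Proof.
move=> dF; have := der_comp (@cont_hor y s) (rd_hor y s) dF.
by rewrite mulr1.
Qed.

Lemma rd_fver (F : C -> C) (x s : R) d : cd F (x +i* s) d -> rd (fun s => F (x +i* s)) s (d * 'i).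
Proof. by move=> dF; exact: der_comp (@cont_ver x s) (rd_ver x s) dF. Qed.

Definition inb (a b x : R) := Num.min a b <= x <= Num.max a b.

Lemma inb1 a b : inb a b a. Proof. by rewrite /inb ge_min le_max !lexx. Qed.
Lemma inb2 a b : inb a b b. Proof. by rewrite /inb ge_min le_max !lexx !orbT. Qed.
Lemma inbC a b x : inb a b x -> inb b a x.
Proof. by rewrite /inb minC maxC. Qed.
Lemma inbE a b x : a <= b -> inb a b x = (a <= x <= b).
Proof. by move=> h; rewrite /inb min_l// max_r. Qed.

Lemma rect_prim (f F : C -> C) a b c e : continuous f ->
  (forall x y, inb a b x -> inb c e y -> cd F (x +i* y) (f (x +i* y))) ->
  rect f a b c e = 0.
Proof.
move=> cf dF.
have h y : inb c e y -> itg a b (fun s => f (s +i* y)) = F (b +i* y) - F (a +i* y).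
  move=> yb; apply: (@itgE R (fun s => F (s +i* y))); first exact: cont_fhor.
  by move=> x xb; apply: rd_fhor; exact: dF.
have v x : inb a b x -> 'i * itg c e (fun s => f (x +i* s)) = F (x +i* e) - F (x +i* c).
  move=> xb; rewrite -itgZ; last exact: cont_fver.
  apply: (@itgE R (fun s => F (x +i* s))).
    move=> s; have h1 := contM (cont_cst 'i s) (@cont_fver f x cf s); exact: h1.
  by move=> y yb; rewrite mulrC; apply: rd_fver; exact: dF.
rewrite /rect (h _ (inb1 _ _)) (h _ (inb2 _ _)) (v _ (inb1 _ _)) (v _ (inb2 _ _)).
by ring.
Qed.

Lemma rectD (f g : C -> C) a b c e : continuous f -> continuous g ->
  rect (fun z => f z + g z) a b c e = rect f a b c e + rect g a b c e.
Proof.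
move=> cf cg; rewrite /rect !itgD; [by ring|..]; by
  [exact: cont_fhor|exact: cont_fver].
Qed.

Lemma rect_split (f : C -> C) a m b c n e : rect f a b c e =
  rect f a m c n + rect f m b c n + rect f a m n e + rect f m b n e.
Proof. by rewrite /rect /itg; ring. Qed.

Lemma rectNx (f : C -> C) a b c e : rect f b a c e = - rect f a b c e.
Proof. by rewrite /rect /itg; ring. Qed.

Lemma rectNy (f : C -> C) a b c e : rect f a b e c = - rect f a b c e.
Proof. by rewrite /rect /itg; ring. Qed.

(** Reduces a rectangle to four that have a corner at (x, y), which will be the exceptional
    point. *)
Lemma rect_corner (f : C -> C) x y a b c e : rect f a b c e =
  rect f x b y e - rect f x a y e - rect f x b y c + rect f x a y c.
Proof. by rewrite /rect /itg; ring. Qed.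

Lemma rectxx (f : C -> C) a c e : rect f a a c e = 0.
Proof. by rewrite /rect /itg; ring. Qed.

Lemma rectyy (f : C -> C) a b c : rect f a b c c = 0.
Proof. by rewrite /rect /itg; ring. Qed.

Lemma rect_bound (f : C -> C) a b c e M : continuous f ->
  (forall x y, inb a b x -> inb c e y -> ab (f (x +i* y)) <= M) ->
  ab (rect f a b c e) <= 2 * M * (`|b - a| + `|e - c|).
Proof.
move=> cf fM.
have h y : inb c e y -> ab (itg a b (fun s => f (s +i* y))) <= M * `|b - a|.
  by move=> yb; apply: itg_bound' => [|x xb]; [exact: cont_fhor|exact: fM].
have v x : inb a b x -> ab ('i * itg c e (fun s => f (x +i* s))) <= M * `|e - c|.
  move=> xb; rewrite abM abi mul1r.
  by apply: itg_bound' => [|y yb]; [exact: cont_fver|exact: fM].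
rewrite /rect; apply: le_trans (abD _ _) _; rewrite abN.
apply: le_trans (lerD (abD _ _) (lexx _)) _; rewrite abN.
apply: le_trans (lerD (lerD (abD _ _) (lexx _)) (lexx _)) _.
have := h _ (inb1 _ _); have := h _ (inb2 _ _).
have := v _ (inb1 _ _); have := v _ (inb2 _ _).
by lra.
Qed.

Lemma goursat_lt (f : C -> C) a b c e : a < b -> c < e -> continuous f ->
  (forall x y, a <= x <= b -> c <= y <= e -> exists d, cd f (x +i* y) d) ->
  rect f a b c e = 0.
Proof.
move=> ltab ltce cf df; apply/eqP; rewrite -ab_eq0 eq_le ab_ge0 andbT.
apply/ler_addgt0Pr => eps eps0; rewrite add0r.
pose w := b - a; pose v := e - c.
have w0 : 0 < w by rewrite subr_gt0.
have v0 : 0 < v by rewrite subr_gt0.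
(* A bound by the area scale adds up under quartering, since 4 (t / 2)^2 = t^2. *)
pose P a' c' t := ab (rect f a' (a' + t * w) c' (c' + t * v)) <= eps * t ^+ 2.
suff : P a c 1 by rewrite /P !mul1r /w /v expr1n mulr1 !(addrC _ (_ - _)) !subrK.
apply: (@cousin2 R P a c w v w0 v0); last first.
  move=> a' c' t t0; rewrite /P => h1 h2 h3 h4.
  rewrite (rect_split f a' (a' + t / 2 * w) _ c' (c' + t / 2 * v)).
  have e1 : a' + t / 2 * w + t / 2 * w = a' + t * w by lra.
  have e2 : c' + t / 2 * v + t / 2 * v = c' + t * v by lra.
  rewrite e1 in h2 h4; rewrite e2 in h3 h4.
  apply: le_trans (abD _ _) _; apply: le_trans (lerD (abD _ _) (lexx _)) _.
  apply: le_trans (lerD (lerD (abD _ _) (lexx _)) (lexx _)) _.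
  have -> : eps * t ^+ 2 = eps * (t / 2) ^+ 2 + eps * (t / 2) ^+ 2
     + eps * (t / 2) ^+ 2 + eps * (t / 2) ^+ 2 by field.
  by rewrite !lerD.
move=> x y xab yab.
have [d dd] : exists d, cd f (x +i* y) d.
  apply: df; first by move: xab; rewrite /w addrC subrK.
  by move: yab; rewrite /v addrC subrK.
set z0 := x +i* y in dd.
(* The affine part [g] of [f] at the tag has a primitive and integrates to 0. The remainder is at
   most del t (w + v) on a rectangle with |sides| t w and t v, so [rect_bound] gives 2 del (t (w +
   v))^2 = eps t^2. *)
pose del := eps / (2 * (w + v) ^+ 2).
have wv0 : 0 < w + v by rewrite addr_gt0.
have del0 : 0 < del by rewrite divr_gt0// mulr_gt0// exprn_gt0.
have /der_epsP/(_ del del0)/nbhs_ab[r r0 rH] := dd.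
exists (r / (w + v)); first by rewrite divr_gt0.
move=> a' c' t t0 tr xa yc; rewrite /P.
pose g z := f z0 + d * (z - z0).
have cg : continuous g.
  move=> z; have h1 := contD (cont_cst (f z0) z) (contM (cont_cst d z) (contB (cont_id z) (cont_cst z0 z))); exact: h1.
have g0 p q p' q' : rect g p q p' q' = 0.
  apply: (@rect_prim g (fun z => f z0 * z + d / 2 * ((z - z0) * (z - z0))) p q p' q' cg) => u u' _ _.
  have dz := derB (der_id id (u +i* u')) (der_cst id z0 (u +i* u')).
  have cz : {for (u +i* u'), continuous (fun z : C => z - z0)}.
    have h1 := contB (cont_id (u +i* u')) (cont_cst z0 _); exact: h1.
  have := derD (derZ (f z0) (der_id id (u +i* u'))) (derZ (d / 2) (derM cz dz dz)).
  by congr (der _ _ _ _); rewrite /g; field.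
pose h z := f z - g z.
have ch : continuous h.
  move=> z; have h1 := contB (cf z) (cg z); exact: h1.
have -> : rect f a' (a' + t * w) c' (c' + t * v) = rect h a' (a' + t * w) c' (c' + t * v).
  have := rectD a' (a' + t * w) c' (c' + t * v) ch cg; rewrite g0 addr0 => <-.
  have -> : (fun z => h z + g z) = f by apply/funext => z; rewrite /h subrK.
  by [].
have tw : 0 < t * w by rewrite mulr_gt0.
have tv : 0 < t * v by rewrite mulr_gt0.
have tr' : t * (w + v) < r by rewrite -ltr_pdivlMr.
have := @rect_bound h a' (a' + t * w) c' (c' + t * v) (del * (t * (w + v))) ch.
have -> : a' + t * w - a' = t * w by ring.
have -> : c' + t * v - c' = t * v by ring.
rewrite !gtr0_norm// => hb; apply: le_trans (hb _) _.
  move=> p q; rewrite !inbE; [|lra|lra] => pb qb.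
  have zz : ab (p +i* q - z0) <= t * (w + v).
    apply: le_trans (ab_ReIm _) _; rewrite /z0 /= mulrDr lerD// ler_norml; apply/andP; split; lra.
  have := rH (p +i* q) (le_lt_trans zz tr').
  rewrite /h /g /= opprD addrA => /le_trans; apply.
  by rewrite ler_wpM2l// ltW.
rewrite le_eqVlt; apply/orP; left; apply/eqP; rewrite /del; field.
by rewrite gt_eqF.
Qed.

Lemma goursat (f : C -> C) a b c e : continuous f ->
  (forall x y, inb a b x -> inb c e y -> exists d, cd f (x +i* y) d) ->
  rect f a b c e = 0.
Proof.
move=> cf; wlog leab : a b / a <= b.
  move=> H df; have [leab|/ltW ba] := leP a b; first exact: H.
  rewrite rectNx H ?oppr0// => x y xb yb.
  by apply: df => //; exact: inbC.
wlog lece : c e / c <= e.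
  move=> H df; have [lece|/ltW ec] := leP c e; first exact: H.
  rewrite rectNy H ?oppr0// => x y xb yb.
  by apply: df => //; exact: inbC.
move=> df; move: leab; rewrite le_eqVlt => /orP[/eqP ->|ltab]; first exact: rectxx.
move: lece; rewrite le_eqVlt => /orP[/eqP ->|ltce]; first exact: rectyy.
apply: goursat_lt => // x y xb yb; apply: df; rewrite inbE//; exact: ltW.
Qed.

End Goursat.

Section LocalPrimitive.
Variable R : realType.
Local Notation C := R[i].

Lemma inb_ball (x0 r a b x : R) : `|a - x0| <= r -> `|b - x0| <= r -> inb a b x ->
  `|x - x0| <= r.
Proof.
rewrite /inb !ler_norml => /andP[h1 h2] /andP[h3 h4].
by case: (leP a b) => h5 /andP[h6 h7]; apply/andP; split; lra.
Qed.

Lemma inb_conv (a b s : R) : 0 < s -> s < 1 -> inb a b (a + s * (b - a)).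
Proof.
move=> s0 s1; rewrite /inb; case: (leP a b) => h5; apply/andP; split; nra.
Qed.

Lemma inb_ne (a b s x : R) : 0 < s -> s < 1 -> a != b ->
  inb (a + s * (b - a)) b x -> x != a.
Proof.
move=> s0 s1 anb; rewrite /inb; have [ab|ba|/eqP] := ltgtP a b; last by rewrite (negPf anb).
  have : 0 < s * (b - a) by rewrite mulr_gt0// subr_gt0.
  by case: (leP (a + s * (b - a)) b) => h1 h2 /andP[h3 h4]; apply/eqP; lra.
have : 0 < s * (a - b) by rewrite mulr_gt0// subr_gt0.
by case: (leP (a + s * (b - a)) b) => h1 h2 /andP[h3 h4]; rewrite neq_lt; apply/orP; left; lra.
Qed.

Section Except.
Variables (f : C -> C) (x0 y0 r px py : R).
Hypothesis r0 : 0 < r.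
Hypothesis cf : continuous f.
Hypothesis df : forall x y, `|x - x0| <= r -> `|y - y0| <= r ->
  ~ (x = px /\ y = py) -> exists d, cd f (x +i* y) d.

(** Only the corner of the rectangle is exceptional. A small rectangle at it is cut off; the three
    others vanish by Goursat, and the small one is bounded by its perimeter, as [f] is bounded near
    the corner. *)
Lemma rect_corner0 b e : `|px - x0| <= r -> `|py - y0| <= r ->
  `|b - x0| <= r -> `|e - y0| <= r -> rect f px b py e = 0.
Proof.
move=> hx hy hb he; have [<-|pb] := eqVneq px b; first exact: rectxx.
have [<-|pe] := eqVneq py e; first exact: rectyy.
apply/eqP; rewrite -ab_eq0 eq_le ab_ge0 andbT.
apply/ler_addgt0Pr => eps eps0; rewrite add0r.
pose p := px +i* py.
have /(@contP R C f p)/(_ 1 ltr01)/nbhs_ab[d d0 dH] := @cf p.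
pose M := ab (f p) + 1.
have M0 : 0 < M by rewrite ltr_wpDl// ab_ge0.
pose K := `|b - px| + `|e - py|.
have K0 : 0 < K by rewrite ltr_wpDr ?normr_ge0// normr_gt0 subr_eq0 eq_sym.
(* The three terms give [s < 1], [s * K < d], so that [f] is bounded by [M] on the small rectangle,
   and 2 M s K <= eps, the bound of [rect_bound]. *)
pose s := Num.min (1 / 2) (Num.min (d / (2 * K)) (eps / (2 * M * K))).
have s0 : 0 < s.
  rewrite !lt_min !divr_gt0// ?mulr_gt0//.
have s1 : s < 1 by rewrite gt_min; apply/orP; left; lra.
have sd : s * K < d.
  have : s <= d / (2 * K) by rewrite !ge_min lexx orbT.
  by rewrite ler_pdivlMr ?mulr_gt0//; nra.
have se : 2 * M * (s * K) <= eps.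
  have : s <= eps / (2 * M * K) by rewrite !ge_min lexx !orbT.
  by rewrite ler_pdivlMr ?mulr_gt0//; lra.
pose m := px + s * (b - px); pose n := py + s * (e - py).
have mb : inb px b m by exact: inb_conv.
have ne : inb py e n by exact: inb_conv.
have hm : `|m - x0| <= r by exact: inb_ball hx hb mb.
have hn : `|n - y0| <= r by exact: inb_ball hy he ne.
rewrite (rect_split f px m b py n e).
have -> : rect f m b py n = 0.
  apply: (goursat cf) => x y xb yb; apply: df; first exact: inb_ball hm hb xb.
    exact: inb_ball hy hn yb.
  by move=> [xp _]; have := inb_ne s0 s1 pb xb; rewrite xp eqxx.
have -> : rect f px m n e = 0.
  apply: (goursat cf) => x y xb yb; apply: df; first exact: inb_ball hx hm xb.
    exact: inb_ball hn he yb.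
  by move=> [_ yp]; have := inb_ne s0 s1 pe yb; rewrite yp eqxx.
have -> : rect f m b n e = 0.
  apply: (goursat cf) => x y xb yb; apply: df; first exact: inb_ball hm hb xb.
    exact: inb_ball hn he yb.
  by move=> [xp _]; have := inb_ne s0 s1 pb xb; rewrite xp eqxx.
rewrite !addr0; apply: le_trans se.
have mE : `|m - px| = s * `|b - px| by rewrite /m addrC addKr normrM (gtr0_norm s0).
have nE : `|n - py| = s * `|e - py| by rewrite /n addrC addKr normrM (gtr0_norm s0).
have sK : s * K = `|m - px| + `|n - py| by rewrite /K mulrDr mE nE.
rewrite sK; apply: (rect_bound cf) => x y xb yb.
have : ab (f (x +i* y) - f p) < 1.
  apply: dH; apply: le_lt_trans sd; apply: le_trans (ab_ReIm _) _ => /=.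
  rewrite sK lerD//.
    by apply: (@inb_ball px _ px m) => //; rewrite subrr normr0 normr_ge0.
  by apply: (@inb_ball py _ py n) => //; rewrite subrr normr0 normr_ge0.
by have := abB (f (x +i* y)) (f p); rewrite /M; lra.
Qed.

End Except.

Lemma rect0_except (f : C -> C) (x0 y0 r : R) (p : C) a b c e :
  0 < r -> continuous f ->
  (forall z, `|complex.Re z - x0| <= r -> `|complex.Im z - y0| <= r -> z != p ->
     exists d, cd f z d) ->
  `|a - x0| <= r -> `|b - x0| <= r -> `|c - y0| <= r -> `|e - y0| <= r ->
  rect f a b c e = 0.
Proof.
move=> r0 cf df ha hb hc he.
(* If [p] is outside the square there is no exceptional point in it, and the centre may take its
   place. *)
wlog [hx hy] : p df / `|complex.Re p - x0| <= r /\ `|complex.Im p - y0| <= r.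
  move=> H; have [[hx hy]|np] := pselect (`|complex.Re p - x0| <= r /\ `|complex.Im p - y0| <= r).
    by apply: (H p).
  apply: (H (x0 +i* y0)) => [z zx zy _|]; last by rewrite /= !subrr normr0 (ltW r0).
  by apply: df => //; apply: contra_notN np => /eqP <-.
have df' x y : `|x - x0| <= r -> `|y - y0| <= r ->
    ~ (x = complex.Re p /\ y = complex.Im p) -> exists d, cd f (x +i* y) d.
  move=> xr yr xyp; apply: df => //.
  by apply: contra_notN xyp => /eqP <-.
have h := rect_corner0 cf df'.
by rewrite (rect_corner f (complex.Re p) (complex.Im p)) !h// !subr0 addr0.
Qed.

Section Clamp.
Variables (x0 r : R).
(** The retraction of the line onto an interval. It extends a function on a square continuously to
    the plane, because [itg] is controlled only for functions continuous on the whole line. *)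
Definition clamp (x : R) := Num.max (x0 - r) (Num.min (x0 + r) x).

Lemma clampE x : `|x - x0| <= r -> clamp x = x.
Proof.
rewrite ler_norml => /andP[h1 h2]; rewrite /clamp min_r ?max_r//; lra.
Qed.

Lemma clamp_ball x : 0 < r -> `|clamp x - x0| <= r.
Proof.
move=> r0; rewrite /clamp ler_norml; case: (leP (x0 + r) x) => h;
  [case: (leP (x0 - r) (x0 + r)) => h2|case: (leP (x0 - r) x) => h2]; apply/andP; split; lra.
Qed.

Lemma clamp_lip x y : `|clamp x - clamp y| <= `|x - y|.
Proof.
rewrite /clamp; wlog : x y / y <= x.
  move=> H; have [/H|/ltW xy] := leP y x; first by apply.
  by rewrite distrC (distrC x); exact: H.
move=> yx; rewrite (ger0_norm (x := x - y)) ?subr_ge0// ler_norml.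
have [h1|h1] := leP (x0 + r) x; have [h2|h2] := leP (x0 + r) y.
- by apply/andP; split; lra.
- have [h3|h3] := leP (x0 - r) (x0 + r); have [h4|h4] := leP (x0 - r) y; apply/andP; split; lra.
- by exfalso; lra.
- have [h3|h3] := leP (x0 - r) x; have [h4|h4] := leP (x0 - r) y; apply/andP; split; lra.
Qed.
End Clamp.

(** At the one point [p] mere continuity is enough. Difference quotients in Cauchy's formula and
    removable singularities are of this kind. *)
Lemma local_prim (f : C -> C) (z0 : C) (rho : R) (p : C) : 0 < rho ->
  (forall z, ab (z - z0) < rho -> {for z, continuous f}) ->
  (forall z, ab (z - z0) < rho -> z != p -> exists d, cd f z d) ->
  exists F : C -> C, forall z, ab (z - z0) < rho / 4 -> cd F z (f z).
Proof.
(* The square of half side rho / 3 lies in the disc, as its points are within 2 rho / 3 of the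
   centre. On the smaller square of half side rho / 4 the clamped function [g] agrees with [f] in a
   neighbourhood of each point, hence has the same derivatives. *)
move=> rho0 cf df; pose r := rho / 3; pose r' := rho / 4.
have r0 : 0 < r by rewrite divr_gt0.
have r'0 : 0 < r' by rewrite divr_gt0.
have r'r : r' < r by rewrite /r /r'; lra.
pose x0 := complex.Re z0; pose y0 := complex.Im z0.
pose K z : C := clamp x0 r (complex.Re z) +i* clamp y0 r (complex.Im z).
have KK z w : ab (K z - K w) <= 2 * ab (z - w).
  apply: le_trans (ab_ReIm _) _ => /=.
  have h1 := clamp_lip x0 r (complex.Re z) (complex.Re w).
  have h2 := clamp_lip y0 r (complex.Im z) (complex.Im w).
  have h3 := Re_ab (z - w); have h4 := Im_ab (z - w).
  rewrite ReD ReN in h3; rewrite ImD ImN in h4.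
  by lra.
have Kin z : ab (K z - z0) < rho.
  apply: le_lt_trans (ab_ReIm _) _.
  rewrite ReD ReN ImD ImN /=.
  have h1 := clamp_ball x0 (complex.Re z) r0.
  have h2 := clamp_ball y0 (complex.Im z) r0.
  by rewrite -/x0 -/y0; rewrite /r in h1 h2 *; lra.
have KE z : `|complex.Re z - x0| <= r -> `|complex.Im z - y0| <= r -> K z = z.
  by move=> h1 h2; rewrite /K !clampE//; case: (z).
pose g z := f (K z).
have cg : continuous g.
  move=> z; apply/(@contP R C g z) => eps eps0.
  have /(@contP R C f _)/(_ eps eps0)/nbhs_ab[d d0 dH] := cf _ (Kin z).
  apply/nbhs_ab; exists (d / 2); first by rewrite divr_gt0.
  by move=> w wz; apply: dH; apply: le_lt_trans (KK _ _) _; lra.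
have fg z : ab (z - z0) < r -> \forall w \near z, f w = g w.
  move=> zr; apply/nbhs_ab; exists (r - ab (z - z0)); first by rewrite subr_gt0.
  move=> w wz; rewrite /g KE//.
    have := Re_ab (w - z0); rewrite ReD ReN => /le_trans; apply.
    by have := abB3 w z z0; lra.
  have := Im_ab (w - z0); rewrite ImD ImN => /le_trans; apply.
  by have := abB3 w z z0; lra.
have gf z : `|complex.Re z - x0| <= r' -> `|complex.Im z - y0| <= r' -> g z = f z.
  by move=> h1 h2; rewrite /g KE//; apply: le_trans (ltW r'r).
have dg z : `|complex.Re z - x0| <= r' -> `|complex.Im z - y0| <= r' -> z != p ->
     exists d, cd g z d.
  move=> h1 h2 zp; have [|d dd] := df z _ zp.
    by apply: le_lt_trans (ab_ReIm _) _; rewrite ReD ReN ImD ImN -/x0 -/y0 /r' in h1 h2 *; lra.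
  exists d; apply: der_ext dd; apply/nbhs_ab; exists (r - r'); first by rewrite subr_gt0.
  move=> w wz; rewrite /g KE//.
    have := Re_ab (w - z); rewrite ReD ReN => h3.
    by have := ler_normD (complex.Re w - complex.Re z) (complex.Re z - x0); rewrite addrA subrK; lra.
  have := Im_ab (w - z); rewrite ImD ImN => h3.
  by have := ler_normD (complex.Im w - complex.Im z) (complex.Im z - y0); rewrite addrA subrK; lra.
have rect0 a b c e : `|a - x0| <= r' -> `|b - x0| <= r' -> `|c - y0| <= r' ->
    `|e - y0| <= r' -> rect g a b c e = 0.
  exact: (rect0_except r'0 cg dg).
pose F z := itg x0 (complex.Re z) (fun s => g (s +i* y0)) +
            'i * itg y0 (complex.Im z) (fun s => g (complex.Re z +i* s)).
exists F => z zr.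
have zx : `|complex.Re z - x0| < r'.
  by apply: le_lt_trans zr; have := Re_ab (z - z0); rewrite ReD ReN.
have zy : `|complex.Im z - y0| < r'.
  by apply: le_lt_trans zr; have := Im_ab (z - z0); rewrite ImD ImN.
apply/der_epsP => eps eps0; rewrite -(gf z) ?(ltW zx) ?(ltW zy)//.
have e20 : 0 < eps / 2 by rewrite divr_gt0.
have /(@contP R C g z)/(_ _ e20)/nbhs_ab[d d0 dH] := cg z.
pose del := Num.min (d / 2) (r' - ab (z - z0)).
have del0 : 0 < del by rewrite lt_min subr_gt0 zr divr_gt0.
apply/nbhs_ab; exists del => // w wz.
have wd : ab (w - z) < d / 2 by apply: lt_le_trans wz _; rewrite ge_min lexx.
have wr : ab (w - z0) < r'.
  have : ab (w - z) < r' - ab (z - z0) by apply: lt_le_trans wz _; rewrite ge_min lexx orbT.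
  by have := abB3 w z z0; lra.
have wx : `|complex.Re w - x0| < r'.
  by apply: le_lt_trans wr; have := Re_ab (w - z0); rewrite ReD ReN.
have wy : `|complex.Im w - y0| < r'.
  by apply: le_lt_trans wr; have := Im_ab (w - z0); rewrite ImD ImN.
set x := complex.Re z in zx *; set y := complex.Im z in zy *.
set x' := complex.Re w in wx *; set y' := complex.Im w in wy *.
have y00 : `|y0 - y0| <= r' by rewrite subrr normr0 ltW.
(* [F] integrates horizontally from the centre and then vertically; the vanishing integral over a
   rectangle moves the horizontal part of the increment up to the height of [z]. *)
have key : F w - F z = itg x x' (fun s => g (s +i* y)) + 'i * itg y y' (fun s => g (x' +i* s)).
  have := rect0 x x' y0 y (ltW zx) (ltW wx) y00 (ltW zy).
  rewrite /rect /F -/x -/y -/x' -/y' => h.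
  rewrite -(itg_chasles x0 x x') -(itg_chasles y0 y y').
  apply/eqP; rewrite -subr_eq0 -h; apply/eqP; ring.
have gE : g z * (w - z) = itg x x' (fun=> g z) + 'i * itg y y' (fun=> g z).
  have -> : w - z = (x' - x)%:C + 'i * (y' - y)%:C.
    by rewrite [LHS]complexE ReD ReN ImD ImN.
  by rewrite !itg_cst; ring.
have ch (u : R) : continuous (fun s => g (s +i* u)) by exact: cont_fhor.
have cv (u : R) : continuous (fun s => g (u +i* s)) by exact: cont_fver.
have cN : continuous (fun _ : R => g z) by move=> s; exact: cvg_cst.
have i1 := itgB x x' (ch y) cN.
have i2 := itgB y y' (cv x') cN.
have -> : F w - F z - g z * (w - z) =
  itg x x' (fun s => g (s +i* y) - g z) + 'i * itg y y' (fun s => g (x' +i* s) - g z).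
  by rewrite key gE i1 i2; ring.
have hx : `|x' - x| <= ab (w - z) by have := Re_ab (w - z); rewrite ReD ReN.
have hy : `|y' - y| <= ab (w - z) by have := Im_ab (w - z); rewrite ImD ImN.
have b1 : ab (itg x x' (fun s => g (s +i* y) - g z)) <= eps / 2 * `|x' - x|.
  apply: itg_bound'.
    by move=> s; have h := contB (ch y s) (cont_cst (g z) s); exact: h.
  move=> s sb; apply: ltW; apply: dH; apply: le_lt_trans (ab_ReIm _) _.
  rewrite ReD ReN ImD ImN /= -/x -/y subrr normr0 addr0.
  have : `|s - x| <= `|x' - x| by apply: (inb_ball _ _ sb); rewrite ?subrr ?normr0 ?normr_ge0.
  by lra.
have b2 : ab (itg y y' (fun s => g (x' +i* s) - g z)) <= eps / 2 * `|y' - y|.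
  apply: itg_bound'.
    by move=> s; have h := contB (cv x' s) (cont_cst (g z) s); exact: h.
  move=> s sb; apply: ltW; apply: dH; apply: le_lt_trans (ab_ReIm _) _.
  rewrite ReD ReN ImD ImN /= -/x -/y.
  have : `|s - y| <= `|y' - y| by apply: (inb_ball _ _ sb); rewrite ?subrr ?normr0 ?normr_ge0.
  by lra.
apply: le_trans (abD _ _) _; rewrite abM abi mul1r.
have h1 : eps / 2 * `|x' - x| <= eps / 2 * ab (w - z) by rewrite ler_wpM2l// ltW.
have h2 : eps / 2 * `|y' - y| <= eps / 2 * ab (w - z) by rewrite ler_wpM2l// ltW.
by lra.
Qed.

End LocalPrimitive.

(** * Cauchy's formula and its consequences *)

Section Circle.
Variable R : realType.
Local Notation C := R[i].

Definition expi (t : R) : C := cos t +i* sin t.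

Lemma rd_expi t : rd expi t ('i * expi t).
Proof.
have h := derD (is_derive_rd (is_derive_cos t)) (derZ 'i (is_derive_rd (is_derive_sin t))).
have e1 : (- sin t)%:C + 'i * (cos t)%:C = 'i * expi t.
  have ii : 'i * 'i = -1 :> C by rewrite -expr2 sqrCi.
  rewrite /expi Re_lin mulrDr mulrA ii mulN1r rmorphN; exact: addrC.
rewrite -e1; apply: eq_der h => s; by rewrite /expi Re_lin.
Qed.

Lemma ab_expi t : ab (expi t) = 1.
Proof. by rewrite /ab normc_def /= cos2Dsin2 sqrtr1. Qed.

Lemma expi0 : expi 0 = 1.
Proof. by rewrite /expi cos0 sin0. Qed.

Lemma expi2pi : expi (2 * pi) = 1.
Proof. by rewrite /expi mulr_natl cos2pi sin2pi. Qed.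

Lemma cont_expi : continuous expi.
Proof. by move=> t; exact: rd_cont (rd_expi t). Qed.

Variables (w0 u : C).
(** The radius vector [u] is complex, so that a circle can start at a prescribed point; the maximum
    principle relies on it. *)
Definition circ t := w0 + u * expi t.
Definition dcirc t := 'i * (u * expi t).

Lemma rd_circ t : rd circ t (dcirc t).
Proof.
have h := derD (der_cst (real_complex R) w0 t) (derZ u (rd_expi t)).
have -> : dcirc t = 0 + u * ('i * expi t) by rewrite /dcirc; ring.
exact: h.
Qed.

Lemma circ_ab t : ab (circ t - w0) = ab u.
Proof. by rewrite /circ addrC addKr abM ab_expi mulr1. Qed.

Lemma dcirc_ab t : ab (dcirc t) = ab u.
Proof. by rewrite /dcirc !abM abi ab_expi mulr1 mul1r. Qed.

Lemma circ2pi : circ (2 * pi) = circ 0.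
Proof. by rewrite /circ expi2pi expi0. Qed.

Lemma cont_circ : continuous circ.
Proof. by move=> t; exact: rd_cont (rd_circ t). Qed.

Lemma cont_dcirc : continuous dcirc.
Proof.
move=> t; have h := contM (cont_cst 'i t) (contM (cont_cst u t) (@cont_expi t)); exact: h.
Qed.

Definition oint (h : R -> C) : C := itg 0 (2 * pi) h.

Lemma pi2_ge0 : 0 <= 2 * pi :> R.
Proof. by rewrite mulr_ge0 ?pi_ge0. Qed.

Lemma oint_bound (h : R -> C) M : continuous h ->
  (forall t, 0 <= t <= 2 * pi -> ab (h t) <= M) -> ab (oint h) <= M * (2 * pi).
Proof. by move=> ch hM; have := itg_bound pi2_ge0 ch hM; rewrite subr0.
Qed.

Lemma oint_prim (F f : C -> C) : continuous (fun t => f (circ t)) ->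
  (forall t, cd F (circ t) (f (circ t))) -> oint (fun t => f (circ t) * dcirc t) = 0.
Proof.
move=> cf dF; have c t : {for t, continuous (fun t => f (circ t) * dcirc t)}.
  exact: contM (cf t) (@cont_dcirc t).
have d t : rd (fun t => F (circ t)) t (f (circ t) * dcirc t).
  exact: der_comp (@cont_circ t) (rd_circ t) (dF t).
have e : oint (fun t => f (circ t) * dcirc t) = _ := itgE c (fun x _ => d x).
by rewrite e circ2pi subrr.
Qed.

End Circle.

Section ConvexConstant.
Variable R : realType.
Local Notation C := R[i].

Lemma cd_cst (F : C -> C) (z0 : C) (r : R) :
  (forall z, ab (z - z0) < r -> cd F z 0) -> forall z, ab (z - z0) < r -> F z = F z0.
Proof.
move=> dF z zr; pose g (t : R) := z0 + (z - z0) * t%:C.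
have dg t : rd g t (z - z0).
  have h := derD (der_cst (real_complex R) z0 t) (derZ (z - z0) (der_id (real_complex R) t)).
  have e : z - z0 = 0 + (z - z0) * 1 by rewrite add0r mulr1.
  rewrite e; exact: h.
have cg t : {for t, continuous g} by exact: rd_cont (dg t).
have gE t : 0 <= t <= 1 -> ab (g t - z0) < r.
  move=> /andP[t0 t1]; rewrite /g addrC addKr abM abC ger0_norm//.
  by apply: le_lt_trans zr; rewrite -[leRHS]mulr1 ler_wpM2l// ab_ge0.
have : F (g 0) = F (g 1).
  apply: (@rd_cst R (fun t => F (g t)) 0 1) => t; rewrite min_l// max_r// => /gE /dF dFt.
  have h := der_comp (cg t) (dg t) dFt.
  by rewrite mul0r in h; exact: h.
by rewrite /g mulr0 addr0 mulr1 addrC subrK => ->.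
Qed.

End ConvexConstant.

Section Kernel.
Variable R : realType.
Local Notation C := R[i].

(** A quadratic remainder, uniform in [t], is integrated directly, with no limit theorem under the
    integral. *)
Lemma diff_under (k k1 : C -> R -> C) (w : C) (del K : R) : 0 < del ->
  (forall w', ab (w' - w) < del -> continuous (k w')) -> continuous (k1 w) ->
  (forall w' t, ab (w' - w) < del -> 0 <= t <= 2 * pi ->
     ab (k w' t - k w t - (w' - w) * k1 w t) <= K * ab (w' - w) ^+ 2) ->
  cd (fun w' => oint (k w')) w (oint (k1 w)).
Proof.
move=> del0 ck ck1 kE; apply/der_epsP => e e0.
have K0 : 0 < `|K| * (2 * pi) + 1 by rewrite ltr_wpDl// mulr_ge0// pi2_ge0.
have e1 : 0 < Num.min del (e / (`|K| * (2 * pi) + 1)) by rewrite lt_min del0 divr_gt0.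
apply: filterS (near_ab w e1) => w'; rewrite lt_min => /andP[wd we].
have ckw' := ck _ wd.
have ckw : continuous (k w) by apply: ck; rewrite subrr ab0.
have c1 : continuous (fun t => k w' t - k w t).
  by move=> t; have h := contB (ckw' t) (ckw t); exact: h.
have c2 : continuous (fun t => (w' - w) * k1 w t).
  by move=> t; have h := contM (cont_cst (w' - w) t) (ck1 t); exact: h.
have c3 : continuous (fun t => k w' t - k w t - (w' - w) * k1 w t).
  by move=> t; have h := contB (c1 t) (c2 t); exact: h.
have i1 : oint (fun t => k w' t - k w t - (w' - w) * k1 w t) =
   oint (k w') - oint (k w) - oint (k1 w) * (w' - w).
  by rewrite /oint (itgB _ _ c1 c2) (itgB _ _ ckw' ckw) (itgZ _ _ _ ck1) (mulrC (w' - w)).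
rewrite -[X in ab X <= _]i1.
have b := oint_bound c3 (fun t => kE w' t wd).
apply: le_trans b _; rewrite expr2.
have a0 := ab_ge0 (w' - w).
have b1 : K * (ab (w' - w) * ab (w' - w)) * (2 * pi) <=
      `|K| * (ab (w' - w) * ab (w' - w)) * (2 * pi).
  by rewrite ler_wpM2r ?pi2_ge0// ler_wpM2r ?mulr_ge0// ler_norm.
apply: le_trans b1 _.
have -> : `|K| * (ab (w' - w) * ab (w' - w)) * (2 * pi) =
  (ab (w' - w) * (`|K| * (2 * pi))) * ab (w' - w) by ring.
rewrite ler_wpM2r//; move: we; rewrite ltr_pdivlMr// => we.
by apply: le_trans (ltW we); rewrite ler_wpM2l// lerDl.
Qed.

Variables (w0 u : C) (phi : R -> C) (M : R).
Hypothesis cphi : continuous phi.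
Hypothesis phiM : forall t, 0 <= t <= 2 * pi -> ab (phi t) <= M.

(** With [phi t] equal to f dz/dt on the circle, n = 1 is the Cauchy integrand; differentiation in
    [w] raises n. *)
Definition ker n (w : C) (t : R) := phi t * (circ w0 u t - w) ^- n.

Lemma circ_gap w t : ab u - ab (w - w0) <= ab (circ w0 u t - w).
Proof. by have := abB3 (circ w0 u t) w w0; rewrite circ_ab; lra. Qed.

Lemma cont_ker n w : ab (w - w0) < ab u -> continuous (ker n w).
Proof.
move=> wu t; have ne : circ w0 u t - w != 0.
  by rewrite -ab_gt0; have := circ_gap w t; lra.
have ne' : (circ w0 u t - w) ^+ n != 0 by rewrite expf_neq0.
have c1 := contB (@cont_circ R w0 u t) (cont_cst w t).
have c2 : {for t, continuous (fun t => (circ w0 u t - w) ^+ n)}.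
  elim: n ne' => [|n IH] ne'.
    by have h := cont_cst (1 : C) t; exact: h.
  have h := contM c1 (IH (expf_neq0 n ne)).
  have e : (fun t => (circ w0 u t - w) ^+ n.+1) = (fun t => (circ w0 u t - w) * (circ w0 u t - w) ^+ n).
    by apply/funext => s; rewrite exprS.
  by rewrite e; exact: h.
have c3 := @contV R R (fun t => (circ w0 u t - w) ^+ n) t ne' c2.
have h := contM (@cphi t) c3; exact: h.
Qed.

Lemma cd_ker1 w : ab (w - w0) < ab u ->
  cd (fun w => oint (ker 1 w)) w (oint (ker 2 w)).
Proof.
move=> wu; pose eta := ab u - ab (w - w0).
have eta0 : 0 < eta by rewrite subr_gt0.
have eta20 : 0 < eta / 2 by rewrite divr_gt0.
have ck w' : ab (w' - w) < eta / 2 -> continuous (ker 1 w').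
  move=> w'w; apply: cont_ker; have := abB3 w' w w0; rewrite /eta in w'w; lra.
(* With a = circ - w, b = circ - w' and h = w' - w, the remainder is phi h^2 / (a^2 b), where |a| >=
   eta and |b| >= eta / 2. *)
apply: (@diff_under (ker 1) (ker 2) w (eta / 2) (M * (2 / eta ^+ 3)) eta20 ck (cont_ker wu)).
move=> w' t w'w tpi.
have g1 : eta <= ab (circ w0 u t - w) by exact: circ_gap.
have g2 : eta / 2 <= ab (circ w0 u t - w').
  by have := circ_gap w' t; have := abB3 w' w w0; rewrite /eta in g1 w'w *; lra.
have n1 : circ w0 u t - w != 0 by rewrite -ab_gt0; lra.
have n2 : circ w0 u t - w' != 0 by rewrite -ab_gt0; lra.
have -> : ker 1 w' t - ker 1 w t - (w' - w) * ker 2 w t =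
  phi t * ((w' - w) ^+ 2 * ((circ w0 u t - w) ^- 2 * (circ w0 u t - w')^-1)).
  by rewrite /ker; field; rewrite n1 n2.
rewrite !abM !abV !abX mulrCA [X in X <= _]mulrC.
have sq0 : 0 <= ab (w' - w) ^+ 2 by rewrite exprn_ge0// ab_ge0.
apply: (ler_wpM2r sq0).
apply: ler_pM; rewrite ?ab_ge0 ?phiM//.
  by rewrite mulr_ge0 ?invr_ge0 ?exprn_ge0 ?ab_ge0.
have -> : 2 / eta ^+ 3 = eta ^- 2 * (eta / 2)^-1.
  by field; rewrite gt_eqF.
apply: ler_pM; rewrite ?invr_ge0 ?exprn_ge0 ?ab_ge0//.
  by rewrite lef_pV2 ?posrE ?exprn_gt0//; [rewrite lerXn2r ?nnegrE ?ab_ge0 ?(ltW eta0)|exact: lt_le_trans g1].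
by rewrite lef_pV2 ?posrE//; exact: lt_le_trans g2.
Qed.

Lemma cd_ker2 w : ab (w - w0) < ab u ->
  exists d, cd (fun w => oint (ker 2 w)) w d.
Proof.
move=> wu; pose eta := ab u - ab (w - w0).
have eta0 : 0 < eta by rewrite subr_gt0.
have eta20 : 0 < eta / 2 by rewrite divr_gt0.
pose k3 w t := 2 * ker 3 w t.
exists (oint (k3 w)).
have ck3 : continuous (k3 w).
  by move=> t; have h := contM (cont_cst 2 t) (@cont_ker 3 w wu t); exact: h.
have ck w' : ab (w' - w) < eta / 2 -> continuous (ker 2 w').
  move=> w'w; apply: cont_ker; have := abB3 w' w w0; rewrite /eta in w'w; lra.
(* In the same notation the remainder is phi h^2 (3 a - 2 h) / (a^3 b^2). As |a| <= 2 |u| and 2 |h|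
   <= |u|, the middle factor stays below 10 |u|. *)
apply: (@diff_under (ker 2) k3 w (eta / 2) (M * (10 * ab u * (eta ^- 3 * (eta / 2) ^- 2))) eta20 ck ck3).
move=> w' t w'w tpi.
have g1 : eta <= ab (circ w0 u t - w) by exact: circ_gap.
have g2 : eta / 2 <= ab (circ w0 u t - w').
  by have := circ_gap w' t; have := abB3 w' w w0; rewrite /eta in g1 w'w *; lra.
have n1 : circ w0 u t - w != 0 by rewrite -ab_gt0; lra.
have n2 : circ w0 u t - w' != 0 by rewrite -ab_gt0; lra.
pose a := circ w0 u t - w.
have -> : ker 2 w' t - ker 2 w t - (w' - w) * k3 w t =
  phi t * ((w' - w) ^+ 2 * ((3 * a - 2 * (w' - w)) * (a ^- 3 * (circ w0 u t - w') ^- 2))).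
  rewrite /k3 /ker /a; field; by rewrite n1 n2.
rewrite abM [X in _ * X]abM abX mulrCA [X in X <= _]mulrC.
have sq0 : 0 <= ab (w' - w) ^+ 2 by rewrite exprn_ge0// ab_ge0.
apply: (ler_wpM2r sq0).
apply: ler_pM; rewrite ?ab_ge0 ?phiM// abM.
apply: ler_pM; rewrite ?ab_ge0//.
  apply: le_trans (abD _ _) _; rewrite abN !abM.
  have a3 : ab (3 : C) = 3 by rewrite -(rmorph_nat (real_complex R) 3) abC normr_nat.
  have a2 : ab (2 : C) = 2 by rewrite -(rmorph_nat (real_complex R) 2) abC normr_nat.
  rewrite a3 a2.
  have : ab a <= 2 * ab u.
    by have := abB3 (circ w0 u t) w0 w; rewrite circ_ab (ab_sym w0) /a; lra.
  by have := ab_ge0 u; have := ab_ge0 (w - w0); rewrite /eta in w'w; lra.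
rewrite abM !abV !abX.
apply: ler_pM; rewrite ?invr_ge0 ?exprn_ge0 ?ab_ge0//.
  by rewrite lef_pV2 ?posrE ?exprn_gt0//; [rewrite lerXn2r ?nnegrE ?ab_ge0 ?(ltW eta0)|exact: lt_le_trans g1].
by rewrite lef_pV2 ?posrE ?exprn_gt0//; [rewrite lerXn2r ?nnegrE ?ab_ge0 ?(ltW eta20)|exact: lt_le_trans g2].
Qed.

End Kernel.

Section Holomorphic.
Variable R : realType.
Local Notation C := R[i].

Definition hol (f : C -> C) (z0 : C) (r : R) :=
  forall z, ab (z - z0) < r -> exists d, cd f z d.

Lemma hol_cont f z0 r z : hol f z0 r -> ab (z - z0) < r -> {for z, continuous f}.
Proof. by move=> hf /hf[d]; exact: cd_cont. Qed.

Lemma bounded_circ (f : R -> C) (a b : R) : continuous f -> a <= b ->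
  exists M, forall t, a <= t <= b -> ab (f t) <= M.
Proof.
move=> cf leab; have c : {within `[a, b]%classic, continuous (fun t => ab (f t))}.
  apply: continuous_subspaceT => t.
  by apply: (@continuous_comp _ _ _ f (@ab R)); [exact: cf|exact: continuous_ab].
have [x _ xM] := EVT_max leab c.
exists (ab (f x)) => t tab; apply: xM.
by rewrite in_itv.
Qed.

Definition diffquot (f : C -> C) (w d z : C) : C :=
  if z == w then d else (f z - f w) / (z - w).

Lemma diffquotE f w d z : f z - f w = (z - w) * diffquot f w d z.
Proof.
rewrite /diffquot; case: eqP => [->|/eqP zw]; first by rewrite !subrr mul0r.
by rewrite mulrCA divff ?mulr1// subr_eq0.
Qed.

Lemma cd_diffquot f w d z e : z != w -> cd f z e -> exists e', cd (diffquot f w d) z e'.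
Proof.
move=> zw fe; have n0 : z - w != 0 by rewrite subr_eq0.
have c := contB (cont_id z) (cont_cst w z).
have d1 := derB (der_id id z) (der_cst id w z).
have d2 := derB fe (der_cst id (f w) z).
have cv := @contV R C (fun z => z - w) z n0 c.
have dv := @derV R C id (fun z => z - w) z _ c n0 d1.
have h := derM cv d2 dv.
eexists; apply: der_ext h.
have : 0 < ab (z - w) by rewrite ab_gt0.
move=> zw0; apply: filterS (near_ab z zw0) => v vz; rewrite /diffquot.
by case: eqP => // vw; move: vz; rewrite vw ab_sym ltxx.
Qed.

Lemma cont_diffquot f w d : cd f w d -> {for w, continuous (diffquot f w d)}.
Proof.
move=> fd; apply/(@contP R C _ w) => e e0.
have e20 : 0 < e / 2 by rewrite divr_gt0.
have /der_epsP/(_ _ e20) := fd.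
apply: filterS => z; rewrite /diffquot eqxx; case: eqP => [_|/eqP zw]; first by rewrite subrr ab0.
have zw0 : z - w != 0 by rewrite subr_eq0.
have -> : (f z - f w) / (z - w) - d = (f z - f w - d * (z - w)) / (z - w) by field.
rewrite abM abV ltr_pdivrMr ?ab_gt0// => h; apply: le_lt_trans h _.
by rewrite ltr_pM2r ?ab_gt0//; lra.
Qed.

Section Cauchy.
Variables (f : C -> C) (w0 u : C) (rho : R).
Hypothesis fhol : hol f w0 rho.
Hypothesis urho : ab u < rho / 4.

Let rho0 : 0 < rho.
Proof. by have h := le_lt_trans (ab_ge0 u) urho; lra. Qed.

Let circ_in t : ab (circ w0 u t - w0) < rho.
Proof. by rewrite circ_ab; have h := le_lt_trans (ab_ge0 u) urho; have := urho; lra. Qed.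

Let cfc : continuous (fun t => f (circ w0 u t)).
Proof.
move=> t; apply: (@continuous_comp _ _ _ (circ w0 u) f); first exact: cont_circ.
exact: hol_cont fhol (circ_in t).
Qed.

Lemma diffquot_prim w d : ab (w - w0) < rho -> cd f w d ->
  exists G : C -> C, forall z, ab (z - w0) < rho / 4 -> cd G z (diffquot f w d z).
Proof.
move=> wr fd; apply: (@local_prim R _ w0 rho w rho0).
  move=> z zr; have [->|zw] := eqVneq z w; first exact: cont_diffquot.
  have [e fe] := fhol zr; have [e' h] := cd_diffquot d zw fe.
  exact: cd_cont h.
by move=> z zr zw; have [e fe] := fhol zr; exact: cd_diffquot zw fe.
Qed.

Lemma oint_diffquot w d : ab (w - w0) < rho -> cd f w d ->
  oint (fun t => diffquot f w d (circ w0 u t) * dcirc u t) = 0.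
Proof.
move=> wr fd; have [G dG] := diffquot_prim wr fd.
apply: oint_prim => t; last by apply: dG; rewrite circ_ab.
apply: (@continuous_comp _ _ _ (circ w0 u) (diffquot f w d)); first exact: cont_circ.
have zr := circ_in t.
have [->|zw] := eqVneq (circ w0 u t) w; first exact: cont_diffquot.
have [e fe] := fhol zr; have [e' h] := cd_diffquot d zw fe.
exact: cd_cont h.
Qed.

Definition phi0 t := dcirc u t.
Definition phif t := f (circ w0 u t) * dcirc u t.

Lemma cont_phif : continuous phif.
Proof. by move=> t; have h := contM (@cfc t) (@cont_dcirc R u t); exact: h. Qed.

(** The difference quotient of [f] at [w], completed by the derivative, has a primitive around the
    circle by [local_prim], with [w] as exceptional point. Its integral is 0, and splitting the
    numerator gives the relation. The factor 1/4 in the radius is that of [local_prim]. *)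
Lemma cauchy_rel w : ab (w - w0) < ab u ->
  oint (ker w0 u phif 1 w) = f w * oint (ker w0 u (dcirc u) 1 w).
Proof.
move=> wu; have wr : ab (w - w0) < rho.
  by have h := le_lt_trans (ab_ge0 u) urho; have := urho; lra.
have [d fd] := fhol wr.
have h := oint_diffquot wr fd.
have c1 := cont_ker cont_phif wu (n := 1%N).
have c2 := cont_ker (@cont_dcirc R u) wu (n := 1%N).
have c3 : continuous (fun t => f w * ker w0 u (dcirc u) 1 w t).
  by move=> t; have h' := contM (cont_cst (f w) t) (c2 t); exact: h'.
apply/eqP; rewrite -subr_eq0 -h /oint -(itgZ _ _ _ c2) -(itgB _ _ c1 c3); apply/eqP.
apply: eq_itg => t.
have ne : circ w0 u t - w != 0.
  by rewrite -ab_gt0; have := circ_gap w0 u w t; lra.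
have := diffquotE f w d (circ w0 u t).
move=> e; rewrite /ker /phif expr1.
have -> : diffquot f w d (circ w0 u t) = (f (circ w0 u t) - f w) / (circ w0 u t - w).
  by rewrite e mulrAC divff// mul1r.
by field.
Qed.

End Cauchy.

(** The winding number integral has derivative 0 in [w], because (v - z)^-2 has a primitive off [z];
    at the centre the integrand is constant. *)
Lemma oint_ker_cst (w0 u w : C) : u != 0 -> ab (w - w0) < ab u ->
  oint (ker w0 u (dcirc u) 1 w) = (2 * pi)%:C * 'i.
Proof.
move=> u0 wu; pose K w := oint (ker w0 u (dcirc u) 1 w).
have bd t : 0 <= t <= 2 * pi -> ab (dcirc u t) <= ab u by rewrite dcirc_ab.
have dK z : ab (z - w0) < ab u -> cd K z 0.
  move=> zu; have := cd_ker1 (@cont_dcirc R u) bd zu.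
  have -> // : oint (ker w0 u (dcirc u) 2 z) = 0.
  have ne t : circ w0 u t - z != 0.
    by rewrite -ab_gt0; have := circ_gap w0 u z t; lra.
  pose F (v : C) := - (v - z)^-1.
  have e : oint (ker w0 u (dcirc u) 2 z) = oint (fun t => (circ w0 u t - z) ^- 2 * dcirc u t).
    by apply: eq_itg => t; rewrite /ker mulrC.
  rewrite e; apply: (@oint_prim R w0 u F (fun v => (v - z) ^- 2)).
    move=> t; have c1 := contB (@cont_circ R w0 u t) (cont_cst z t).
    have ne2 : (circ w0 u t - z) ^+ 2 != 0 by rewrite expf_neq0.
    have c2 := contM c1 c1.
    have h := @contV R R (fun t => (circ w0 u t - z) * (circ w0 u t - z)) t ne2 c2; exact: h.
  move=> t; set v := circ w0 u t.
  have c := contB (cont_id v) (cont_cst z v).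
  have d1 := derB (der_id id v) (der_cst id z v).
  have h := derN (@derV R C id (fun v => v - z) v _ c (ne t) d1).
  have -> : (v - z) ^- 2 = - (- (1 - 0) / (v - z) ^+ 2).
    by rewrite subr0 mulNr opprK mul1r.
  exact: h.
have -> : oint (ker w0 u (dcirc u) 1 w) = K w0 by rewrite -(cd_cst dK wu).
have -> : K w0 = oint (fun _ : R => 'i).
  apply: eq_itg => t; rewrite /ker expr1 /dcirc /circ addrC addKr mulfK//.
  by rewrite -ab_eq0 abM ab_expi mulr1 ab_eq0.
by rewrite /oint itg_cst subr0.
Qed.

Lemma twopii_neq0 : (2 * pi)%:C * 'i != 0 :> C.
Proof.
have pi0 := pi_gt0 R.
rewrite mulf_neq0 ?neq0Ci// -ab_eq0 abC normr_eq0; apply: lt0r_neq0; lra.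
Qed.

Lemma cauchy (f : C -> C) (w0 u : C) (rho : R) (w : C) :
  hol f w0 rho -> u != 0 -> ab u < rho / 4 -> ab (w - w0) < ab u ->
  f w = oint (ker w0 u (phif f w0 u) 1 w) / ((2 * pi)%:C * 'i).
Proof.
move=> fh u0 ur wu; rewrite (cauchy_rel fh ur wu) oint_ker_cst// mulfK//.
exact: twopii_neq0.
Qed.

Lemma phif_bounded (f : C -> C) (w0 u : C) (rho : R) :
  hol f w0 rho -> ab u < rho / 4 ->
  exists M, forall t, 0 <= t <= 2 * pi -> ab (phif f w0 u t) <= M.
Proof. by move=> fh ur; have := bounded_circ (cont_phif fh ur) (pi2_ge0 R). Qed.

Lemma exists_radius (rho : R) : 0 < rho -> exists u : C, u != 0 /\ ab u = rho / 8.
Proof.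
move=> r0; have r8 : 0 < rho / 8 by rewrite divr_gt0.
by exists (rho / 8)%:C; rewrite -ab_gt0 abC gtr0_norm.
Qed.

(** Cauchy's formula is differentiated under the integral once for f' and once more for the
    derivative of f'. *)
Lemma cd_cd (f : C -> C) (w0 : C) (rho : R) : hol f w0 rho ->
  exists2 f' : C -> C, (forall z, ab (z - w0) < rho / 8 -> cd f z (f' z))
    & hol f' w0 (rho / 8).
Proof.
move=> fh; have [r0|r0] := ltP 0 rho; last first.
  by exists f => z; have := ab_ge0 (z - w0); lra.
have [u [u0 ur]] := exists_radius r0.
have ur4 : ab u < rho / 4 by lra.
have [M HM] := phif_bounded fh ur4.
have cp := cont_phif fh ur4.
exists (fun z => oint (ker w0 u (phif f w0 u) 2 z) / ((2 * pi)%:C * 'i)) => z; rewrite -ur => zr.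
  have h := derZ ((2 * pi)%:C * 'i)^-1 (cd_ker1 cp HM zr).
  rewrite mulrC; apply: der_ext h.
  have e0 : 0 < ab u - ab (z - w0) by lra.
  apply: filterS (near_ab z e0) => w wz; rewrite [LHS]mulrC.
  by apply/esym; apply: (cauchy fh u0 ur4); have := abB3 w z w0; lra.
have [d hd] := cd_ker2 cp HM zr.
have h := derZ ((2 * pi)%:C * 'i)^-1 hd.
exists (((2 * pi)%:C * 'i)^-1 * d); apply: eq_der h => w; exact: mulrC.
Qed.

Lemma hol_deriv (f f' : C -> C) z0 r :
  (forall z, ab (z - z0) < r -> cd f z (f' z)) -> hol f' z0 r.
Proof.
move=> df z zr; have r10 : 0 < r - ab (z - z0) by rewrite subr_gt0.
have fh : hol f z (r - ab (z - z0)).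
  by move=> w wz; exists (f' w); apply: df; have := abB3 w z z0; lra.
have [g dg gh] := cd_cd fh.
have r80 : 0 < (r - ab (z - z0)) / 8 by rewrite divr_gt0.
have [|d gd] := gh z; first by rewrite subrr ab0.
exists d; apply: der_ext gd; apply: filterS (near_ab z r80) => w wz.
apply: cd_unique (dg w wz) _; apply: df.
by have := abB3 w z z0; lra.
Qed.

(** Despite the exceptional point [f] has a local primitive, and a derivative is holomorphic. *)
Lemma removable (f : C -> C) (w0 : C) (rho : R) : 0 < rho ->
  (forall z, ab (z - w0) < rho -> {for z, continuous f}) ->
  (forall z, ab (z - w0) < rho -> z != w0 -> exists d, cd f z d) ->
  hol f w0 rho.
Proof.
move=> r0 cf df z zr; have [->|zw] := eqVneq z w0; last exact: df.
have [F dF] := local_prim r0 cf df.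
by apply: (hol_deriv dF); rewrite subrr ab0 divr_gt0.
Qed.

Lemma hol_diffquot (f : C -> C) (w0 : C) (rho : R) d : 0 < rho -> hol f w0 rho ->
  cd f w0 d -> hol (diffquot f w0 d) w0 rho.
Proof.
move=> r0 fh fd; apply: (removable r0).
  move=> z zr; have [->|zw] := eqVneq z w0; first exact: cont_diffquot.
  have [e fe] := fh z zr; have [e' h] := cd_diffquot d zw fe.
  exact: cd_cont h.
by move=> z zr zw; have [e fe] := fh z zr; exact: cd_diffquot zw fe.
Qed.

Lemma cauchy_bound (f : C -> C) (w0 u : C) (rho M : R) w :
  hol f w0 rho -> u != 0 -> ab u < rho / 4 -> ab (w - w0) < ab u / 2 ->
  (forall t, 0 <= t <= 2 * pi -> ab (f (circ w0 u t)) <= M) -> ab (f w) <= 2 * M.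
Proof.
move=> fh u0 ur wu HM; have up : 0 < ab u by rewrite ab_gt0.
have wu' : ab (w - w0) < ab u by lra.
have p0 : 0 < 2 * pi :> R by rewrite mulr_gt0// pi_gt0.
have M0 : 0 <= M.
  apply: le_trans (HM 0 _); first exact: ab_ge0.
  by rewrite lexx ltW.
rewrite (cauchy fh u0 ur wu') abM abV abM abi mulr1 abC (gtr0_norm p0).
rewrite ler_pdivrMr//; apply: oint_bound; first exact: (cont_ker (cont_phif fh ur) wu').
move=> t tpi; rewrite /ker /phif abM abV expr1 abM dcirc_ab -mulrA mulrC.
apply: ler_pM; rewrite ?mulr_ge0 ?invr_ge0 ?ab_ge0 ?HM//.
have g := circ_gap w0 u w t.
have g' : 0 < ab (circ w0 u t - w) by lra.
by rewrite ler_pdivrMr//; lra.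
Qed.

(** Factors z - w0 are divided out by [nx] as long as the quotient vanishes at [w0]. If this never
    ends, the quotient [F n] is at most M / |u|^n on the circle, so [cauchy_bound] gives |f z| <= 2
    M (|z - w0| / |u|)^n, which tends to 0. Otherwise the first nonzero quotient is nonzero
    nearby. *)
Lemma isolated_zeros (f : C -> C) (w0 : C) (rho : R) : 0 < rho -> hol f w0 rho ->
  (\forall z \near w0, f z = 0) \/
  (exists2 r : R, 0 < r & forall z, ab (z - w0) < r -> z != w0 -> f z != 0).
Proof.
move=> r0 fh.
have dex g : hol g w0 rho -> exists d, cd g w0 d.
  by move=> gh; apply: gh; rewrite subrr ab0.
pose nx (g : C -> C) := diffquot g w0 (xget 0 [set d | cd g w0 d]).
have nxh g : hol g w0 rho -> hol (nx g) w0 rho.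
  move=> gh; have [d gd] := dex g gh; apply: (hol_diffquot r0 gh).
  by case: xgetP => [//|] /(_ d).
pose F n := iter n nx f.
have Fh n : hol (F n) w0 rho by elim: n => // n IH; exact: nxh.
have FE n : (forall k, (k < n)%N -> F k w0 = 0) -> forall z, f z = (z - w0) ^+ n * F n z.
  elim: n => [_ z|n IH Hn z]; first by rewrite expr0 mul1r.
  rewrite IH => [|k kn]; last by apply: Hn; exact: ltnW.
  have := diffquotE (F n) w0 (xget 0 [set d | cd (F n) w0 d]) z.
  by rewrite Hn// subr0 => ->; rewrite exprSr mulrA.
have [all0|] := pselect (forall n, F n w0 = 0).
  left; have [u [u0 ur]] := exists_radius r0.
  have up : 0 < ab u by rewrite ab_gt0.
  have ur4 : ab u < rho / 4 by lra.
  have cfc : continuous (fun t => f (circ w0 u t)).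
    move=> t; apply: (@continuous_comp _ _ _ (circ w0 u) f); first exact: cont_circ.
    by apply: (hol_cont fh); rewrite circ_ab; lra.
  have [M HM] := bounded_circ cfc (pi2_ge0 R).
  have u20 : 0 < ab u / 2 by rewrite divr_gt0.
  apply: filterS (near_ab w0 u20) => z zu.
  have M0 : 0 <= M.
    apply: le_trans (HM 0 _); first exact: ab_ge0.
    by rewrite lexx pi2_ge0.
  have bn n : ab (f z) <= 2 * M * 2^-1 ^+ n.
    have b : ab (F n z) <= 2 * (M / ab u ^+ n).
      apply: (cauchy_bound (Fh n) u0 ur4 zu) => t tpi.
      rewrite ler_pdivlMr ?exprn_gt0//; apply: le_trans (HM t tpi).
      by rewrite (FE n (fun k _ => all0 k)) abM abX circ_ab mulrC.
    rewrite (FE n (fun k _ => all0 k)) abM abX.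
    apply: le_trans (ler_wpM2l _ b) _; first by rewrite exprn_ge0 ?ab_ge0.
    have -> : ab (z - w0) ^+ n * (2 * (M / ab u ^+ n)) = 2 * M * (ab (z - w0) / ab u) ^+ n.
      by rewrite expr_div_n; ring.
    rewrite ler_wpM2l ?mulr_ge0// lerXn2r ?nnegrE ?divr_ge0 ?ab_ge0 ?invr_ge0//.
    by rewrite ler_pdivrMr//; lra.
  apply/eqP; rewrite -ab_eq0 eq_le ab_ge0 andbT.
  have c : (fun n : nat => 2 * M * 2^-1 ^+ n) @ \oo --> 2 * M * (0 : R).
    apply: cvgM; first exact: cvg_cst.
    by apply: cvg_expr; rewrite ger0_norm ?invr_ge0// invf_lt1// ltr1n.
  rewrite mulr0 in c.
  rewrite leNgt; apply/negP => fz0.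
  move/cvgrPdist_lt : c => /(_ _ fz0) [n _ /(_ n (leqnn n))] /=.
  by rewrite sub0r normrN ger0_norm ?mulr_ge0 ?exprn_ge0 ?invr_ge0// ltNge bn.
move=> /existsNP[n0 /eqP n0P]; right.
have [n nP nmin] := ex_minnP (ex_intro (fun n => F n w0 != 0) n0 n0P).
have F0 k : (k < n)%N -> F k w0 = 0.
  by move=> kn; apply/eqP/negPn/negP => /nmin; rewrite leqNgt kn.
have cF : {for w0, continuous (F n)} by apply: (hol_cont (Fh n)); rewrite subrr ab0.
have p : 0 < ab (F n w0) by rewrite ab_gt0.
have /(@contP R C (F n) w0)/(_ _ p)/nbhs_ab[r rr0 rH] := cF.
exists r => // z zr zw; rewrite (FE n F0) mulf_neq0//.
  by rewrite expf_neq0// subr_eq0.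
by apply: contraTneq (rH z zr) => ->; rewrite sub0r abN ltxx.
Qed.

Lemma Re_mono (G g : R -> C) (a b : R) : a <= b ->
  (forall x, a <= x <= b -> rd G x (g x)) ->
  (forall x, a <= x <= b -> complex.Re (g x) <= 0) ->
  complex.Re (G b) <= complex.Re (G a).
Proof.
move=> leab dG g0; rewrite -subr_le0; apply/ler_addgt0Pr => e e0; rewrite add0r.
have k0 : 0 < b - a + 1 by lra.
pose d := e / (b - a + 1).
have d0 : 0 < d by rewrite divr_gt0.
suff : complex.Re (G b) - complex.Re (G a) <= d * (b - a).
  move/le_trans; apply; rewrite /d mulrAC ler_pdivrMr//.
  by rewrite ler_wpM2l ?ltW//; lra.
apply: (@cousin R (fun x y => complex.Re (G y) - complex.Re (G x) <= d * (y - x))) => //; last first.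
  by move=> x y z _ _ _ _ h1 h2; lra.
move=> t tab; have /der_epsP/(_ d d0)/nbhs_R[r r0 rH] := dG t tab.
have Ret (z : C) (x : R) : complex.Re (z * x%:C) = complex.Re z * x.
  by case: z => p q /=; rewrite mulr0 subr0.
have gt := g0 t tab.
exists r => // x y /andP[ax xt] /andP[ty yb] tx yt.
have hx : complex.Re (G t) - complex.Re (G x) <= d * (t - x).
  have xr : `|x - t| < r by rewrite distrC ger0_norm; lra.
  have := le_trans (Re_ab _) (rH x xr).
  rewrite -rmorphB/= abC !ReD !ReN Ret (distrC x t) (ger0_norm (x := t - x)); last by lra.
  rewrite ler_norml => /andP[h1 h2].
  have : complex.Re (g t) * (t - x) <= 0 by rewrite mulr_le0_ge0//; lra.
  by lra.
have hy : complex.Re (G y) - complex.Re (G t) <= d * (y - t).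
  have yr : `|y - t| < r by rewrite ger0_norm; lra.
  have := le_trans (Re_ab _) (rH y yr).
  rewrite -rmorphB/= abC !ReD !ReN Ret (ger0_norm (x := y - t)); last by lra.
  rewrite ler_norml => /andP[h1 h2].
  have : complex.Re (g t) * (y - t) <= 0 by rewrite mulr_le0_ge0//; lra.
  by lra.
by lra.
Qed.

(** Mean value property on the circle about [w0] that starts at [z1]: [g] = f(circ) - f(w0) has
    integral 0 and real part at most 0. Hence the real part of its primitive decreases and returns
    to its initial value, so it is constant, and its derivative at 0, the real part of f(z1) -
    f(w0), is 0. *)
Lemma max_principle (f : C -> C) (w0 : C) (rho : R) : hol f w0 rho ->
  (forall z, ab (z - w0) < rho -> complex.Re (f z) <= complex.Re (f w0)) ->
  forall z, ab (z - w0) < rho / 4 -> complex.Re (f z) = complex.Re (f w0).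
Proof.
move=> fh fmax z1 z1r; have [->//|zw] := eqVneq z1 w0.
pose u := z1 - w0; have u0 : u != 0 by rewrite subr_eq0.
have r0 : 0 < rho by have := ab_ge0 u; rewrite /u; lra.
have [d fd] : exists d, cd f w0 d by apply: fh; rewrite subrr ab0.
have w0r : ab (w0 - w0) < rho by rewrite subrr ab0.
have h := oint_diffquot fh z1r w0r fd.
have inr t : ab (circ w0 u t - w0) < rho by rewrite circ_ab; have := ab_ge0 u; rewrite /u; lra.
have cfc : continuous (fun t => f (circ w0 u t)).
  move=> t; apply: (@continuous_comp _ _ _ (circ w0 u) f); first exact: cont_circ.
  exact: hol_cont fh (inr t).
pose g t := f (circ w0 u t) - f w0.
have cg : continuous g.
  by move=> t; have h1 := contB (cfc t) (cont_cst (f w0) t); exact: h1.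
have e : oint (fun t => diffquot f w0 d (circ w0 u t) * dcirc u t) = 'i * oint g.
  rewrite /oint -(itgZ _ _ _ cg); apply: eq_itg => t.
  have cE : circ w0 u t - w0 = u * expi t by rewrite /circ addrC addKr.
  by rewrite /g (diffquotE f w0 d) cE /dcirc; ring.
have og : oint g = 0.
  by move: h; rewrite e => /eqP; rewrite mulf_eq0 (negPf (neq0Ci _)) => /eqP.
have gle t : complex.Re (g t) <= 0 by rewrite /g ReD ReN subr_le0; exact: fmax.
have dP := primP cg.
have p0 : 0 < 2 * pi :> R by rewrite mulr_gt0// pi_gt0.
have P0 t : 0 <= t <= 2 * pi -> complex.Re (prim g t) = complex.Re (prim g 0).
  move=> /andP[t0 t1].
  have h1 : complex.Re (prim g t) <= complex.Re (prim g 0) by apply: Re_mono (t0) _ _ => x _.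
  have h2 : complex.Re (prim g (2 * pi)) <= complex.Re (prim g t) by apply: Re_mono (t1) _ _ => x _.
  have h3 : prim g (2 * pi) - prim g 0 = 0 by exact: og.
  have h4 : prim g (2 * pi) = prim g 0 by apply/eqP; rewrite -subr_eq0 h3.
  by apply/eqP; rewrite eq_le h1 -h4 h2.
have g0 : g 0 = f z1 - f w0 by rewrite /g /circ expi0 mulr1 /u [w0 + _]addrC subrK.
suff : complex.Re (g 0) = 0.
  by rewrite g0 ReD ReN => /eqP; rewrite subr_eq0 => /eqP.
apply/eqP; rewrite eq_le gle /= leNgt; apply/negP => gneg.
(* A negative derivative at 0 would make the constant function decrease at rate at least half of
   it. *)
have a0 : 0 < - complex.Re (g 0) / 2 by rewrite divr_gt0// oppr_gt0.
have /der_epsP/(_ _ a0)/nbhs_R[r rr0 rH] := dP 0.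
pose t := Num.min (r / 2) (2 * pi).
have t0 : 0 < t by rewrite lt_min divr_gt0.
have tr : `|t - 0| < r.
  rewrite subr0 gtr0_norm//.
  have : t <= r / 2 by rewrite ge_min lexx.
  by lra.
have t2 : t <= 2 * pi by rewrite ge_min lexx orbT.
have Ret (z : C) (x : R) : complex.Re (z * x%:C) = complex.Re z * x.
  by case: z => p q /=; rewrite mulr0 subr0.
have := le_trans (Re_ab _) (rH t tr).
rewrite -rmorphB/= abC !ReD !ReN Ret subr0 (gtr0_norm t0) P0; last by rewrite ltW.
rewrite subrr sub0r normrN normrM (gtr0_norm t0) ler_pM2r// (ltr0_norm gneg).
have gE : complex.Re (g 0) = complex.Re (f (circ w0 u 0)) - complex.Re (f w0).
  by rewrite /g ReD ReN.
rewrite -gE; move: gneg; lra.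
Qed.

(** Increments in the directions 1 and i show that the real and the imaginary part of [d] are both
    arbitrarily small. *)
Lemma Re_cst_deriv (f : C -> C) (z d : C) : cd f z d ->
  (\forall w \near z, complex.Re (f w) = complex.Re (f z)) -> d = 0.
Proof.
move=> /der_epsP fd /nbhs_ab[r r0 rH]; apply/eqP; rewrite -ab_eq0 eq_le ab_ge0 andbT.
apply/ler_addgt0Pr => e e0; rewrite add0r.
have e20 : 0 < e / 2 by rewrite divr_gt0.
have /nbhs_ab[s s0 sH] := fd _ e20.
pose t := Num.min r s / 2.
have t0 : 0 < t by rewrite divr_gt0// lt_min r0.
have tr : t < r.
  have : Num.min r s <= r by rewrite ge_min lexx.
  by rewrite /t; have : 0 < Num.min r s by [rewrite lt_min r0|]; lra.
have ts : t < s.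
  have : Num.min r s <= s by rewrite ge_min lexx orbT.
  by rewrite /t; have : 0 < Num.min r s by [rewrite lt_min r0|]; lra.
have key (v : C) : ab v = 1 -> `|complex.Re (d * v)| <= e / 2.
  move=> v1; pose w := z + v * t%:C.
  have wz : ab (w - z) = t by rewrite /w addrC addKr abM v1 mul1r abC gtr0_norm.
  have h1 : complex.Re (f w) = complex.Re (f z) by apply: rH; rewrite wz.
  have := sH w; rewrite wz => /(_ ts) /(le_trans (Re_ab _)).
  have -> : f w - f z - d * (w - z) = (f w - f z) - (d * v) * t%:C.
    by rewrite /w; ring.
  rewrite ReD ReD !ReN h1 subrr sub0r normrN.
  have -> : complex.Re (d * v * t%:C) = complex.Re (d * v) * t.
    by case: (d * v) => p q /=; rewrite mulr0 subr0.
  by rewrite normrM (gtr0_norm t0) ler_pM2r.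
have k1 := key 1 (@ab1 R); rewrite mulr1 in k1.
have ki := key 'i (@abi R).
have ei : complex.Re (d * 'i) = - complex.Im d by exact: ReiNIm.
rewrite ei normrN in ki.
by apply: le_trans (ab_ReIm _) _; lra.
Qed.

End Holomorphic.

Lemma nbhsI2 (T : topologicalType) (p : T) (A B : set T) :
  nbhs p A -> nbhs p B -> nbhs p (A `&` B).
Proof. by move=> pA pB; apply: filterI. Qed.

(** * Local theory of Riemann surfaces *)

Section Charts.
Variables (R : realType) (Y : riemannSurface R).
Local Notation C := R[i].
Local Notation I := (rs_index Y).
Local Notation dom := (rs_dom Y).
Local Notation chart := (rs_chart Y).
Implicit Types (i j : I) (p q : Y) (f g : Y -> C).

Lemma dom_nbhs i p : dom i p -> nbhs p (dom i).
Proof. by move=> ip; apply: open_nbhs_nbhs; split => //; exact: rs_open. Qed.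

Lemma chart_cont i p : dom i p -> {for p, continuous (chart i)}.
Proof.
move=> ip U hU; have : nbhs (chart i p) U := hU.
rewrite nbhsE => [[W [oO Op] OU]].
pose A := dom i `&` chart i @^-1` W.
have oA : open A.
  have sA : A `<=` dom i by move=> q [].
  apply/(@rs_homeo _ Y i A sA).
  have -> : chart i @` A = (chart i @` dom i) `&` W.
    apply/seteqP; split => [_ [q [iq Oq] <-]|_ [[q iq <-] Oq]]; last by exists q.
    by split => //; exists q.
  by apply: openI => //; apply/(@rs_homeo _ Y i (dom i)) => //; exact: rs_open.
have h : nbhs p (chart i @^-1` U).
  by rewrite nbhsE; exists A; [split|move=> q [_ /OU]].
exact: h.
Qed.

(** The inverse of the chart; [p] is only the default value off its image. *)
Definition cinv i p (z : C) : Y := xget p [set q | dom i q /\ chart i q = z].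

Lemma cinvK i p q : dom i q -> cinv i p (chart i q) = q.
Proof.
move=> iq; rewrite /cinv; case: xgetP => [y _ [iy yq]|/(_ q)]; last by case.
exact: rs_inj yq.
Qed.

Lemma cinv_cont i p q : dom i q -> {for chart i q, continuous (cinv i p)}.
Proof.
move=> iq U hU; have : nbhs (cinv i p (chart i q)) U := hU.
rewrite cinvK// nbhsE => [[W [oO Oq] OU]].
pose A := W `&` dom i.
have oA : open (chart i @` A).
  have sA : A `<=` dom i by move=> y [].
  apply/(@rs_homeo _ Y i A sA).
  by apply: openI => //; exact: rs_open.
have h : nbhs (chart i q) (cinv i p @^-1` U).
  rewrite nbhsE; exists (chart i @` A); first by split => //; exists q.
  by move=> _ [y [Oy iy] <-]; rewrite /= cinvK//; exact: OU.
exact: h.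
Qed.

Lemma cinv_near i p q : dom i q ->
  \forall z \near chart i q, dom i (cinv i p z) /\ chart i (cinv i p z) = z.
Proof.
move=> iq; have oA : open (chart i @` dom i).
  by apply/(@rs_homeo _ Y i (dom i)) => //; exact: rs_open.
have h : nbhs (chart i q) [set z | dom i (cinv i p z) /\ chart i (cinv i p z) = z].
  rewrite nbhsE; exists (chart i @` dom i); first by split => //; exists q.
  by move=> _ [y iy <-]; rewrite /= cinvK.
exact: h.
Qed.

Lemma near_cinv i p q (P : set Y) : dom i q ->
  (\forall y \near q, P y) -> \forall z \near chart i q, P (cinv i p z).
Proof.
move=> iq nP; apply: (cinv_cont (p := p) iq); by rewrite cinvK.
Qed.

Lemma near_chart i q (P : set C) : dom i q ->
  (\forall z \near chart i q, P z) -> \forall y \near q, P (chart i y).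
Proof. by move=> iq; exact: (chart_cont iq). Qed.

Lemma chart_nonisolated i p U : dom i p -> nbhs p U ->
  exists2 q, U q & chart i q != chart i p.
Proof.
move=> ip Up; have h := nbhsI2 (cinv_near p ip) (near_cinv p ip Up).
have [r r0 rH] := (nbhs_ab _ _).1 h.
have [|[iq qE] Uq] := rH (chart i p + (r / 2)%:C).
  by rewrite addrC addKr abC gtr0_norm; lra.
exists (cinv i p (chart i p + (r / 2)%:C)) => //; rewrite qE.
rewrite -subr_eq0 addrC addKr -ab_eq0 abC normr_eq0; apply: lt0r_neq0; lra.
Qed.

(** The working form of [chart_deriv], equivalent to it by [hderP]: derivatives are taken on the
    surface itself and no function of the coordinate is exhibited. *)
Definition hder i f p d :=
  der (chart i) f p d /\ \forall q \near p, exists e, der (chart i) f q e.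

Lemma cd_chart i f p d : dom i p -> der (chart i) f p d ->
  cd (fun z => f (cinv i p z)) (chart i p) d.
Proof.
move=> ip fd; have h : der id (chart i \o cinv i p) (chart i p) 1.
  apply: der_ext (der_id id (chart i p)).
  by apply: filterS (cinv_near p ip) => z [_ /= ->].
have fd' : der (chart i) f (cinv i p (chart i p)) d by rewrite cinvK.
have := der_comp (cinv_cont (p := p) ip) h fd'.
by rewrite mulr1.
Qed.

Lemma chart_cd i (g : C -> C) p d : dom i p -> cd g (chart i p) d ->
  der (chart i) (fun q => g (chart i q)) p d.
Proof.
move=> ip gd; have := der_comp (chart_cont ip) (der_id (chart i) p) gd.
by rewrite mulr1.
Qed.

Lemma hderP i f p d : dom i p -> chart_deriv (chart i) f p d <-> hder i f p d.
Proof.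
move=> ip; split=> [[g [gnear fg /cdP gd]]|[fd fnear]].
  split; first by apply: der_ext (chart_cd ip gd); apply: filterS fg => q ->.
  have h1 := near_chart ip gnear.
  have h2 := near_join fg.
  have h3 := dom_nbhs ip.
  apply: filterS3 h1 h2 h3 => q /derivable_cd[e ge] h iq; exists e.
  by apply: der_ext (chart_cd iq ge); apply: filterS h => y ->.
exists (fun z => f (cinv i p z)); split.
- have h1 := near_cinv p ip fnear.
  apply: filterS2 h1 (cinv_near p ip) => z [e fe] [iz zE].
  apply/derivable_cd; exists e.
  have := cd_chart iz fe; rewrite zE; apply: der_ext.
  have h2 := cinv_near (cinv i p z) iz; rewrite zE in h2.
  apply: filterS h2 => w [iw wE]; congr (f _).
  by rewrite -{2}wE cinvK.
- by apply: filterS (dom_nbhs ip) => q iq; rewrite cinvK.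
- by apply/cdP; exact: cd_chart.
Qed.

Lemma hder_unique i f p d e : dom i p -> hder i f p d -> hder i f p e -> d = e.
Proof.
move=> ip [fd _] [fe _]; apply: der_unique fd fe => U pU.
exact: chart_nonisolated.
Qed.

Lemma der_unique_chart i f p d e : dom i p -> der (chart i) f p d -> der (chart i) f p e -> d = e.
Proof. by move=> ip; apply: der_unique => U pU; exact: chart_nonisolated. Qed.

Lemma hder_cont i f p d : dom i p -> hder i f p d -> {for p, continuous f}.
Proof. by move=> ip [fd _]; exact: der_cont (chart_cont ip) fd. Qed.

Lemma hder_ext i f g p d : (\forall q \near p, f q = g q) -> hder i f p d -> hder i g p d.
Proof.
move=> fg [fd fn]; split; first exact: der_ext fd.
have fg' := near_join fg.
by apply: filterS2 fg' fn => q h [e fe]; exists e; exact: der_ext fe.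
Qed.

Lemma hder_near i f p d : hder i f p d -> \forall q \near p, exists e, hder i f q e.
Proof.
move=> [_ fn]; apply: filterS2 fn (near_join fn) => q [e fe] h.
by exists e; split.
Qed.

Lemma hder_cst i p c : hder i (fun=> c) p 0.
Proof. by split; [exact: der_cst|apply: filterE => q; exists 0; exact: der_cst]. Qed.

Lemma hderD i f g p d e : hder i f p d -> hder i g p e ->
  hder i (fun q => f q + g q) p (d + e).
Proof.
move=> [fd fn] [ge gn]; split; first exact: derD fd ge.
by apply: filterS2 fn gn => q [d' h1] [e' h2]; exists (d' + e'); exact: derD h1 h2.
Qed.

Lemma hderZ i f c p d : hder i f p d -> hder i (fun q => c * f q) p (c * d).
Proof.
move=> [fd fn]; split; first exact: derZ fd.
by apply: filterS fn => q [d' h1]; exists (c * d'); exact: derZ h1.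
Qed.

Lemma hderB i f g p d e : hder i f p d -> hder i g p e ->
  hder i (fun q => f q - g q) p (d - e).
Proof.
move=> [fd fn] [ge gn]; split; first exact: derB fd ge.
by apply: filterS2 fn gn => q [d' h1] [e' h2]; exists (d' - e'); exact: derB h1 h2.
Qed.

Lemma hderM i f g p d e : dom i p -> hder i f p d -> hder i g p e ->
  hder i (fun q => f q * g q) p (d * g p + f p * e).
Proof.
move=> ip fh gh; have [fd fn] := fh; have [ge gn] := gh; split.
  exact: derM (hder_cont ip gh) fd ge.
apply: filterS3 fn gn (dom_nbhs ip) => q [d' h1] [e' h2] iq.
by exists (d' * g q + f q * e'); exact: derM (der_cont (chart_cont iq) h2) h1 h2.
Qed.

Lemma hderV i f p d : dom i p -> f p != 0 -> hder i f p d ->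
  exists e, hder i (fun q => (f q)^-1) p e.
Proof.
move=> ip fp fh; have [fd fn] := fh; have cf := hder_cont ip fh.
eexists; split; first exact: derV cf fp fd.
have f0 : \forall q \near p, f q != 0.
  have fp0 : 0 < ab (f p) by rewrite ab_gt0.
  have /(@contP R Y f p)/(_ _ fp0) := cf.
  by apply: filterS => q; apply: contraTneq => ->; rewrite sub0r abN ltxx.
apply: filterS3 fn f0 (dom_nbhs ip) => q [e' h1] fq iq.
eexists; exact: derV (der_cont (chart_cont iq) h1) fq h1.
Qed.

Lemma hder_deriv i f f' p : dom i p ->
  (\forall q \near p, der (chart i) f q (f' q)) -> exists d, hder i f' p d.
Proof.
move=> ip fn.
have h := near_cinv p ip fn.
have h2 := nbhsI2 h (cinv_near p ip).
  have [r r0 rH] := (nbhs_ab _ _).1 h2.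
have key : hol (fun z => f' (cinv i p z)) (chart i p) r.
  apply: (@hol_deriv R (fun z => f (cinv i p z))) => z /rH [fd [iz zE]].
  have := cd_chart iz fd; rewrite zE; apply: der_ext.
  have h3 := cinv_near (cinv i p z) iz; rewrite zE in h3.
  apply: filterS h3 => w [iw wE]; congr (f _).
  by rewrite -{2}wE cinvK.
have near_r : \forall q \near p, ab (chart i q - chart i p) < r.
  exact: (near_chart ip (near_ab _ r0)).
have all : \forall q \near p, exists d, der (chart i) f' q d.
  apply: filterS2 near_r (dom_nbhs ip) => q qr iq.
  have [d hd] := key _ qr; exists d.
  apply: der_ext (chart_cd iq hd).
  by apply: filterS (dom_nbhs iq) => y iy; rewrite cinvK.
by have [d hd] := nbhs_singleton all; exists d; split.
Qed.

(** The two transition derivatives multiply to 1 by the chain rule, so neither vanishes. *)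
Lemma chart_change i j p : dom i p -> dom j p ->
  exists d, [/\ d != 0, hder i (chart j) p d & hder j (chart i) p d^-1].
Proof.
move=> ip jp; have [d /(hderP _ _ ip) hd] := rs_compat ip jp.
have [e /(hderP _ _ jp) he] := rs_compat jp ip.
have idc : {for p, continuous (@idfun Y)} by exact: cvg_id.
have h1 := der_comp (f := @idfun Y) idc hd.1 he.1.
have e1 : e * d = 1 by exact: der_unique_chart ip h1 (der_id _ _).
have d0 : d != 0 by apply: contra_eqN e1 => /eqP ->; rewrite mulr0 eq_sym oner_eq0.
have e2 : d^-1 = e by rewrite -[LHS]mul1r -e1 mulfK.
by exists d; split; [exact: d0|exact: hd|rewrite e2; exact: he].
Qed.

Lemma hder_change i j f p d e : dom i p -> dom j p ->
  hder i f p d -> hder j (chart i) p e -> hder j f p (d * e).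
Proof.
move=> ip jp [fd fn] [ie ine].
have comp q d' e' : der (chart i) f q d' -> der (chart j) (chart i) q e' -> der (chart j) f q (d' * e').
  move=> h1 h2; have idc : {for q, continuous (@idfun Y)} by exact: cvg_id.
  exact: (der_comp (f := @idfun Y) idc h2 h1).
split; first exact: comp.
by apply: filterS2 fn ine => q [d' h1] [e' h2]; exists (d' * e'); exact: comp.
Qed.

End Charts.

Section HolMaps.
Variables (R : realType) (Y Z : riemannSurface R).
Local Notation C := R[i].

Lemma hder_comp (f : Y -> Z) (g : Z -> C) i j p d e : continuous f ->
  hder i (fun q => rs_chart Z j (f q)) p d -> hder j g (f p) e ->
  hder i (fun q => g (f q)) p (e * d).
Proof.
move=> cf [fd fn] [ge gn]; split; first exact: (der_comp (@cf p) fd ge).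
have gn' := @cf p _ gn.
apply: filterS2 fn gn' => q [d' h1] [e' h2].
exists (e' * d'); exact: (der_comp (@cf q) h1 h2).
Qed.

Lemma holomorphic_hder (f : Y -> Z) i j p : holomorphic_map f ->
  rs_dom Y i p -> rs_dom Z j (f p) -> exists d, hder i (fun q => rs_chart Z j (f q)) p d.
Proof.
move=> [_ hf] ip jp; have [d hd] := hf i j p ip jp; exists d.
by apply/hderP.
Qed.

End HolMaps.

(** * Differentials and their primitives *)

Section Diff.
Variables (R : realType) (Y : riemannSurface R).
Local Notation C := R[i].
Local Notation I := (rs_index Y).
Local Notation dom := (rs_dom Y).
Local Notation chart := (rs_chart Y).
Local Notation Om := (differential Y).
Implicit Types (i j : I) (p q : Y) (f g : Y -> C) (w : Om).

Lemma diff_hol w i p : dom i p -> exists d, hder i (w i) p d.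
Proof.
by case: w => c /asboolP[_ h _] /= ip; have [d /(hderP _ _ ip) hd] := h i p ip; exists d.
Qed.

Lemma diff_trans w i j p d : dom i p -> dom j p -> hder i (chart j) p d ->
  w i p = w j p * d.
Proof.
by case: w => c /asboolP[_ _ h] /= ip jp hd; apply: h => //; apply/hderP.
Qed.

Lemma diff_eq w w' : (forall i p, dom i p -> w i p = w' i p) -> w = w'.
Proof.
case: w w' => [c cP] [c' cP'] /= h; apply: val_inj => /=.
apply/funext => i; apply/funext => p.
have [ip|ip] := pselect (dom i p); first exact: h.
move: cP cP' => /asboolP[h1 _ _] /asboolP[h2 _ _].
by rewrite h1// h2.
Qed.

Lemma mk_diff (c : I -> Y -> C) :
  (forall i p, dom i p -> exists d, hder i (c i) p d) ->
  (forall i j p d, dom i p -> dom j p -> hder i (chart j) p d -> c i p = c j p * d) ->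
  exists w, forall i p, dom i p -> w i p = c i p.
Proof.
move=> ch ct; pose c' i p := if pselect (dom i p) then c i p else 0.
have c'E i p : dom i p -> c' i p = c i p by rewrite /c'; case: pselect.
have c'P : c' \in diff_pred (Y := Y).
  apply/asboolP; split.
  - by move=> i p; rewrite /c'; case: pselect.
  - move=> i p ip; have [d hd] := ch i p ip; exists d; apply/hderP => //.
    by apply: hder_ext hd; apply: filterS (dom_nbhs ip) => q iq; rewrite c'E.
  - move=> i j p d ip jp /(hderP _ _ ip) hd; rewrite !c'E//; exact: ct hd.
by exists (Differential c'P) => i p /c'E.
Qed.

Lemma diffZE a w i p : (a *: w) i p = a * w i p. Proof. by []. Qed.
Lemma diff0E i p : (0 : Om) i p = 0. Proof. by []. Qed.

Definition prim_at w f q := forall i, dom i q -> hder i f q (w i q).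

Lemma prim_at1 w f q i : dom i q -> hder i f q (w i q) -> prim_at w f q.
Proof.
move=> iq h j jq; have [d [d0 h1 h2]] := chart_change jq iq.
have e := diff_trans w jq iq h1.
by rewrite e; exact: hder_change iq jq h h1.
Qed.

Lemma primitive_nearP w p f : primitive_near w p f <-> \forall q \near p, prim_at w f q.
Proof.
by split; apply: filterS => q h i iq; have := h i iq; move/(hderP _ _ iq).
Qed.

Lemma prim_atB w f g q i : dom i q -> prim_at w f q -> prim_at w g q ->
  hder i (fun y => f y - g y) q 0.
Proof. by move=> iq fq gq; have h := hderB (fq i iq) (gq i iq); rewrite subrr in h. Qed.

Lemma prim_atD w w' f g q : prim_at w f q -> prim_at w' g q ->
  prim_at (w + w') (fun y => f y + g y) q.
Proof. by move=> fq gq i iq; exact: hderD (fq i iq) (gq i iq). Qed.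

Lemma prim_atZ a w f q : prim_at w f q -> prim_at (a *: w) (fun y => a * f y) q.
Proof. by move=> fq i iq; rewrite diffZE; exact: (hderZ a (fq i iq)). Qed.

(* Stands in for coordinate discs. *)
Definition nice (N : set Y) := [/\ open N,
  forall w, exists f, forall q, N q -> prim_at w f q,
  forall f, (forall q, N q -> exists2 i, dom i q & der (chart i) f q 0) ->
     forall a b, N a -> N b -> f a = f b &
  forall a b, N a -> N b -> exists c : R -> Y,
    [/\ continuous c, c 0 = a, c 1 = b & forall t, N (c t)]].

Lemma disc_ex i p (U : set Y) : dom i p -> nbhs p U ->
  exists2 r : R, 0 < r & forall z, ab (z - chart i p) < r ->
    [/\ dom i (cinv i p z), chart i (cinv i p z) = z & U (cinv i p z)].
Proof.
move=> ip Up; have /nbhs_ab[r r0 rH] := nbhsI2 (cinv_near p ip) (near_cinv p ip Up).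
by exists r => // z /rH[[]].
Qed.

Lemma nice_ex p (U : set Y) : nbhs p U -> exists N, [/\ nice N, N p & N `<=` U].
Proof.
move=> Up; have [i ip] := rs_cover p.
have [r r0 rH] := disc_ex ip Up.
(* A quarter of the radius is where [local_prim] provides primitives. *)
pose r4 := r / 4; have r40 : 0 < r4 by rewrite divr_gt0.
have r4r : r4 < r by rewrite /r4; lra.
pose N := [set q | dom i q /\ ab (chart i q - chart i p) < r4].
have Nin q : N q -> ab (chart i q - chart i p) < r by move=> [_ h]; exact: lt_trans r4r.
have psi z : ab (z - chart i p) < r4 -> N (cinv i p z).
  by move=> zr; have [h1 h2 _] := rH _ (lt_trans zr r4r); split => //; rewrite h2.
exists N; split; last first.
- by move=> q [iq qr]; have [_ _] := rH _ (lt_trans qr r4r); rewrite cinvK.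
- by split => //; rewrite subrr ab0.
split.
- rewrite openE => q [iq qr].
  have e0 : 0 < r4 - ab (chart i q - chart i p) by rewrite subr_gt0.
  have h := near_chart iq (near_ab (chart i q) e0).
  have h2 := nbhsI2 (dom_nbhs iq) h; apply: filterS h2 => y [iy yq].
  by split => //; have := abB3 (chart i y) (chart i q) (chart i p); lra.
- move=> w; pose g z := w i (cinv i p z).
  have gh z : ab (z - chart i p) < r -> exists d, cd g z d.
    move=> zr; have [iz zE _] := rH _ zr.
    have [d [hd _]] := diff_hol w iz; exists d.
    have := cd_chart iz hd; rewrite zE; apply: der_ext.
    have h3 := cinv_near (cinv i p z) iz; rewrite zE in h3.
    apply: filterS h3 => v [iv vE]; rewrite /g; congr (w i _).
    by rewrite -{2}vE cinvK.
  have [F dF] := @local_prim R g (chart i p) r (chart i p) r0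
     (fun z zr => let: ex_intro d hd := gh z zr in cd_cont hd) (fun z zr _ => gh z zr).
  have der0 q : N q -> der (chart i) (fun y => F (chart i y)) q (w i q).
    by move=> [iq qr]; have := chart_cd iq (dF _ qr); rewrite /g cinvK.
  exists (fun q => F (chart i q)) => q Nq; have [iq qr] := Nq.
  apply: (prim_at1 iq); split; first exact: der0.
  have e0 : 0 < r4 - ab (chart i q - chart i p) by rewrite subr_gt0.
  have h := near_chart iq (near_ab (chart i q) e0).
  have h2 := nbhsI2 (dom_nbhs iq) h; apply: filterS h2 => y [iy yq].
  exists (w i y); apply: der0; split => //.
  by have := abB3 (chart i y) (chart i q) (chart i p); lra.
- move=> f df a b Na Nb.
  suff key q : N q -> f q = f p by rewrite (key a Na) (key b Nb).
  move=> [iq qr]; pose g z := f (cinv i p z).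
  have dg z : ab (z - chart i p) < r4 -> cd g z 0.
    move=> zr; have [iz zE] := psi z zr.
    have [j jz fd] := df _ (psi z zr).
    have [d [d0 h1 h2]] := chart_change iz jz.
    have idc : {for cinv i p z, continuous (@idfun Y)} by exact: cvg_id.
    have := der_comp (f := @idfun Y) idc h1.1 fd; rewrite mul0r => fd'.
    have [_ zE' _] := rH _ (lt_trans zr r4r).
    have := cd_chart iz fd'; rewrite zE'; apply: der_ext.
    have h3 := cinv_near (cinv i p z) iz; rewrite zE' in h3.
    apply: filterS h3 => v [iv vE]; rewrite /g /=; congr (f _).
    by rewrite -{2}vE cinvK.
  by have := cd_cst dg qr; rewrite /g !cinvK.
move=> a b [ia ar] [ib br].
(* [nice] asks for a path continuous on the whole line, so the parameter of the segment is clamped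
   to [0, 1]. *)
pose s (t : R) : R := clamp (1 / 2) (1 / 2) t.
pose g t := chart i a + (chart i b - chart i a) * (s t)%:C.
have cs : continuous (fun t => (s t)%:C).
  move=> t; apply/(@contP R R (fun t => (s t)%:C) t) => e e0; apply/nbhs_R; exists e => // y yt.
  by rewrite -rmorphB/= abC; apply: le_lt_trans (clamp_lip _ _ _ _) yt.
have s01 t : 0 <= s t <= 1.
  have h20 : 0 < 1 / 2 :> R by rewrite divr_gt0.
  have := clamp_ball (1 / 2) t h20; rewrite -/(s t) ler_norml => /andP[h1 h2].
  by apply/andP; split; lra.
have gr t : ab (g t - chart i p) < r4.
  have /andP[s0 s1] := s01 t.
  have -> : g t - chart i p = (chart i a - chart i p) * (1 - s t)%:C + (chart i b - chart i p) * (s t)%:C.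
    by rewrite /g rmorphB rmorph1; ring.
  apply: le_lt_trans (abD _ _) _; rewrite !abM !abC !ger0_norm//; last by rewrite subr_ge0.
  pose m := Num.max (ab (chart i a - chart i p)) (ab (chart i b - chart i p)).
  have mr : m < r4 by rewrite gt_max ar br.
  apply: le_lt_trans mr.
  have h1 : ab (chart i a - chart i p) * (1 - s t) <= m * (1 - s t).
    by rewrite ler_wpM2r ?subr_ge0// le_max lexx.
  have h2 : ab (chart i b - chart i p) * s t <= m * s t.
    by rewrite ler_wpM2r// le_max lexx orbT.
  by lra.
have cg : continuous g.
  move=> t; have h := contD (cont_cst (chart i a) t) (contM (cont_cst (chart i b - chart i a) t) (cs t)).
  exact: h.
exists (fun t => cinv i p (g t)); split.
- move=> t; apply: (@continuous_comp _ _ _ g (cinv i p)); first exact: cg.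
  have [h1 h2 _] := rH _ (lt_trans (gr t) r4r).
  by have := cinv_cont (p := p) h1; rewrite h2.
- rewrite /g /s clampE; last by rewrite sub0r normrN ger0_norm.
  by rewrite mulr0 addr0 cinvK.
- rewrite /g /s clampE; last by rewrite ger0_norm; lra.
  by rewrite mulr1 addrC subrK cinvK.
- by move=> t; apply: psi.
Qed.

(** The premise says that [u] is harmonic. It attains its maximum by compactness; the set where it
    does is closed by continuity, open by the maximum principle, hence everything. *)
Lemma surface_max (u : Y -> R) :
  (forall p, exists2 f, (\forall q \near p, u q = complex.Re (f q)) &
     exists2 i, dom i p & exists d, hder i f p d) ->
  forall p q, u p = u q.
Proof.
move=> loc.
have cu : continuous u.
  move=> p; have [f fu [i ip [d hd]]] := loc p.
  have cf : {for p, continuous (fun q => complex.Re (f q))}.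
    by apply: (@continuous_comp _ _ _ f (@complex.Re R)); [exact: hder_cont ip hd|exact: continuous_Re].
  rewrite /continuous_at (nbhs_singleton fu).
  apply: cvg_trans cf; apply: near_eq_cvg.
  by apply: filterS fu => q ->.
have [m _ mP] := compact_EVT_max (@rs_nonempty _ Y) (@rs_compact _ Y) (continuous_subspaceT cu).
have umax q : u q <= u m by apply: mP; rewrite inE.
pose S := [set q | u q = u m].
have oS : open S.
  rewrite openE => p pS; have [f fu [i ip [d hd]]] := loc p.
  have [_ hn] := hd.
  have [r r0 rH] := disc_ex ip (nbhsI2 fu hn).
  pose g z := f (cinv i p z).
  have gh : hol g (chart i p) r.
    move=> z zr; have [iz zE [_ [e fe]]] := rH _ zr; exists e.
    have := cd_chart iz fe; rewrite zE; apply: der_ext.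
    have h3 := cinv_near (cinv i p z) iz; rewrite zE in h3.
    apply: filterS h3 => v [iv vE]; rewrite /g; congr (f _).
    by rewrite -{2}vE cinvK.
  have gp : complex.Re (g (chart i p)) = u m.
    by rewrite /g cinvK// -(nbhs_singleton fu).
  have gm z : ab (z - chart i p) < r -> complex.Re (g z) <= complex.Re (g (chart i p)).
    by move=> zr; have [_ _ [uz _]] := rH _ zr; rewrite gp /g -uz.
  have key := max_principle gh gm.
  have r40 : 0 < r / 4 by rewrite divr_gt0.
  have h := nbhsI2 (near_chart ip (near_ab (chart i p) r40)) (nbhsI2 (dom_nbhs ip) fu).
  apply: filterS h => q [/= qr [iq uq]]; rewrite /S /= uq -gp -(key _ qr) /g cinvK//.
have cS : closed S.
  have -> : S = u @^-1` [set u m] by apply/seteqP; split.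
  by apply: closed_comp => // p _; exact: cu.
have ST : S = setT.
  by apply: (@rs_connected _ Y); [exists m|exists S => //; rewrite setTI|exists S => //; rewrite setTI].
have uS q : u q = u m by have : S q by rewrite ST.
by move=> p q; rewrite !uS.
Qed.

Lemma hol_const f : (forall p, exists2 i, dom i p & exists d, hder i f p d) ->
  forall p q, f p = f q.
Proof.
move=> fh p q.
have h1 : complex.Re (f p) = complex.Re (f q).
  by apply: (@surface_max (fun q => complex.Re (f q))) => y; exists f => //; exact: filterE.
have h2 : complex.Im (f p) = complex.Im (f q).
  apply: (@surface_max (fun q => complex.Im (f q))) => y; exists (fun q => - 'i * f q).
    by apply: filterE => x; case: (f x) => a b /=; rewrite /Num.imaginary /= ; ring.
  by have [i iy [d hd]] := fh y; exists i => //; exists (- 'i * d); exact: hderZ.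
by rewrite [f p]complexE h1 h2 -complexE.
Qed.

End Diff.

Section DiffPrim.
Variables (R : realType) (Y : riemannSurface R).
Local Notation C := R[i].
Local Notation Om := (differential Y).
Implicit Types (p q : Y) (f g : Y -> C) (w : Om).

Lemma prim_ex w p : exists f, \forall q \near p, prim_at w f q.
Proof.
have [N [[oN pN _ _] Np _]] := nice_ex (filterT : nbhs p setT).
have [f fP] := pN w; exists f.
have nN : nbhs p N by apply: open_nbhs_nbhs.
by apply: filterS nN => q /fP.
Qed.

Lemma diff_eq_prim w w' : (forall p, exists2 f, prim_at w f p & prim_at w' f p) -> w = w'.
Proof.
move=> h; apply: diff_eq => i p ip; have [f f1 f2] := h p.
exact: hder_unique ip (f1 i ip) (f2 i ip).
Qed.

Lemma prim_at_ext w f g p : (\forall q \near p, f q = g q) -> prim_at w f p -> prim_at w g p.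
Proof. by move=> fg fp i ip; exact: hder_ext fg (fp i ip). Qed.

Lemma prim_at_cst w f c p : prim_at w f p -> prim_at w (fun q => f q + c) p.
Proof.
by move=> fp i ip; have h := hderD (fp i ip) (hder_cst i p c); rewrite addr0 in h.
Qed.

End DiffPrim.

(** * Pullback of holomorphic differentials *)

Section Pullback.
Variables (R : realType) (Y Z : riemannSurface R) (f : Y -> Z).
Hypothesis hf : holomorphic_map f.
Local Notation C := R[i].

Let cf : continuous f := hf.1.

(** The coefficient is that of [u] times the derivative of [f] in charts. The chain rule makes it
    independent of the chart on [Z], and it is holomorphic because the derivative of a holomorphic
    function is. *)
Lemma pb_ex (u : differential Z) : exists w : differential Y,
  forall i j p d, rs_dom Y i p -> rs_dom Z j (f p) ->
    hder i (fun q => rs_chart Z j (f q)) p d -> w i p = u j (f p) * d.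
Proof.
pose rel i p x := exists j d, [/\ rs_dom Z j (f p),
  hder i (fun q => rs_chart Z j (f q)) p d & x = u j (f p) * d].
have relu i p x y : rs_dom Y i p -> rel i p x -> rel i p y -> x = y.
  move=> ip [j [d [jp hd ->]]] [k [e [kp he ->]]].
  have [a [a0 h1 h2]] := chart_change jp kp.
  rewrite (diff_trans u jp kp h1) -mulrA; congr (_ * _).
  by apply: (hder_unique ip) he; exact: hder_comp cf hd h1.
pose c i p := xget 0 (rel i p).
have cE i j p d : rs_dom Y i p -> rs_dom Z j (f p) ->
    hder i (fun q => rs_chart Z j (f q)) p d -> c i p = u j (f p) * d.
  move=> ip jp hd; have r0 : rel i p (u j (f p) * d) by exists j, d.
  by rewrite /c; case: xgetP => [x _ xr|/(_ _ r0)//]; exact: relu xr r0.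
have [||w wE] := @mk_diff R Y c.
- move=> i p ip; have [j jp] := rs_cover (f p).
  have [d hd] := holomorphic_hder hf ip jp.
  pose k q := xget 0 (fun e => der (rs_chart Y i) (fun q => rs_chart Z j (f q)) q e).
  have kP : \forall q \near p, der (rs_chart Y i) (fun q => rs_chart Z j (f q)) q (k q).
    apply: filterS hd.2 => q [e he]; rewrite /k.
    by case: xgetP => [x _ //|/(_ _ he)].
  have [e ke] := hder_deriv ip kP.
  have [e' ue] := diff_hol u jp.
  have h1 := hderM ip (hder_comp cf hd ue) ke.
  eexists; apply: hder_ext h1.
  have jn : \forall q \near p, rs_dom Z j (f q) by exact: (@cf p _ (dom_nbhs jp)).
  have hn := hder_near hd.
  have hh := nbhsI2 (nbhsI2 jn hn) (nbhsI2 kP (dom_nbhs ip)).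
  apply: filterS hh => q [[jq [e2 he2]] [kq iq]].
  by rewrite (cE i j q e2)// (der_unique_chart iq kq he2.1).
- move=> i j p d ip jp hd; have [k kp] := rs_cover (f p).
  have [e he] := holomorphic_hder hf jp kp.
  rewrite (cE j k p e)// (cE i k p (e * d))// ?mulrA//.
  exact: hder_change jp ip he hd.
by exists w => i j p d ip jp hd; rewrite wE//; exact: cE.
Qed.

Definition pb (u : differential Z) : differential Y := projT1 (cid (pb_ex u)).

Lemma pbE u i j p d : rs_dom Y i p -> rs_dom Z j (f p) ->
  hder i (fun q => rs_chart Z j (f q)) p d -> pb u i p = u j (f p) * d.
Proof. by rewrite /pb; case: cid => w /= wE; exact: wE. Qed.

(** On primitives, pulling back is composition. Identities between pullbacks are checked on
    primitives through [diff_eq_prim]. *)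
Lemma pb_prim u g p : prim_at u g (f p) -> prim_at (pb u) (fun q => g (f q)) p.
Proof.
move=> gp i ip; have [j jp] := rs_cover (f p).
have [d hd] := holomorphic_hder hf ip jp.
by rewrite (pbE u ip jp hd); exact: hder_comp cf hd (gp j jp).
Qed.

Lemma pb_linear a u u' : pb (a *: u + u') = a *: pb u + pb u'.
Proof.
apply: diff_eq_prim => p; have [g gP] := prim_ex u (f p); have [g' gP'] := prim_ex u' (f p).
have h1 := nbhs_singleton gP; have h2 := nbhs_singleton gP'.
exists (fun q => a * g (f q) + g' (f q)).
  exact: (pb_prim (prim_atD (prim_atZ a h1) h2)).
exact: prim_atD (prim_atZ a (pb_prim h1)) (pb_prim h2).
Qed.

End Pullback.

(** * Integrals along paths and the period group *)

Section Conn.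
Variables (R : realType) (Y : riemannSurface R).
Local Notation C := R[i].
Local Notation Om := (differential Y).
Implicit Types (p q : Y) (f g : Y -> C) (w : Om) (I J : Om -> C).

Lemma within01P (c : R -> Y) : {within `[0, 1]%classic, continuous c} <->
  forall t : R, 0 <= t <= 1 -> forall U, nbhs (c t) U ->
    \forall s \near t, 0 <= s <= 1 -> U (c s).
Proof.
split=> [/subspace_continuousP h t t01 U cU|h].
  have t01' : `[0, 1]%classic t by rewrite /= in_itv.
  have := h t t01' U cU; rewrite /nbhs/= /within/=.
  by apply: filterS => s hs s01; apply: hs; rewrite in_itv.
apply/subspace_continuousP => t; rewrite /= in_itv /= => t01 U cU.
have := h t t01 U cU; rewrite /nbhs/= /within/=.
by apply: filterS => s hs; rewrite in_itv/=; exact: hs.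
Qed.

(* Paths are remembered only through the integrals along them. *)
Definition conn p q I : Prop := exists c : R -> Y,
  [/\ {within `[0, 1]%classic, continuous c}, c 0 = p, c 1 = q &
      forall w, path_integral c w (I w)].

Lemma conn_local (N : set Y) p q I : nice N -> N p -> N q ->
  (forall w, exists2 f, (forall y, N y -> prim_at w f y) & I w = f q - f p) ->
  conn p q I.
Proof.
move=> [oN _ _ cN] Np Nq hI; have [c [cc c0 c1 cin]] := cN p q Np Nq.
exists c; split => //; first exact: continuous_subspaceT.
move=> w; have [f fP IE] := hI w; exists (fun t => f (c t)); rewrite c0 c1; split => //.
move=> t t01; exists f; split; last by apply: filterE.
apply/primitive_nearP.
have nN : nbhs (c t) N by apply: open_nbhs_nbhs.
by apply: filterS nN => y /fP.
Qed.

Lemma conn_trans p q r I J : conn p q I -> conn q r J -> conn p r (fun w => I w + J w).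
Proof.
move=> [c [/within01P cc c0 c1 cI]] [e [/within01P ec e0 e1 eJ]].
(* A property near [t] is tested on the two halves of [0, 1] separately; at t = 1/2 both premises
   apply. *)
have near_half (P : R -> Prop) (t : R) : 0 <= t <= 1 ->
   (0 <= 2 * t <= 1 -> \forall s \near 2 * t, 0 <= s <= 1 -> P (s / 2)) ->
   (0 <= 2 * t - 1 <= 1 -> \forall s \near 2 * t - 1, 0 <= s <= 1 -> P ((s + 1) / 2)) ->
   \forall s \near t, 0 <= s <= 1 -> P s.
  move=> /andP[t0 t1] h1 h2.
  have twice (s : R) : 2 * s / 2 = s by lra.
  have [lt|tl] := ltP t (1 / 2).
    have [|d d0 dH] := (nbhs_R _ _).1 (h1 _); first by apply/andP; split; lra.
    apply/nbhs_R; exists (Num.min (d / 2) (1 / 2 - t)); first by rewrite lt_min divr_gt0// subr_gt0.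
    move=> s; rewrite lt_min ltr_norml ltr_norml => /andP[/andP[a1 a2] /andP[a3 a4]] /andP[s0 s1].
    have := dH (2 * s); rewrite twice.
    by apply; [rewrite ltr_norml; apply/andP; split; lra|apply/andP; split; lra].
  have [d2 d20 dH2] := (nbhs_R _ _).1 (h2 ltac:(apply/andP; split; lra)).
  have half (s : R) : (2 * s - 1 + 1) / 2 = s by lra.
  move: tl; rewrite le_eqVlt => /orP[/eqP tE|lt]; last first.
    apply/nbhs_R; exists (Num.min (d2 / 2) (t - 1 / 2)); first by rewrite lt_min divr_gt0// subr_gt0.
    move=> s; rewrite lt_min ltr_norml ltr_norml => /andP[/andP[a1 a2] /andP[a3 a4]] /andP[s0 s1].
    have := dH2 (2 * s - 1); rewrite half.
    by apply; [rewrite ltr_norml; apply/andP; split; lra|apply/andP; split; lra].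
  have [d1 d10 dH1] := (nbhs_R _ _).1 (h1 ltac:(apply/andP; split; lra)).
  apply/nbhs_R; exists (Num.min (d1 / 2) (d2 / 2)); first by rewrite lt_min !divr_gt0.
  move=> s; rewrite lt_min ltr_norml ltr_norml => /andP[/andP[a1 a2] /andP[a3 a4]] /andP[s0 s1].
  have [sl|sl] := leP s (1 / 2).
    have := dH1 (2 * s); rewrite twice.
    by apply; [rewrite ltr_norml; apply/andP; split; lra|apply/andP; split; lra].
  have := dH2 (2 * s - 1); rewrite half.
  by apply; [rewrite ltr_norml; apply/andP; split; lra|apply/andP; split; lra].
pose k (t : R) := if t <= 1 / 2 then c (2 * t) else e (2 * t - 1).
have k1 (s : R) : 0 <= s <= 1 -> k (s / 2) = c s.
  move=> /andP[s0 s1]; rewrite /k ifT; last lra.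
  by congr c; lra.
have k2 (s : R) : 0 <= s <= 1 -> k ((s + 1) / 2) = e s.
  move=> /andP[s0 s1]; rewrite /k; case: ifPn => [h|_]; last by congr e; lra.
  have -> : s = 0 by lra.
  rewrite e0 -c1; congr c; lra.
have kl (t : R) : t <= 1 / 2 -> k t = c (2 * t) by move=> h; rewrite /k h.
have kr (t : R) : 1 / 2 <= t -> k t = e (2 * t - 1).
  move=> h; rewrite /k; case: ifPn => [h'|//].
  have -> : 2 * t = 1 by lra.
  by rewrite subrr c1 e0.
exists k; split.
- apply/within01P => t t01 U kU; apply: near_half => // h01.
    have kt : k t = c (2 * t) by apply: kl; move: h01 => /andP[]; lra.
    rewrite kt in kU; have := cc _ h01 U kU.
    by apply: filterS => s hs s01; rewrite k1//; exact: hs.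
  have kt : k t = e (2 * t - 1) by apply: kr; move: h01 => /andP[]; lra.
  rewrite kt in kU; have := ec _ h01 U kU.
  by apply: filterS => s hs s01; rewrite k2//; exact: hs.
- by rewrite kl ?mulr0//; lra.
- by rewrite kr; [rewrite -e1; congr e; lra|lra].
move=> w; have [F [FP FE]] := cI w; have [G [GP GE]] := eJ w.
(* The shift makes the two halves agree at 1/2. *)
pose K (t : R) := if t <= 1 / 2 then F (2 * t) else G (2 * t - 1) + (F 1 - G 0).
have K1 (s : R) : 0 <= s <= 1 -> K (s / 2) = F s.
  move=> /andP[s0 s1]; rewrite /K ifT; last lra.
  by congr F; lra.
have K2 (s : R) : 0 <= s <= 1 -> K ((s + 1) / 2) = G s + (F 1 - G 0).
  move=> /andP[s0 s1]; rewrite /K; case: ifPn => [h|_]; last by congr (G _ + _); lra.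
  have s00 : s = 0 by lra.
  have -> : G s + (F 1 - G 0) = F 1 by rewrite s00; ring.
  by congr F; lra.
exists K; split; last first.
  have h0 : K 0 = F 0 by rewrite -[in LHS](mul0r (2^-1)) K1// lexx ler01.
  have h1 : K 1 = G 1 + (F 1 - G 0).
    have {1}-> : 1 = (1 + 1) / 2 :> R by lra.
    by rewrite K2// lexx ler01.
  by rewrite h0 h1 FE GE; ring.
move=> t t01; have [lt|gt] := leP t (1 / 2).
  have h01 : 0 <= 2 * t <= 1 by move: t01 => /andP[]; lra.
  have [f [fp fF]] := FP _ h01.
  exists f; rewrite kl//; split => //; apply: near_half => // h01'.
    by apply: filterS fF => s hs s01; rewrite k1// K1//; exact: hs.
  have tE : t = 1 / 2 by move: h01' => /andP[]; lra.
  have [g [gp gG]] := GP _ h01'.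
  have e20 : 2 * t - 1 = 0 by lra.
  have c21 : 2 * t = 1 by lra.
  have fgp : primitive_near w (e (2 * t - 1)) f by rewrite e20 e0 -c1 -c21.
  move/primitive_nearP : fgp => fgp; move/primitive_nearP : gp => gp.
  have [N [[oN _ zN _] Nt NU]] := nice_ex (nbhsI2 fgp gp).
  (* At the midpoint one primitive has to serve both halves. The primitives [f] and [g] differ by a
     constant on [N], which is read off at the common point [q]. *)
  have fg y : N y -> f y = g y + (F 1 - G 0).
    move=> Ny; have : f y - g y = f (e (2 * t - 1)) - g (e (2 * t - 1)).
      apply: (zN (fun y => f y - g y)) => // x Nx; have [h1 h2] := NU x Nx.
      have [i iq] := rs_cover x; exists i => //.
      exact: (prim_atB iq h1 h2).1.
    have fF1 : F 1 = f q.
      by have := nbhs_singleton fF; rewrite c21 c1; apply; rewrite lexx ler01.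
    have gG0 : G 0 = g q.
      by have := nbhs_singleton gG; rewrite e20 e0; apply; rewrite lexx ler01.
    rewrite e20 e0 fF1 gG0 => <-; ring.
  have eN : nbhs (e (2 * t - 1)) N by apply: open_nbhs_nbhs.
  have := ec _ h01' N eN.
  apply: filterS2 gG => s hg hs s01; rewrite k2// K2// hg//.
  by rewrite fg//; exact: hs.
have h01 : 0 <= 2 * t - 1 <= 1 by move: t01 => /andP[]; lra.
have [g [gp gG]] := GP _ h01.
exists (fun y => g y + (F 1 - G 0)); rewrite kr; last exact: ltW.
split.
  move/primitive_nearP : gp => gp; apply/primitive_nearP.
  by apply: filterS gp => y; exact: prim_at_cst.
apply: near_half => // h01'; first by exfalso; move: h01' => /andP[]; lra.
by apply: filterS gG => s hs s01; rewrite k2// K2// hs.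
Qed.

End Conn.

Section ConnTheory.
Variables (R : realType) (Y : riemannSurface R).
Local Notation C := R[i].
Local Notation Om := (differential Y).
Implicit Types (p q : Y) (f g : Y -> C) (w : Om) (I J : Om -> C).

Lemma nice_prim_eq (N : set Y) w f g : nice N ->
  (forall y, N y -> prim_at w f y) -> (forall y, N y -> prim_at w g y) ->
  forall a b, N a -> N b -> f b - f a = g b - g a.
Proof.
move=> [_ _ zN _] fP gP a b Na Nb.
have : f a - g a = f b - g b.
  apply: (zN (fun y => f y - g y)) => // y Ny; have [i iy] := rs_cover y; exists i => //.
  exact: (prim_atB iy (fP y Ny) (gP y Ny)).1.
move=> h; have -> : f b = f b - g b + g b by ring.
by rewrite -h; ring.
Qed.

(** Induction on paths: a relation compatible with concatenation holds for all paths once it holds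
    for short ones. The ends of a short piece lie in [N], while its integrals are increments of
    primitives on the larger nice set [U]. *)
Lemma conn_elim (Rl : Y -> Y -> (Om -> C) -> Prop) :
  (forall p (U : set Y), nice U -> U p -> exists N : set Y, [/\ open N, N p, N `<=` U &
     forall a b I, N a -> N b ->
       (forall w f, (forall q, U q -> prim_at w f q) -> I w = f b - f a) -> Rl a b I]) ->
  (forall a b c I J, Rl a b I -> Rl b c J -> Rl a c (fun w => I w + J w)) ->
  forall p q I, conn p q I -> Rl p q I.
Proof.
move=> loc tr p q I [c [/within01P cc <- <- cI]].
have [F FP] := choice cI.
have FPw w : _ := (FP w).1; have FE w : _ := (FP w).2.
have -> : I = (fun w => F w 1 - F w 0) by apply/funext.
pose P a b := Rl (c a) (c b) (fun w => F w b - F w a).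
apply: (@cousin R P 0 1 ler01); last first.
  move=> x y z _ _ _ _ h1 h2; have := tr _ _ _ _ _ h1 h2; rewrite /P.
  by congr (Rl _ _ _); apply/funext => w; rewrite addrC addrA subrK.
move=> t t01.
have [U [nU Ut _]] := nice_ex (filterT : nbhs (c t) setT).
have [N [oN Nt NU HN]] := loc (c t) U nU Ut.
have nN : nbhs (c t) N by apply: open_nbhs_nbhs.
have /nbhs_R[r r0 rH] := cc t t01 N nN.
exists r => // a b /andP[a0 at_] /andP[tb b1] ta bt.
have cin s : a <= s <= b -> N (c s).
  by move=> /andP[as_ sb]; apply: rH; [rewrite ltr_norml|]; apply/andP; split; lra.
have ab_ : a <= b := le_trans at_ tb.
apply: HN; [by apply: cin; rewrite lexx|by apply: cin; rewrite lexx andbT|].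
(* [F] is given by primitives that change along the path; a second use of Cousin's lemma compares
   all of them with the single primitive [f]. *)
move=> w f fP; pose G s := F w s - f (c s).
suff : G a = G b.
  rewrite /G => h.
  have -> : F w b = F w b - f (c b) + f (c b) by ring.
  by rewrite -h; ring.
apply: (@cousin R (fun x y => G x = G y) a b ab_) => [s sab|x y z _ _ _ _ -> //].
have s01 : 0 <= s <= 1 by move: sab => /andP[h1 h2]; apply/andP; split; lra.
have [g [/primitive_nearP gp gF]] := FPw w s s01.
have [N2 [[oN2 _ zN2 _] N2s N2U]] := nice_ex (nbhsI2 (open_nbhs_nbhs (conj oN (cin s sab))) gp).
have nN2 : nbhs (c s) N2 by apply: open_nbhs_nbhs.
have /nbhs_R[d1 d10 dH1] := gF.
have /nbhs_R[d2 d20 dH2] := cc s s01 N2 nN2.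
exists (Num.min d1 d2); first by rewrite lt_min d10.
move=> x y /andP[ax xs] /andP[sy yb] sx ys.
have inb_ z : x <= z <= y -> G z = g (c z) - f (c z) /\ N2 (c z).
  move=> /andP[xz zy].
  have m1 : Num.min d1 d2 <= d1 by rewrite ge_min lexx.
  have m2 : Num.min d1 d2 <= d2 by rewrite ge_min lexx orbT.
  have z01 : 0 <= z <= 1 by apply/andP; split; lra.
  split; last by apply: dH2 => //; rewrite ltr_norml; apply/andP; split; lra.
  by rewrite /G dH1//; rewrite ltr_norml; apply/andP; split; lra.
have xy : x <= y := le_trans xs sy.
have [-> Nx] := inb_ x ltac:(by rewrite lexx); have [-> Ny] := inb_ y ltac:(by rewrite lexx andbT).
apply: (zN2 (fun v => g v - f v)) => // v Nv; have [i iv] := rs_cover v; exists i => //.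
have [NV gV] := N2U v Nv.
exact: (prim_atB iv gV (fP v (NU v NV))).1.
Qed.

Lemma conn_nice (N : set Y) p q I : nice N -> N p -> N q ->
  (forall w f, (forall y, N y -> prim_at w f y) -> I w = f q - f p) -> conn p q I.
Proof.
move=> nN Np Nq h; apply: (conn_local nN) => // w.
by have [_ pN _ _] := nN; have [f fP] := pN w; exists f => //; exact: h.
Qed.

Lemma conn_refl p : conn p p (fun=> 0).
Proof.
have [N [nN Np _]] := nice_ex (filterT : nbhs p setT).
by apply: (conn_nice nN) => // w f _; rewrite subrr.
Qed.

Lemma conn_sym p q I : conn p q I -> conn q p (fun w => - I w).
Proof.
apply: (conn_elim (Rl := fun p q I => conn q p (fun w => - I w))).
  move=> x U nU Ux; exists U; split => //; first by case: nU.
  move=> a b J Ua Ub h; apply: (conn_nice nU) => // w f fP.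
  by rewrite (h w f fP) opprB.
move=> a b c I1 I2 h1 h2; have := conn_trans h2 h1.
by congr (conn _ _ _); apply/funext => w; rewrite opprD addrC.
Qed.

(** The set of points that can be reached from [p] is open and closed. *)
Lemma conn_ex p q : exists I, conn p q I.
Proof.
pose S := [set y | exists I, conn p y I].
have key x : exists N : set Y, [/\ open N, N x & forall a b, N a -> N b -> S a -> S b].
  have [N [nN Nx _]] := nice_ex (filterT : nbhs x setT).
  exists N; split => //; first by case: nN.
  move=> a b Na Nb [I aI].
  have [F FP] : exists F : Om -> Y -> C, forall w y, N y -> prim_at w (F w) y.
    by have [_ pN _ _] := nN; have [F FP] := choice pN; exists F.
  exists (fun w => I w + (F w b - F w a)); apply: conn_trans aI _.
  by apply: (conn_local nN) => // w; exists (F w) => //; exact: FP.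
have oS : open S.
  rewrite openE => x Sx; have [N [oN Nx NS]] := key x.
  have nN : nbhs x N by apply: open_nbhs_nbhs.
  by apply: filterS nN => y Ny; exact: NS Sx.
have cS : closed S.
  rewrite -openC openE => x Sx; have [N [oN Nx NS]] := key x.
  have nN : nbhs x N by apply: open_nbhs_nbhs.
  by apply: filterS nN => y Ny Sy; apply: Sx; exact: NS Sy.
have ST : S = setT.
  apply: (@rs_connected _ Y).
  - by exists p; exists (fun=> 0); exact: conn_refl.
  - by exists S => //; rewrite setTI.
  - by exists S => //; rewrite setTI.
by have : S q by rewrite ST.
Qed.

Lemma conn_linear p q I : conn p q I ->
  forall a w w', I (a *: w + w') = a * I w + I w'.
Proof.
apply: (conn_elim (Rl := fun p q I => forall a w w', I (a *: w + w') = a * I w + I w')).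
  move=> x U nU Ux; exists U; split => //; first by case: nU.
  move=> a b J Ua Ub h k w w'; have [_ pN _ _] := nU.
  have [f fP] := pN w; have [f' fP'] := pN w'.
  have hp y : U y -> prim_at (k *: w + w') (fun y => k * f y + f' y) y.
    by move=> Uy; exact: prim_atD (prim_atZ k (fP y Uy)) (fP' y Uy).
  by rewrite (h _ _ hp) (h _ _ fP) (h _ _ fP'); ring.
by move=> a b c I1 I2 h1 h2 k w w'; rewrite h1 h2; ring.
Qed.

Lemma periodsP (l : linform Om) : periods l <-> exists p, conn p p l.
Proof.
split=> [[c [h1 h2 h3]]|[p [c [h1 h2 h3 h4]]]]; last by exists c; split => //; rewrite h2 h3.
by exists (c 0); exists c.
Qed.

(** A loop is conjugated by a path, whose contributions to the integrals cancel. *)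
Lemma conn_base p0 p I : conn p p I -> conn p0 p0 I.
Proof.
move=> h; have [J hJ] := conn_ex p0 p.
have := conn_trans (conn_trans hJ h) (conn_sym hJ).
by congr (conn _ _ _); apply/funext => w; ring.
Qed.

Lemma linform_ex I : (forall a w w', I (a *: w + w') = a * I w + I w') ->
  exists l : linform Om, forall w, l w = I w.
Proof.
move=> h; have IP : (I : Om -> C^o) \in @linform_pred _ Om by apply/asboolP => a u v; exact: h.
by exists (LinForm IP).
Qed.

Lemma linformP (l : linform Om) a w w' : l (a *: w + w') = a * l w + l w'.
Proof. by have /asboolP h := valP l; exact: h. Qed.

Lemma linform_eq (l l' : linform Om) : (forall w, l w = l' w) -> l = l'.
Proof. by move=> h; apply: val_inj; apply/funext. Qed.

Lemma linformDE (l l' : linform Om) w : (l + l') w = l w + l' w. Proof. by []. Qed.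
Lemma linformNE (l : linform Om) w : (- l) w = - l w. Proof. by []. Qed.
Lemma linformZE a (l : linform Om) w : (a *: l) w = a * l w. Proof. by []. Qed.
Lemma linform0E w : (0 : linform Om) w = 0. Proof. by []. Qed.

Lemma period0 : periods (0 : linform Om).
Proof. by have [p _] := @rs_nonempty _ Y; apply/periodsP; exists p; exact: conn_refl. Qed.

Lemma periodN (l : linform Om) : periods l -> periods (- l).
Proof. by move=> /periodsP[p h]; apply/periodsP; exists p; exact: conn_sym. Qed.

Lemma periodD (l l' : linform Om) : periods l -> periods l' -> periods (l + l').
Proof.
move=> /periodsP[p h] /periodsP[q h']; apply/periodsP; exists p.
exact: conn_trans h (conn_base p h').
Qed.

Lemma fin_cover (W : Y -> set Y) : (forall x, open (W x)) -> (forall x, W x x) ->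
  exists s : seq Y, forall y, exists2 x, x \in s & W x y.
Proof.
move=> oW Wx.
(* The filter of lists containing a given finite list turns the near-covering form of compactness
   into a finite subcover. *)
pose F : set_system (seq Y) := [set A | exists s0 : seq Y, forall s : seq Y,
  (forall x, x \in s0 -> x \in s) -> A s].
have FF : Filter F.
  split; first by exists [::].
    move=> A B [s1 h1] [s2 h2]; exists (s1 ++ s2) => s hs.
    by split; [apply: h1|apply: h2] => x xs; apply: hs; rewrite mem_cat xs ?orbT.
  by move=> A B AB [s1 h1]; exists s1 => s hs; apply: AB; exact: h1.
have nc : near_covering [set: Y] by apply/compact_near_coveringP; exact: rs_compact.
have [|s0 h] := nc (seq Y) F (fun s y => exists2 x, x \in s & W x y) FF.
  move=> x _; exists (W x, [set s : seq Y | x \in s]).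
    split; first exact: (open_nbhs_nbhs (conj (oW x) (Wx x))).
    by exists [:: x] => s hs; apply: hs; rewrite inE.
  by move=> [y s] [/= Wxy xs]; exists x.
by exists s0 => y; exact: (h s0 (fun _ => id) y).
Qed.

(** The overlap of two sets of a cover may be disconnected. When both lie in one nice set, their
    primitives are restrictions, up to constants, of a common one, so their difference is constant
    on the whole overlap. *)
Lemma star_cover : exists W : Y -> set Y, [/\ forall x, nice (W x), forall x, W x x &
  forall x y z, W x z -> W y z -> exists U, [/\ nice U, W x `<=` U & W y `<=` U]].
Proof.
have [U UP] : exists U : Y -> set Y, forall x, nice (U x) /\ U x x.
  have h x : exists U : set Y, nice U /\ U x.
    by have [N [nN Nx _]] := nice_ex (filterT : nbhs x setT); exists N.
  by have [U UP] := choice h; exists U.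
have reg x : {for x, @regular_space Y}.
  exact: (compact_regular (@rs_hausdorff _ Y) (@rs_compact _ Y) filterT).
have [V VP] : exists V : Y -> set Y, forall x, [/\ open (V x), V x x & closure (V x) `<=` U x].
  have h x : exists V : set Y, [/\ open V, V x & closure V `<=` U x].
    have [nU Ux] := UP x; have [oU _ _ _] := nU.
    have nUx : nbhs x (U x) by apply: open_nbhs_nbhs.
    have [V nV cV] := reg x (U x) nUx.
    exists (interior V); split; [exact: open_interior|exact: nV|].
    by apply: subset_trans cV; apply: closure_subset; exact: interior_subset.
  by have [V VP] := choice h; exists V.
have [s sP] := fin_cover (fun x => let: And3 h _ _ := VP x in h) (fun x => let: And3 _ h _ := VP x in h).
(* [W x] will lie in every [U i] that contains [x] and miss every closure of [V i] that does not
   contain [x]. If [W v] meets [V i], then [v] is in the closure of [V i], hence in [U i], and [W v]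
   lies in [U i]. *)
have near_s x : \forall y \near x, forall i, i \in s ->
    (U i x -> U i y) /\ (~ closure (V i) x -> ~ closure (V i) y).
  elim: (s) => [|j s' IH]; first by apply: filterE.
  have h1 : \forall y \near x, U j x -> U j y.
    have [Ux|nUx] := pselect (U j x); last by apply: filterE.
    have [[oU _ _ _] _] := UP j.
    have nU : nbhs x (U j) by apply: open_nbhs_nbhs.
    by apply: filterS nU.
  have h2 : \forall y \near x, ~ closure (V j) x -> ~ closure (V j) y.
    have [Vx|nVx] := pselect (closure (V j) x); first by apply: filterE.
    have oc : open (~` closure (V j)) by rewrite openC; exact: closed_closure.
    have nc : nbhs x (~` closure (V j)) by apply: open_nbhs_nbhs.
    by apply: filterS nc.
  apply: filterS3 IH h1 h2 => y a b c i; rewrite inE => /orP[/eqP ->//|]; exact: a.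
have h x : exists N, [/\ nice N, N x & N `<=` [set y | forall i, i \in s ->
    (U i x -> U i y) /\ (~ closure (V i) x -> ~ closure (V i) y)]].
  exact: nice_ex (near_s x).
have [W WP] := choice h; exists W; split.
- by move=> x; case: (WP x).
- by move=> x; case: (WP x).
move=> x y z xz yz; have [i is_ Viz] := sP z; have [[nU _] [_ _ cV]] := (UP i, VP i).
have sub v : W v z -> W v `<=` U i.
  move=> vz; have [_ _ hv] := WP v.
  have Uv : U i v.
    apply: cV; apply: contrapT => nv; have [_ h2] := hv z vz i is_.
    by apply: (h2 nv); exact: subset_closure.
  by move=> v' /hv /(_ i is_) [h1 _]; exact: h1.
by exists (U i); split => //; exact: sub.
Qed.

End ConnTheory.

Section PeriodGroup.
Variables (R : realType) (Y : riemannSurface R).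
Local Notation C := R[i].
Local Notation Om := (differential Y).
Implicit Types (p q : Y) (f g : Y -> C) (w : Om) (I J : Om -> C).

Lemma periodB (l l' : linform Om) : periods l -> periods l' -> periods (l - l').
Proof. by move=> h h'; apply: periodD => //; exact: periodN. Qed.

Lemma periodMn (l : linform Om) n : periods l -> periods (l *+ n).
Proof.
move=> h; elim: n => [|n IH]; first by rewrite mulr0n; exact: period0.
by rewrite mulrS; exact: periodD.
Qed.

Lemma periodMz (l : linform Om) (n : int) : periods l -> periods (l *~ n).
Proof.
case: n => n h; first by rewrite -pmulrn; exact: periodMn.
by rewrite NegzE mulrNz; apply: periodN; rewrite -pmulrn; exact: periodMn.
Qed.

Lemma period_sum (T : finType) (F : T -> linform Om) :
  (forall t, periods (F t)) -> periods (\sum_t F t).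
Proof.
move=> h; elim/big_ind: _ => //; [exact: period0|exact: periodD].
Qed.

(* The loops gamma x y = G x - G y, taken on overlaps of a star-refined cover,
   generate: a loop subdivided along the cover telescopes into them. *)
Lemma periods_fg : exists (T : finType) (g : T -> linform Om),
  (forall t, periods (g t)) /\
  forall l, periods l -> exists m : T -> int, l = \sum_t g t *~ m t.
Proof.
have [W [nW Wx star]] := star_cover Y.
have oW x : open (W x) by case: (nW x).
have [s sP] := fin_cover oW Wx.
have [p0 _] := @rs_nonempty _ Y.
have [B BP] := choice (conn_ex p0).
have [f fP] : exists f : Y -> Om -> Y -> C, forall x w y, W x y -> prim_at w (f x w) y.
  have h x : exists f : Om -> Y -> C, forall w y, W x y -> prim_at w (f w) y.
    by have [_ pW _ _] := nW x; have [f fP] := choice pW; exists f.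
  by have [f fP] := choice h; exists f.
(* The integral from [p0] to the centre [x] and on to [a] inside [W x]. *)
pose G x a w := B x w + (f x w a - f x w x).
have Gconn x a : W x a -> conn p0 a (G x a).
  move=> xa; apply: conn_trans (BP x) _; apply: (conn_local (nW x)) => // w.
  by exists (f x w) => //; exact: fP.
have Gdiff x y a b : W x a -> W y a -> W x b -> W y b ->
    forall w, G x a w - G y a w = G x b w - G y b w.
  move=> xa ya xb yb w; have [U [nU xU yU]] := star x y a xa ya.
  have [_ pU _ _] := nU; have [h hP] := pU w.
  have e1 := nice_prim_eq (nW x) (fP x w) (fun y Wy => hP y (xU y Wy)) xa xb.
  have e2 := nice_prim_eq (nW y) (fP y w) (fun v Wv => hP v (yU v Wv)) ya yb.
  have e3 : f x w b - f x w a = f y w b - f y w a by rewrite e1 e2.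
  rewrite /G; apply/eqP; rewrite -subr_eq0.
  have -> : B x w + (f x w a - f x w x) - (B y w + (f y w a - f y w y)) -
    (B x w + (f x w b - f x w x) - (B y w + (f y w b - f y w y))) =
    (f y w b - f y w a) - (f x w b - f x w a) by ring.
  by rewrite e3 subrr.
pose T : finType := ('I_(size s) * 'I_(size s))%type.
pose pt (k : 'I_(size s)) := nth p0 s k.
(* Independent of the chosen point of the overlap by [Gdiff]; the zero functional, also a period, is
   used when there is no overlap. *)
pose gam (x y : Y) w := if pselect (exists z, W x z /\ W y z) is left h then
  G x (projT1 (cid h)) w - G y (projT1 (cid h)) w else 0.
have gamE x y z w : W x z -> W y z -> gam x y w = G x z w - G y z w.
  move=> xz yz; rewrite /gam; case: pselect => [h|]; last by case; exists z.
  by case: cid => /= v [xv yv]; exact: Gdiff.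
have gamconn x y : conn p0 p0 (gam x y).
  have [[z [xz yz]]|n] := pselect (exists z, W x z /\ W y z).
    have := conn_trans (Gconn x z xz) (conn_sym (Gconn y z yz)).
    by congr (conn _ _ _); apply/funext => w; rewrite (gamE x y z).
  have := conn_refl p0; congr (conn _ _ _); apply/funext => w.
  by rewrite /gam; case: pselect.
have [g gP] : exists g : T -> linform Om, forall t w, g t w = gam (pt t.1) (pt t.2) w.
  have h t : exists l : linform Om, forall w, l w = gam (pt t.1) (pt t.2) w.
    exact: linform_ex (conn_linear (gamconn _ _)).
  by have [g gP] := choice h; exists g.
have gper t : periods (g t).
  apply/periodsP; exists p0; have := gamconn (pt t.1) (pt t.2).
  by congr (conn _ _ _); apply/funext => w; rewrite gP.
exists T, g; split => // l.
pose span I := exists m : T -> int, forall w, I w = (\sum_t g t *~ m t : linform Om) w.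
have spanD I J : span I -> span J -> span (fun w => I w + J w).
  move=> [m mP] [n nP]; exists (fun t => m t + n t) => w.
  rewrite mP nP -linformDE -big_split/=; congr (linform_val _ w).
  by apply: eq_bigr => t _; rewrite mulrzDr.
have span_gam x y : x \in s -> y \in s -> span (gam x y).
  move=> xs ys.
  have xi : (index x s < size s)%N by rewrite index_mem.
  have yi : (index y s < size s)%N by rewrite index_mem.
  pose t0 : T := (Ordinal xi, Ordinal yi).
  exists (fun t => (t == t0)%:Z) => w.
  rewrite (bigD1 t0)//= eqxx mulr1z big1 ?addr0.
    by rewrite gP /t0 /pt /= !nth_index.
  by move=> t /negPf ->; rewrite mulr0z.
move=> /periodsP[p pl].
(* In the induction, a path from a to b is closed up by the comparison paths [G x a] and [G y b].
   For a loop and x = y these two cancel. *)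
suff key : forall x y, x \in s -> y \in s -> W x p -> W y p ->
    span (fun w => l w - G y p w + G x p w).
  have [x xs xp] := sP p; have [m mP] := key x x xs xs xp xp.
  by exists m; apply: linform_eq => w; rewrite -mP subrK.
apply: (conn_elim (Rl := fun a b I => forall x y, x \in s -> y \in s -> W x a ->
  W y b -> span (fun w => I w - G y b w + G x a w))) pl.
  move=> x U nU Ux; have [m ms mx] := sP x.
  (* Inside one [W m] the integral of the piece is [G m b - G m a], so the piece closed up is
     [gam m x2] plus [gam x1 m]. *)
  have nn : nbhs x (W m `&` U).
    apply: nbhsI2; apply: open_nbhs_nbhs; split => //.
    by case: nU.
  have [N [nN Nx NWU]] := nice_ex nn; exists N; split => //; first by case: nN.
    by move=> y /NWU[].
  move=> a b J Na Nb hJ x1 x2 s1 s2 w1 w2.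
  have [ma Ua] := NWU a Na; have [mb Ub] := NWU b Nb.
  have JE w : J w = G m b w - G m a w.
    have [_ pU _ _] := nU; have [h hP] := pU w.
    rewrite (hJ w h hP) (nice_prim_eq nN (fun y Ny => hP y (NWU y Ny).2)
       (fun y Ny => fP m w y (NWU y Ny).1) Na Nb) /G.
    by ring.
  have := spanD _ _ (span_gam m x2 ms s2) (span_gam x1 m s1 ms).
  congr (span _); apply/funext => w.
  by rewrite (gamE m x2 b)// (gamE x1 m a)// JE; ring.
move=> a b c I1 I2 h1 h2 x y xs ys xa yc; have [m ms mb] := sP b.
have := spanD _ _ (h1 x m xs ms xa mb) (h2 m y ms ys mb yc).
by congr (span _); apply/funext => w; ring.
Qed.

(** If M l is an integral combination of the generators, division of the coefficients by M leaves,
    modulo periods, a combination with coefficients r / M and 0 <= r < M: finitely many. *)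
Lemma periods_saturation (M : nat) : (0 < M)%N -> exists s : seq (linform Om),
  forall l, periods (l *+ M) -> exists2 a, a \in s & periods (l - a).
Proof.
move=> M0; have [T [g [gper gen]]] := periods_fg.
have MC0 : (M%:R : C) != 0 by rewrite pnatr_eq0 -lt0n.
pose a (r : {ffun T -> 'I_M}) : linform Om := M%:R^-1 *: \sum_t g t *+ r t.
exists [seq a r | r <- enum {ffun T -> 'I_M}] => l /gen[m mP].
have rP t : (`|(m t %% M)%Z| < M)%N.
  have h1 : (0 <= (m t %% M)%Z)%R by apply: modz_ge0; rewrite eqz_nat -lt0n.
  have h2 : ((m t %% M)%Z < M)%R by apply: ltz_pmod.
  by rewrite -ltz_nat gez0_abs.
pose r := [ffun t => Ordinal (rP t)].
exists (a r); first by apply: map_f; rewrite mem_enum.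
have -> : l - a r = \sum_t g t *~ (m t %/ M)%Z.
  apply: (scalerI MC0); rewrite scalerBr /a scalerA divff// scale1r.
  rewrite scaler_nat mP scaler_nat -sumrMnl -sumrB; apply: eq_bigr => t _.
  have h1 : (0 <= (m t %% M)%Z)%R by apply: modz_ge0; rewrite eqz_nat -lt0n.
  rewrite ffunE /= {1}(divz_eq (m t) M) mulrzDr -[(m t %% M)%Z in X in X - _]gez0_abs//.
  by rewrite -pmulrn addrK mulrzA.
by apply: period_sum => t; exact: periodMz.
Qed.

(** The real part of the integral of [w] from a base point is independent of the path and locally
    the real part of a primitive, so it is constant by [surface_max]; then the derivative of the
    primitive vanishes. *)
Lemma periods_imaginary w : (forall l, periods l -> complex.Re (l w) = 0) -> w = 0.
Proof.
move=> h; have [p0 _] := @rs_nonempty _ Y.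
have loop I : conn p0 p0 I -> complex.Re (I w) = 0.
  move=> hI; have [l lE] := linform_ex (conn_linear hI).
  rewrite -lE; apply: h; apply/periodsP; exists p0.
  by move: hI; congr (conn _ _ _); apply/funext => v; rewrite lE.
have [B BP] := choice (conn_ex p0).
pose u q := complex.Re (B q w).
have uloc p : exists2 f, (forall q, prim_at w f q -> prim_at w f q) &
    exists2 N, nice N /\ N p & (forall q, N q -> prim_at w f q) /\
      forall q, N q -> u q = complex.Re (f q).
  have [N [nN Np _]] := nice_ex (filterT : nbhs p setT).
  have [F FP] : exists F : Om -> Y -> C, forall v y, N y -> prim_at v (F v) y.
    by have [_ pN _ _] := nN; have [F FP] := choice pN; exists F.
  exists (fun q => F w q + (B p w - F w p)) => //; exists N => //; split.
    by move=> q Nq; apply: prim_at_cst; exact: FP.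
  move=> q Nq.
  have h1 : conn p q (fun v => F v q - F v p).
    by apply: (conn_local nN) => // v; exists (F v) => //; exact: FP.
  have h2 := loop _ (conn_trans (BP q) (conn_sym (conn_trans (BP p) h1))).
  move: h2; rewrite /u !(ReD, ReN) => h2; rewrite ?(ReD, ReN); lra.
have ucst : forall p q, u p = u q.
  apply: surface_max => p; have [f _ [N [nN Np] [fP fu]]] := uloc p.
  have nNp : nbhs p N by apply: open_nbhs_nbhs; split => //; case: nN.
  exists f; first by apply: filterS nNp => q; exact: fu.
  have [i ip] := rs_cover p; exists i => //; exists (w i p); exact: fP.
apply: diff_eq => i p ip; rewrite diff0E.
have [f _ [N [nN Np] [fP fu]]] := uloc p.
have nNp : nbhs p N by apply: open_nbhs_nbhs; split => //; case: nN.
have fd := cd_chart ip (fP p Np i ip).1.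
apply: (Re_cst_deriv fd).
have := nbhsI2 (near_cinv p ip nNp) (cinv_near p ip).
apply: filterS => z [Nz _]; rewrite cinvK// -(fu _ Nz) -(fu _ Np); exact: ucst.
Qed.

End PeriodGroup.

(** Substitution for path integrals; on a short piece it is [pb_prim]. *)
Lemma conn_map (R : realType) (Y Z : riemannSurface R) (f : Y -> Z)
    (hf : holomorphic_map f) p q I : conn p q I -> conn (f p) (f q) (fun u => I (pb hf u)).
Proof.
apply: (conn_elim (Rl := fun p q I => conn (f p) (f q) (fun u => I (pb hf u)))).
  move=> x U nU Ux.
  have [N' [nN' N'x _]] := nice_ex (filterT : nbhs (f x) setT).
  have nn : nbhs x (U `&` f @^-1` N').
    apply: nbhsI2; first by apply: open_nbhs_nbhs; split => //; case: nU.
    by apply: hf.1; apply: open_nbhs_nbhs; split => //; case: nN'.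
  have [N [nN Nx NU]] := nice_ex nn; exists N; split => //; first by case: nN.
    by move=> y /NU[].
  move=> a b J Na Nb hJ; apply: (conn_nice nN') => [||u g gP]; [exact: (NU a Na).2|exact: (NU b Nb).2|].
  have [_ pU _ _] := nU; have [F FP] := pU (pb hf u).
  rewrite (hJ _ F FP).
  have gfP y : N y -> prim_at (pb hf u) (fun y => g (f y)) y.
    by move=> Ny; exact: (pb_prim hf (gP _ (NU y Ny).2)).
  exact: (nice_prim_eq nN (fun y Ny => FP y (NU y Ny).1) gfP Na Nb).
by move=> a b c I1 I2; exact: conn_trans.
Qed.

(** * Quotients by automorphisms of finite order *)

Section Quotient.
Variables (R : realType) (Y Z : riemannSurface R) (s : Y -> Y) (f : Y -> Z) (n : nat).
Hypothesis n0 : (0 < n)%N.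
Hypothesis sn : forall p, iter n s p = p.
Hypothesis hs : holomorphic_map s.
Hypothesis quot : is_quotient_by s f.
Local Notation C := R[i].
Implicit Types (p q : Y) (y z : Z).

Lemma quot_hol : holomorphic_map f. Proof. by case: quot. Qed.
Local Notation hf := quot_hol.
Let cf : continuous f := hf.1.
Let fsurj z : exists p, f p = z. Proof. by case: quot. Qed.

Lemma iter_mod k p : iter (n * k) s p = p.
Proof. by elim: k => [|k IH]; rewrite ?muln0// mulnS iterD IH. Qed.

Lemma iter_inv k p : iter (n * k - k) s (iter k s p) = p.
Proof. by rewrite -iterD subnK ?iter_mod// leq_pmull. Qed.

Lemma quot_fiber p q : f p = f q <-> exists k, q = iter k s p.
Proof.
have [_ _ h] := quot; rewrite h; split=> [[k [->|->]]|[k ->]].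
- by exists k.
- by exists (n * k - k)%N; rewrite iter_inv.
- by exists k; left.
Qed.

Lemma iter_ltn k p : exists2 m, (m < n)%N & iter k s p = iter m s p.
Proof.
exists (k %% n)%N; first by rewrite ltn_mod.
by rewrite {1}(divn_eq k n) mulnC addnC iterD iter_mod.
Qed.

Lemma quot_iter k p : f (iter k s p) = f p.
Proof. by apply/esym/quot_fiber; exists k. Qed.

Lemma cont_iter k : continuous (iter k s).
Proof.
elim: k => [|k IH] p; first exact: cvg_id.
apply: (@continuous_comp _ _ _ (iter k s) s); first exact: IH.
exact: hs.1.
Qed.

(** The saturation of [A] is open, being a union of preimages of [A] under iterates of [s]. The
    image of its complement is compact, so closed, and it is the complement of the image of [A]. *)
Lemma quot_open (A : set Y) : open A -> open (f @` A).
Proof.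
move=> oA; pose B := f @^-1` (f @` A).
have oB : open B.
  have -> : B = \bigcup_(k in setT) (iter k s @^-1` A).
    apply/seteqP; split=> [p [q Aq fqp]|p [k _ Akp]].
      by have [k kE] := (quot_fiber p q).1 (esym fqp); exists k => //; rewrite /= -kE.
    by exists (iter k s p) => //; exact: quot_iter.
  apply: bigcup_open => k _; apply: open_comp => // p _; exact: cont_iter.
have cfB : closed (f @` (~` B)).
  apply: compact_closed; first exact: rs_hausdorff.
  apply: continuous_compact; first exact: continuous_subspaceT.
  apply: (@subclosed_compact _ _ setT) => //; last exact: rs_compact.
  by rewrite closedC.
have -> : f @` A = ~` (f @` (~` B)).
  apply/seteqP; split=> [z [q Aq <-] [p Bp fpq]|z nz].
    by apply: Bp; exists q.
  have [p pz] := fsurj z; have [Bp|nBp] := pselect (B p); first by rewrite -pz.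
  by exfalso; apply: nz; exists p.
by rewrite openC.
Qed.

Lemma near_quot p (P : set Z) : (\forall q \near p, P (f q)) -> \forall z \near f p, P z.
Proof.
move=> h; have : nbhs p (f @^-1` P) := h.
rewrite nbhsE => [[A [oA Ap] AP]] {h}.
suff h : nbhs (f p) P by exact: h.
have h : nbhs (f p) (f @` A).
  by apply: open_nbhs_nbhs; split; [exact: quot_open|exists p].
by apply: filterS h => _ [q Aq <-]; exact: AP.
Qed.

Lemma fiber_isolated p : \forall q \near p, f q = f p -> q = p.
Proof.
have h m : \forall q \near p, forall k, (k < m)%N -> q = iter k s p -> q = p.
  elim: m => [|m IH]; first by apply: filterE.
  have [e|ne] := pselect (iter m s p = p).
    apply: filterS IH => q hq k; rewrite ltnS leq_eqVlt => /orP[/eqP -> ->//|]; exact: hq.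
  have oc : open (~` [set iter m s p]).
    rewrite openC; apply: compact_closed; first exact: rs_hausdorff.
    exact: compact_set1.
  have nc : nbhs p (~` [set iter m s p]).
    exact: (open_nbhs_nbhs (conj oc (fun h => ne (esym h)))).
  apply: filterS2 IH nc => q hq nq k; rewrite ltnS leq_eqVlt => /orP[/eqP -> qE|]; last exact: hq.
  by case: nq.
apply: filterS (h n) => q hq fqp.
have [k kE] := (quot_fiber p q).1 (esym fqp).
have [m mn mE] := iter_ltn k p.
by apply: (hq m mn); rewrite kE.
Qed.

(** Ramification is isolated: the derivative of [f] in charts is holomorphic, and if it vanished
    near [p], then [f] would be constant there, against [fiber_isolated]. *)
Lemma quot_deriv i j p : rs_dom Y i p -> rs_dom Z j (f p) ->
  \forall q \near p, q <> p -> exists2 d, d != 0 & hder i (fun x => rs_chart Z j (f x)) q d.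
Proof.
move=> ip jp; have [d0 hd0] := holomorphic_hder hf ip jp.
pose k q := xget 0 (fun e => der (rs_chart Y i) (fun q => rs_chart Z j (f q)) q e).
have kP : \forall q \near p, der (rs_chart Y i) (fun q => rs_chart Z j (f q)) q (k q).
  apply: filterS hd0.2 => q [e he]; rewrite /k.
  by case: xgetP => [x _ //|/(_ _ he)].
have [e [_ ke]] := hder_deriv ip kP.
have [r r0 rH] := disc_ex ip (nbhsI2 ke kP).
pose g (v : C) := k (cinv i p v).
have gh : hol g (rs_chart Y i p) r.
  move=> z zr; have [iz zE [[e' fe] _]] := rH _ zr; exists e'.
  have := cd_chart iz fe; rewrite zE; apply: der_ext.
  have h3 := cinv_near (cinv i p z) iz; rewrite zE in h3.
  apply: filterS h3 => v [iv vE]; rewrite /g; congr (k _).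
  by rewrite -{2}vE cinvK.
have [z0|[r' r'0 nz]] := isolated_zeros r0 gh.
  exfalso.
  have kz : \forall q \near p, k q = 0.
    apply: filterS2 (near_chart ip z0) (dom_nbhs ip) => q.
    by rewrite /g => + iq; rewrite cinvK.
  have jn : \forall q \near p, rs_dom Z j (f q) by exact: (@cf p _ (dom_nbhs jp)).
  have nn := nbhsI2 (nbhsI2 kP kz) (nbhsI2 (nbhsI2 (dom_nbhs ip) jn) (fiber_isolated p)).
  have [N [[oN _ zN _] Np NU]] := nice_ex nn.
  have nN : nbhs p N by apply: open_nbhs_nbhs.
  have [q Nq qp] := chart_nonisolated ip nN.
  have [_ [[_ jq] iso]] := NU q Nq.
  suff e1 : q = p by rewrite e1 eqxx in qp.
  apply: iso; apply: (rs_inj jq jp).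
  apply: (zN (fun x => rs_chart Z j (f x))) => // x Nx.
  have [[kx kx0] [[ix _] _]] := NU x Nx; exists i; first exact: ix.
  by have := kx; rewrite kx0.
have h1 := near_chart ip (near_ab (rs_chart Y i p) r'0).
have hn := hder_near hd0.
apply: filterS2 (nbhsI2 h1 (dom_nbhs ip)) (nbhsI2 kP hn) => q [qr iq] [kq [e' he']] qp.
exists (k q); last by rewrite (der_unique_chart iq kq he'.1).
have := nz _ qr; rewrite /g cinvK//; apply.
by apply/eqP => h; apply: qp; exact: rs_inj h.
Qed.

Section Descent.
Variable w : differential Y.
Hypothesis sw : pb hs w = w.

Lemma prim_iter k g p : prim_at w g (iter k s p) -> prim_at w (fun q => g (iter k s q)) p.
Proof.
elim: k g => [|k IH] g //= h.
by apply: (IH (fun q => g (s q))); rewrite -sw; exact: pb_prim.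
Qed.

(** A local potential near [z] of the form on [Z] to be found: holomorphic at [z], and a primitive
    of [w] after composition with [f], at all points of the nearby fibres. *)
Definition good z (G : Z -> C) := (forall j, rs_dom Z j z -> exists d, hder j G z d) /\
  \forall z' \near z, forall p, f p = z' -> prim_at w (fun q => G (f q)) p.

Lemma good_near z G : good z G -> \forall z' \near z, good z' G.
Proof.
move=> [h1 h2]; have [j jz] := rs_cover z; have [d hd] := h1 j jz.
apply: filterS3 (hder_near hd) (near_join h2) (dom_nbhs jz) => z' [e he] h jz'.
split => // k kz'; have [a [_ _ h3]] := chart_change jz' kz'.
by exists (e * a^-1); exact: hder_change jz' kz' he h3.
Qed.

(** Estimates near [q] become estimates near [f q] because [f] is open. *)
Lemma der_pushforward i j q (g : Y -> C) (G : Z -> C) d e : d != 0 ->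
  der (rs_chart Y i) (fun x => rs_chart Z j (f x)) q d -> der (rs_chart Y i) g q e ->
  (\forall x \near q, G (f x) = g x) -> der (rs_chart Z j) G (f q) (e / d).
Proof.
move=> d0 fd ge Gg.
have idc : {for q, continuous (@idfun Y)} by exact: cvg_id.
have := der_comp (f := @idfun Y) idc (der_inv d0 fd) ge.
move=> /der_epsP h; apply/der_epsP => eps eps0.
have Gq := nbhs_singleton Gg.
by apply: near_quot; apply: filterS2 (h eps eps0) Gg => x /= hx ->; rewrite Gq.
Qed.

(** A primitive [g] of [w] near a preimage [p] is invariant near [p] under the powers of [s] that
    fix [p], and the other powers move a small neighbourhood off itself, so [g] descends to a
    function [G]. Off [z] the map [f] is unramified nearby and [G] is differentiable. *)
Lemma good_ex z : exists G, good z G.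
Proof.
have [p pz] := fsurj z; have [i ip] := rs_cover p; have [j jz] := rs_cover z.
have [g gP] := prim_ex w p.
(* The neighbourhood is shrunk for one power of [s] at a time. For a power fixing [p], the
   difference of [g] and its translate has derivative 0 and vanishes at [p]. *)
have stab m : exists2 A, nbhs p A & forall k, (k < m)%N -> forall q, A q ->
    A (iter k s q) -> g (iter k s q) = g q.
  elim: m => [|m [A pA AP]]; first by exists setT => //; exact: filterT.
  have ext (B : set Y) : nbhs p B -> (forall q, B q -> B (iter m s q) -> g (iter m s q) = g q) ->
    exists2 A, nbhs p A & forall k, (k < m.+1)%N -> forall q, A q ->
      A (iter k s q) -> g (iter k s q) = g q.
    move=> pB BP; exists (A `&` B); first exact: nbhsI2.
    move=> k; rewrite ltnS leq_eqVlt => /orP[/eqP -> q [_ Bq] [_ Bq']|km q [Aq _] [Aq' _]].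
      exact: BP.
    exact: AP.
  have [e|ne] := pselect (iter m s p = p).
    have c := @cont_iter m p.
    have gs : \forall q \near p, prim_at w g (iter m s q).
      have gP' : \forall q \near iter m s p, prim_at w g q by rewrite e.
      exact: (c _ gP').
    have [N [[oN _ zN _] Np NU]] := nice_ex (nbhsI2 gP gs).
    have nN : nbhs p N by apply: open_nbhs_nbhs.
    apply: (ext N nN) => q Nq _.
    have : g (iter m s q) - g q = g (iter m s p) - g p.
      apply: (zN (fun q => g (iter m s q) - g q)) => // x Nx.
      have [h1 h2] := NU x Nx; have [l lx] := rs_cover x; exists l => //.
      exact: (prim_atB lx (prim_iter h2) h1).1.
    by rewrite e subrr => /eqP; rewrite subr_eq0 => /eqP.
  have hd := @rs_hausdorff _ Y; rewrite open_hausdorff in hd.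
  have neb : iter m s p != p by apply/eqP.
  have [[B B'] [/= Bp Bp'] [oB oB' /eqP BB']] := hd _ _ neb.
  have nB' : nbhs p B'.
    by apply: open_nbhs_nbhs; split; [exact: oB'|exact: set_mem].
  have nBi : nbhs (iter m s p) B.
    by apply: open_nbhs_nbhs; split; [exact: oB|exact: set_mem].
  have nB := @cont_iter m p _ nBi.
  apply: (ext _ (nbhsI2 nB nB')) => q [Bq _] [_ B'q].
  have : (B `&` B') (iter m s q) by [].
  by rewrite BB'.
have [A pA AP] := stab n.
have jp : rs_dom Z j (f p) by rewrite pz.
have cnear := @cf p _ (dom_nbhs jp).
have [N [[oN _ _ _] Np NU]] := nice_ex (nbhsI2 (nbhsI2 pA gP) (nbhsI2 (quot_deriv ip jp) (nbhsI2 cnear (dom_nbhs ip)))).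
pose G z' := g (xget p [set q | N q /\ f q = z']).
have GE q : N q -> G (f q) = g q.
  move=> Nq; rewrite /G; case: xgetP => [x _ [Nx fx]|/(_ q)]; last by case.
  have [k kE] := (quot_fiber q x).1 (esym fx).
  have [m mn mE] := iter_ltn k q; rewrite kE mE.
  have [[Aq _] _] := NU q Nq; have [[Ax _] _] := NU x Nx.
  by apply: AP => //; rewrite -mE -kE.
have oU : open (f @` N) by exact: quot_open.
have nU : nbhs z (f @` N) by apply: open_nbhs_nbhs; split => //; exists p.
have GEn q : N q -> \forall x \near q, G (f x) = g x.
  move=> Nq; have nN : nbhs q N by apply: open_nbhs_nbhs.
  by apply: filterS nN => x; exact: GE.
have Gprim z' p' : (f @` N) z' -> f p' = z' -> prim_at w (fun q => G (f q)) p'.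
  move=> [q Nq fq] fp'.
  have [k kE] := (quot_fiber p' q).1 (etrans fp' (esym fq)).
  have [[_ gq] _] := NU q Nq.
  have h : prim_at w (fun x => g (iter k s x)) p' by apply: prim_iter; rewrite -kE.
  apply: prim_at_ext h.
  have nk : nbhs (iter k s p') N by rewrite -kE; apply: open_nbhs_nbhs.
  have nk' : nbhs p' (iter k s @^-1` N) := @cont_iter k p' _ nk.
  by apply: filterS nk' => x Nx; rewrite -(GE _ Nx) quot_iter.
have Gcont z' : (f @` N) z' -> {for z', continuous G}.
  move=> [q Nq <-]; have [[_ gq] _] := NU q Nq.
  have [l lq] := rs_cover q; have cg := hder_cont lq (gq l lq).
  move=> O; rewrite GE// => nO; apply: near_quot.
  by apply: filterS2 (GEn q Nq) (cg _ nO) => x /= ->.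
have Gder z' : (f @` N) z' -> z' <> z -> exists d, der (rs_chart Z j) G z' d.
  move=> [q Nq fq] z'z.
  have [[_ gq] [hq [_ iq]]] := NU q Nq.
  have [|d d0 hd] := hq; first by move=> qp; apply: z'z; rewrite -fq qp.
  exists (w i q / d); rewrite -fq.
  exact: der_pushforward d0 hd.1 (gq i iq).1 (GEn q Nq).
have [r r0 rH] := disc_ex jz nU.
pose H v := G (cinv j z v).
(* At [z], possibly a branch point, continuity of [G] is all that is known, and the singularity is
   removable. *)
have Hh : hol H (rs_chart Z j z) r.
  apply: (removable r0).
    move=> v vr; have [jv vE Uv] := rH v vr.
    apply: (@continuous_comp _ _ _ (cinv j z) G); last exact: Gcont.
    by have := cinv_cont (p := z) jv; rewrite vE.
  move=> v vr vz; have [jv vE Uv] := rH v vr.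
  have [|d hd] := Gder _ Uv; first by move=> h; move: vz; rewrite -vE h eqxx.
  exists d; have := cd_chart jv hd; rewrite vE; apply: der_ext.
  have h3 := cinv_near (cinv j z v) jv; rewrite vE in h3.
  apply: filterS h3 => v' [iv' vE']; rewrite /H; congr (G _).
  by rewrite -{2}vE' cinvK.
have Gall : \forall z' \near z, exists d, der (rs_chart Z j) G z' d.
  apply: filterS2 (near_chart jz (near_ab (rs_chart Z j z) r0)) (dom_nbhs jz) => z' zr jz'.
  have [d hd] := Hh _ zr; exists d; apply: der_ext (chart_cd jz' hd).
  by apply: filterS (dom_nbhs jz') => x jx; rewrite /H cinvK.
exists G; split.
  have [d hd] := nbhs_singleton Gall.
  have h1 : hder j G z d by [].
  move=> l lz; have [a [_ _ h3]] := chart_change jz lz.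
  by exists (d * a^-1); exact: hder_change jz lz h1 h3.
by apply: filterS nU => z' Uz' p'; exact: Gprim.
Qed.

Lemma good_unique z G G' j d d' : rs_dom Z j z -> good z G -> good z G' ->
  hder j G z d -> hder j G' z d' -> d = d'.
Proof.
move=> jz [_ h1] [_ h2] hd hd'.
have [p pz] := fsurj z; rewrite -pz in h1 h2.
have nn := @cf p _ (nbhsI2 h1 h2).
have [N [[oN _ zN _] Np NU]] := nice_ex nn.
have nN : nbhs p N by apply: open_nbhs_nbhs.
have cst q : N q -> G (f q) - G' (f q) = G (f p) - G' (f p).
  move=> Nq; apply: (zN (fun q => G (f q) - G' (f q))) => // x Nx.
  have [e1 e2] := NU x Nx; have [i ix] := rs_cover x; exists i => //.
  exact: (prim_atB ix (e1 x erefl) (e2 x erefl)).1.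
have nz : \forall z' \near z, G (f p) - G' (f p) = G z' - G' z'.
  rewrite -pz; apply: near_quot; apply: filterS nN => q Nq; exact/esym/cst.
have e0 := hder_ext nz (hder_cst j z (G (f p) - G' (f p))).
have := hder_unique jz (hderB hd hd') e0.
by move/eqP; rewrite subr_eq0 => /eqP.
Qed.

Lemma descent : exists u : differential Z, pb hf u = w.
Proof.
pose c j z := xget 0 (fun x => exists2 G, good z G & hder j G z x).
have cE j z G : rs_dom Z j z -> good z G -> hder j G z (c j z).
  move=> jz gG; have [d hd] := gG.1 j jz.
  rewrite /c; case: xgetP => [x _ [G' gG' hx]|/(_ d) []]; last by exists G.
  by rewrite (good_unique jz gG' gG hx hd).
have [||u uE] := @mk_diff R Z c.
- move=> j z jz; have [G gG] := good_ex z.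
  apply: (hder_deriv (f := G) jz).
  apply: filterS2 (good_near gG) (dom_nbhs jz) => z' gz' jz'.
  exact: (cE j z' G jz' gz').1.
- move=> j k z d jz kz hd; have [G gG] := good_ex z.
  have h := hder_change kz jz (cE k z G kz gG) hd.
  exact: hder_unique jz (cE j z G jz gG) h.
exists u; apply: diff_eq_prim => p; have [G gG] := good_ex (f p).
exists (fun q => G (f q)); last exact: (nbhs_singleton gG.2).
have [j jp] := rs_cover (f p).
by apply: pb_prim; apply: (prim_at1 jp); rewrite uE//; exact: cE.
Qed.

End Descent.

Lemma pb_inj (u : differential Z) : pb hf u = 0 -> u = 0.
Proof.
move=> u0; apply: diff_eq => j z jz; rewrite diff0E.
have [p pz] := fsurj z; have [g gP] := prim_ex u (f p).
have nn := @cf p _ gP.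
have [N [[oN _ zN _] Np NU]] := nice_ex nn.
have nN : nbhs p N by apply: open_nbhs_nbhs.
have cst q : N q -> g (f q) = g (f p).
  move=> Nq; apply: (zN (fun q => g (f q))) => // x Nx.
  have [i ix] := rs_cover x; exists i => //.
  have := pb_prim hf (NU x Nx); rewrite u0 => h; exact: (h i ix).1.
have nz : \forall z' \near f p, g (f p) = g z'.
  by apply: near_quot; apply: filterS nN => q Nq; exact/esym/cst.
have gz := nbhs_singleton gP; rewrite pz in gz nz.
exact: hder_unique jz (gz j jz) (hder_ext nz (hder_cst j z (g z))).
Qed.

Lemma pb_quot_inv (u : differential Z) : pb hs (pb hf u) = pb hf u.
Proof.
apply: diff_eq_prim => p; have [g gP] := prim_ex u (f p).
have h := nbhs_singleton gP; exists (fun q => g (f q)); last exact: pb_prim.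
have e q : f (s q) = f q := quot_iter 1 q.
have h' : prim_at u g (f (s p)) by rewrite e.
apply: prim_at_ext (pb_prim hs (pb_prim hf h')).
by apply: filterE => q; rewrite e.
Qed.

Lemma conn_iter k p q J : conn p q J -> exists J', conn (iter k s p) (iter k s q) J' /\
  forall w, pb hs w = w -> J' w = J w.
Proof.
move=> h; elim: k => [|k [J' [h1 h2]]]; first by exists J.
exists (fun u => J' (pb hs u)); split; first exact: (conn_map hs h1).
by move=> w sw; rewrite sw; exact: h2.
Qed.

(** Path lifting that tolerates ramification. The ends of a short piece are lifted into one nice
    set, whose points are connected, and an iterate of [s] moves the lift to the prescribed start.
    Forms pulled back from [Z] are invariant, so their integrals do not change. *)
Lemma conn_lift z z' I : conn z z' I -> forall p, f p = z ->
  exists p' J, [/\ f p' = z', conn p p' J & forall u, J (pb hf u) = I u].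
Proof.
apply: (conn_elim (Rl := fun z z' I => forall p, f p = z ->
  exists p' J, [/\ f p' = z', conn p p' J & forall u, J (pb hf u) = I u])).
  move=> x U nU Ux; have [p0 p0x] := fsurj x.
  have oU : open U by case: nU.
  have nn : nbhs p0 (f @^-1` U) by apply: cf; apply: open_nbhs_nbhs; rewrite p0x.
  have [N [nN Np NU]] := nice_ex nn; exists (f @` N).
  split; [by apply: quot_open; case: nN|by exists p0|by move=> _ [q Nq <-]; exact: NU|].
  move=> a b J [a' Na' fa'] [b' Nb' fb'] hJ p pa.
  have [k kE] := (quot_fiber a' p).1 (etrans fa' (esym pa)).
  have [F FP] : exists F : differential Y -> Y -> C, forall v x, N x -> prim_at v (F v) x.
    by have [_ pN _ _] := nN; have [F FP] := choice pN; exists F.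
  have h0 : conn a' b' (fun v => F v b' - F v a').
    by apply: (conn_local nN) => // v; exists (F v) => //; exact: FP.
  have [J' [h1 h2]] := conn_iter k h0.
  exists (iter k s b'), J'; split; [by rewrite quot_iter|by rewrite kE|].
  move=> u; rewrite h2; last exact: pb_quot_inv.
  have [_ pU _ _] := nU; have [g gP] := pU u; rewrite (hJ u g gP) -fa' -fb'.
  have gfP v : N v -> prim_at (pb hf u) (fun v => g (f v)) v.
    by move=> Nv; exact: (pb_prim hf (gP _ (NU v Nv))).
  exact: (nice_prim_eq nN (FP _) gfP Na' Nb').
move=> a b c I1 I2 h1 h2 p pa; have [p1 [J1 [e1 c1 j1]]] := h1 p pa.
have [p2 [J2 [e2 c2 j2]]] := h2 p1 e1.
exists p2, (fun v => J1 v + J2 v); split => //; first exact: conn_trans c1 c2.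
by move=> u; rewrite j1 j2.
Qed.

End Quotient.

(** * Curves in complex tori *)

Lemma ord2P (k : 'I_2) : k = 0 \/ k = 1.
Proof. by case: k => [[|[|//]]] ?; [left|right]; exact: val_inj. Qed.

Section VectorDeriv.
Variables (R : realType) (Y : riemannSurface R).
Local Notation C := R[i].
Local Notation V := 'rV[R[i]]_2.

Lemma is_derive_coord (g : C -> V) (z : C) (d : V) k :
  is_derive z 1 g d -> is_derive z 1 (fun z => g z 0 k) (d 0 k).
Proof.
move=> [dg gd].
have h : (fun h => h^-1 *: ((g \o shift z) (h *: 1) - g z)) @ 0^' --> d.
  move: dg gd; rewrite /derivable /derive => /cvg_ex[l hl].
  move=> gd; have e := cvg_lim (@norm_hausdorff _ _) hl; rewrite e in gd.
  by rewrite -gd; exact: hl.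
have h2 : (fun h => h^-1 *: (((fun z => g z 0 k) \o shift z) (h *: 1) - g z 0 k)) @ 0^' --> d 0 k.
  have := @cvg_comp _ _ _ _ (fun v : V => v 0 k) _ _ _ h (@coord_continuous _ _ _ 0 k d).
  apply: cvg_trans; apply: near_eq_cvg; apply: filterE => t /=.
  by rewrite !mxE.
split; first by rewrite /derivable; apply/cvg_ex; exists (d 0 k).
by rewrite /derive; exact: (cvg_lim (@norm_hausdorff _ _) h2).
Qed.

Lemma chart_deriv_coord i (s : Y -> V) p d k : rs_dom Y i p ->
  chart_deriv (rs_chart Y i) s p d -> hder i (fun q => s q 0 k) p (d 0 k).
Proof.
move=> ip [g [g1 g2 g3]]; apply/hderP => //; exists (fun z => g z 0 k); split.
- apply: filterS g1 => z /derivableP h.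
  by have [] := is_derive_coord k h.
- by apply: filterS g2 => q ->.
- exact: is_derive_coord.
Qed.

End VectorDeriv.

Section TorusCurve.
Variables (R : realType) (L D : set 'rV[R[i]]_2) (Y : riemannSurface R) (u : 'rV[R[i]]_2 -> Y).
Local Notation C := R[i].
Local Notation V := 'rV[R[i]]_2.

(** What the local theory needs of L and L'; for L' it is deduced from L in [extension_discrete]. *)
Definition discrete_subgroup (L : set V) := is_subgroup L /\
  exists2 e : R, 0 < e & forall l, L l -> (forall k, ab (l 0 k) < e) -> l = 0.

Hypothesis dL : discrete_subgroup L.
Hypothesis hY : is_curve_in_torus L D u.

Let L0 : L 0. Proof. by case: dL => [[]]. Qed.
Let LB x y : L x -> L y -> L (x - y). Proof. by case: dL => [[_ h] _]; exact: h. Qed.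
Let LN x : L x -> L (- x). Proof. by move=> h; rewrite -sub0r; exact: LB. Qed.
Let LD x y : L x -> L y -> L (x + y).
Proof. by move=> hx hy; rewrite -[y]opprK; apply: LB => //; exact: LN. Qed.

Lemma curve_surj p : exists2 v, D v & u v = p.
Proof. by case: hY. Qed.

Lemma curve_eq v w : D v -> D w -> u v = u w <-> L (v - w).
Proof. by case: hY => _ h _; exact: h. Qed.

(** A local lift of the curve to the plane that is a holomorphic immersion. Two lifts near a point
    differ by a constant element of [L]. *)
Definition locsec p (s : Y -> V) := [/\ \forall q \near p, D (s q) /\ u (s q) = q,
  forall i, rs_dom Y i p -> forall k, exists d, hder i (fun q => s q 0 k) p d &
  forall i, rs_dom Y i p -> exists k, exists2 d, d != 0 & hder i (fun q => s q 0 k) p d].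

Lemma locsec_ex v : D v -> exists2 s, s (u v) = v & locsec (u v) s.
Proof.
move=> Dv; have [i iv] := rs_cover (u v).
have [_ _ /(_ v i Dv iv)[s [d [sv sn sd d0]]]] := hY.
exists s => //; split => //.
  move=> j jv k; have [a [_ _ h3]] := chart_change iv jv.
  have h := chart_deriv_coord k iv sd.
  by exists (d 0 k * a^-1); exact: hder_change iv jv h h3.
move=> j jv; have [k dk] : exists k, d 0 k != 0.
  apply/not_existsP => h; case/eqP: d0; apply/rowP => k; rewrite mxE.
  by apply/eqP/negP => /negP; exact: h.
exists k; have [a [a0 _ h3]] := chart_change iv jv.
have h := chart_deriv_coord k iv sd.
exists (d 0 k * a^-1); first by rewrite mulf_neq0 ?invr_eq0.
exact: hder_change iv jv h h3.
Qed.

Lemma locsec_cont p s k : locsec p s -> {for p, continuous (fun q => s q 0 k)}.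
Proof.
move=> [_ h _]; have [i ip] := rs_cover p; have [d hd] := h i ip k.
exact: hder_cont ip hd.
Qed.

Lemma discrete_near (T : topologicalType) (p : T) (f : T -> V) :
  (forall k, {for p, continuous (fun q => f q 0 k)}) ->
  (\forall q \near p, L (f q)) -> \forall q \near p, f q = f p.
Proof.
move=> cf Lf; have [_ [e e0 eP]] := dL.
have h k : \forall q \near p, ab (f q 0 k - f p 0 k) < e.
  have /(@contP R T (fun q => f q 0 k) p) h := cf k; exact: h.
have Lp := nbhs_singleton Lf.
apply: filterS3 Lf (h 0) (h 1) => q Lq h0 h1.
apply/eqP; rewrite -subr_eq0; apply/eqP; apply: eP; first exact: LB.
move=> k; rewrite !mxE.
by have [->|->] := ord2P k.
Qed.

Lemma L_closed (v : V) : ~ L v -> exists2 e : R, 0 < e &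
  forall w : V, (forall k, ab (w 0 k - v 0 k) < e) -> ~ L w.
Proof.
move=> nLv; have [_ [e e0 eP]] := dL.
have [[l [Ll lv]]|none] := pselect (exists l : V, L l /\ forall k, ab (l 0 k - v 0 k) < e / 2).
  have [k kP] : exists k, l 0 k - v 0 k != 0.
    apply/not_existsP => h; apply: nLv; have -> // : v = l.
    apply/rowP => k; apply/eqP; rewrite eq_sym -subr_eq0; apply/negP => /negP; exact: h.
  exists (Num.min (e / 2) (ab (l 0 k - v 0 k))); first by rewrite lt_min divr_gt0//= ab_gt0.
  move=> w wv Lw; have lw : l - w = 0.
    apply: eP; first exact: LB.
    move=> k'; rewrite !mxE; have := abB3 (l 0 k') (v 0 k') (w 0 k').
    rewrite (ab_sym (v 0 k')); have := wv k'; rewrite lt_min => /andP[h1 _].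
    have := lv k'; lra.
  have := wv k; rewrite -(subr0_eq lw) lt_min => /andP[_]; by rewrite ltxx.
exists (e / 2); first by rewrite divr_gt0.
by move=> w wv Lw; apply: none; exists w.
Qed.

(** The local lifts go from the curve to the plane, so continuity of [u] takes compactness. A point
    y outside a neighbourhood of u(phi p) has a lift that is not congruent to phi p; as [L] is
    closed, this persists for points near y and parameters near p, uniformly on the compact
    complement. *)
Lemma u_cont (X : topologicalType) (p : X) (phi : X -> V) :
  (forall k, {for p, continuous (fun q => phi q 0 k)}) ->
  (\forall q \near p, D (phi q)) -> {for p, continuous (fun q => u (phi q))}.
Proof.
move=> cphi Dphi W; rewrite nbhsE => [[B [oB Bp] BW]].
have Dp := nbhs_singleton Dphi.
pose K := ~` B.
have cK : compact K.
  apply: (@subclosed_compact _ _ setT) => //; last exact: rs_compact.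
  by rewrite closedC.
have /compact_near_coveringP nc := cK.
have key : \forall q \near p, K `<=` (fun y => D (phi q) -> u (phi q) <> y).
  apply: (nc X (nbhs p) (fun q y => D (phi q) -> u (phi q) <> y)) => y Ky.
  have [v Dv uv] := curve_surj y; have [s sv sl] := locsec_ex Dv.
  rewrite uv in sv sl; have [sn _ _] := sl.
  have nL : ~ L (v - phi p).
    by move=> /(curve_eq Dv Dp) h; apply: Ky; rewrite -uv h.
  have [e e0 eP] := L_closed nL.
  have e20 : 0 < e / 2 by rewrite divr_gt0.
  have h1 k : \forall y' \near y, ab (s y' 0 k - v 0 k) < e / 2.
    have /(@contP R Y (fun q => s q 0 k) y) h := locsec_cont (k := k) sl.
    by have := h _ e20; rewrite sv.
  have h2 k : \forall q \near p, ab (phi q 0 k - phi p 0 k) < e / 2.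
    have /(@contP R X (fun q => phi q 0 k) p) h := cphi k; exact: h.
  exists ([set y' | (D (s y') /\ u (s y') = y') /\ (ab (s y' 0 0 - v 0 0) < e / 2 /\
     ab (s y' 0 1 - v 0 1) < e / 2)], [set q | ab (phi q 0 0 - phi p 0 0) < e / 2 /\
     ab (phi q 0 1 - phi p 0 1) < e / 2]).
    split => /=; first exact: nbhsI2 sn (nbhsI2 (h1 0) (h1 1)).
    exact: nbhsI2 (h2 0) (h2 1).
  move=> [y' q] /= [[[Ds us] [a0 a1]] [b0 b1]] Dq; rewrite -us => uq.
  have /(curve_eq Ds Dq) := esym uq; apply: eP => k; rewrite !mxE.
  have -> : s y' 0 k - phi q 0 k - (v 0 k - phi p 0 k) =
    (s y' 0 k - v 0 k) - (phi q 0 k - phi p 0 k) by ring.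
  apply: le_lt_trans (abD _ _) _; rewrite abN.
  have [->|->] := ord2P k; lra.
have h : nbhs p (fun q => W (u (phi q))).
  apply: filterS2 key Dphi => q Kq Dq; apply: BW; apply: contrapT => nB.
  exact: (Kq _ nB Dq).
exact: h.
Qed.

Lemma locsec_diff p s s' : locsec p s -> locsec p s' ->
  \forall q \near p, s' q - s q = s' p - s p.
Proof.
move=> ls ls'; apply: discrete_near => [k|].
  have h := contB (locsec_cont (k := k) ls') (locsec_cont (k := k) ls).
  have e : (fun q => (s' q - s q) 0 k) = (fun q => s' q 0 k - s q 0 k).
    by apply/funext => q; rewrite !mxE.
  by rewrite e; exact: h.
have [sn _ _] := ls; have [sn' _ _] := ls'.
by apply: filterS2 sn sn' => q [D1 u1] [D2 u2]; apply/curve_eq => //; rewrite u1.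
Qed.

Lemma locsec_near p s : locsec p s -> \forall q \near p, locsec q s.
Proof.
move=> [sn sd sk]; have [i ip] := rs_cover p.
have [d0 h0] := sd i ip 0; have [d1 h1] := sd i ip 1.
have all k : \forall q \near p, exists d, hder i (fun q => s q 0 k) q d.
  by have [d hd] := sd i ip k; exact: hder_near hd.
have [k [dk dk0 hk]] := sk i ip.
have nz : \forall q \near p, exists2 d, d != 0 & hder i (fun q => s q 0 k) q d.
  pose f' q := xget 0 (fun e => der (rs_chart Y i) (fun q => s q 0 k) q e).
  have fP : \forall q \near p, der (rs_chart Y i) (fun q => s q 0 k) q (f' q).
    apply: filterS (all k) => q [e [he _]]; rewrite /f'.
    by case: xgetP => [x _ //|/(_ _ he)].
  have [e he] := hder_deriv ip fP.
  have f'p : f' p = dk by exact: der_unique_chart ip (nbhs_singleton fP) hk.1.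
  have f'0 : 0 < ab (f' p) by rewrite f'p ab_gt0.
  have /(@contP R Y f' p)/(_ _ f'0) := hder_cont ip he.
  apply: filterS3 (all k) (nbhsI2 fP (dom_nbhs ip)) => q [e' he'] [hq iq] hf.
  exists e' => //; rewrite -(der_unique_chart iq hq he'.1).
  by apply: contraTneq hf => ->; rewrite sub0r abN ltxx.
apply: filterS2 (nbhsI2 (near_join sn) (nbhsI2 (all 0) (all 1))) (nbhsI2 nz (dom_nbhs ip)).
move=> q [snq [a0 a1]] [[e e0 he] iq]; split => //.
  move=> j jq k'; have [a [_ _ h3]] := chart_change iq jq.
  have [e' he'] : exists d, hder i (fun q => s q 0 k') q d.
    by have [->|->] := ord2P k'.
  by exists (e' * a^-1); exact: hder_change iq jq he' h3.
move=> j jq; have [a [a0' _ h3]] := chart_change iq jq.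
exists k, (e * a^-1); first by rewrite mulf_neq0 ?invr_eq0.
exact: hder_change iq jq he h3.
Qed.

(** The restriction of the k-th coordinate differential. It is well defined because lifts differ by
    constants. *)
Lemma dz_ex k : exists w : differential Y, forall p s, locsec p s ->
  prim_at w (fun q => s q 0 k) p.
Proof.
pose c i p := xget 0 (fun x => exists2 s, locsec p s & hder i (fun q => s q 0 k) p x).
have cE i p s : rs_dom Y i p -> locsec p s -> hder i (fun q => s q 0 k) p (c i p).
  move=> ip ls; have [_ sd _] := ls; have [d hd] := sd i ip k.
  rewrite /c; case: xgetP => [x _ [s' ls' hx]|/(_ d) []]; last by exists s.
  have e := locsec_diff ls ls'.
  have h : \forall q \near p, s' q 0 k = s q 0 k + (s' p - s p) 0 k.
    by apply: filterS e => q <-; rewrite !mxE; ring.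
  have := hderB (hder_ext h hx) (hder_cst i p ((s' p - s p) 0 k)).
  rewrite subr0; apply: hder_ext; apply: filterE => q; exact: addrK.
have [||w wE] := @mk_diff R Y c.
- move=> i p ip; have [v Dv uv] := curve_surj p; have [s _ ls] := locsec_ex Dv.
  rewrite uv in ls.
  apply: (hder_deriv (f := fun q => s q 0 k) ip).
  apply: filterS2 (locsec_near ls) (dom_nbhs ip) => q lq iq.
  exact: (cE i q s iq lq).1.
- move=> i j p d ip jp hd; have [v Dv uv] := curve_surj p; have [s _ ls] := locsec_ex Dv.
  rewrite uv in ls.
  exact: hder_unique ip (cE i p s ip ls) (hder_change jp ip (cE j p s jp ls) hd).
by exists w => p s ls i ip; rewrite wE//; exact: cE.
Qed.

Definition dz k : differential Y := projT1 (cid (dz_ex k)).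

Lemma dzP k p s : locsec p s -> prim_at (dz k) (fun q => s q 0 k) p.
Proof. by rewrite /dz; case: cid => w /= h; exact: h. Qed.

Definition vec (I : differential Y -> C) : V := \row_k I (dz k).

Lemma vecD I J : vec (fun w => I w + J w) = vec I + vec J.
Proof. by apply/rowP => k; rewrite !mxE. Qed.

(** On a short piece one lift serves both ends, and its increment is the integral of the coordinate
    differentials. *)
Lemma conn_vec p q I : conn p q I ->
  forall v w, D v -> D w -> u v = p -> u w = q -> L (w - v - vec I).
Proof.
apply: (conn_elim (Rl := fun p q I => forall v w, D v -> D w -> u v = p -> u w = q ->
   L (w - v - vec I))).
  move=> x U nU Ux; have [v0 D0 uv0] := curve_surj x.
  have [s _ ls] := locsec_ex D0; rewrite uv0 in ls.
  have [sn _ _] := ls.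
  have nUx : nbhs x U by apply: open_nbhs_nbhs; split => //; case: nU.
  have [N [nN Nx NU]] := nice_ex (nbhsI2 nUx (nbhsI2 sn (locsec_near ls))).
  exists N; split => //; first by case: nN.
    by move=> y /NU[].
  move=> a b J Na Nb hJ v w Dv Dw uv uw.
  have [Ua [[Da ua] la]] := NU a Na; have [Ub [[Db ub] lb]] := NU b Nb.
  have JE : vec J = s b - s a.
    apply/rowP => k; rewrite !mxE.
    have [_ pU _ _] := nU; have [f fP] := pU (dz k); rewrite (hJ _ f fP).
    have sP y : N y -> prim_at (dz k) (fun q => s q 0 k) y.
      by move=> Ny; exact: (dzP k (NU y Ny).2.2).
    exact: (nice_prim_eq nN (fun y Ny => fP y (NU y Ny).1) sP Na Nb).
  have h1 : L (w - s b) by apply/curve_eq => //; rewrite uw ub.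
  have h2 : L (v - s a) by apply/curve_eq => //; rewrite uv ua.
  have -> : w - v - vec J = (w - s b) - (v - s a).
    by rewrite JE !opprB addrACA [RHS]addrACA; congr (_ + _); rewrite addrC.
  exact: LB.
move=> a b c I1 I2 h1 h2 v w Dv Dw uv uw; have [x Dx ux] := curve_surj b.
rewrite vecD.
have -> : w - v - (vec I1 + vec I2) = (w - x - vec I2) + (x - v - vec I1).
  by rewrite addrACA -opprD [vec I2 + _]addrC [w - x + _]addrA subrK.
by apply: LD; [exact: h2|exact: h1].
Qed.

Lemma period_vec (l : linform (differential Y)) : periods l -> L (vec l).
Proof.
move=> /periodsP[p h]; have [v Dv uv] := curve_surj p.
have := conn_vec h Dv Dv uv uv; rewrite subrr sub0r => /LN.
by rewrite opprK.
Qed.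

End TorusCurve.

(** * Affine maps between curves in tori *)

Section AffineMap.
Variables (R : realType) (L1 D1 L2 D2 : set 'rV[R[i]]_2) (Y1 Y2 : riemannSurface R).
Variables (u1 : 'rV[R[i]]_2 -> Y1) (u2 : 'rV[R[i]]_2 -> Y2).
Local Notation C := R[i].
Local Notation V := 'rV[R[i]]_2.
Hypothesis dL1 : discrete_subgroup L1.
Hypothesis dL2 : discrete_subgroup L2.
Hypothesis hY1 : is_curve_in_torus L1 D1 u1.
Hypothesis hY2 : is_curve_in_torus L2 D2 u2.
Variables (eps : C) (c : V) (F : Y1 -> Y2).
Hypothesis FD : forall v, D1 v -> D2 (eps *: v + c).
Hypothesis Fu : forall v, D1 v -> F (u1 v) = u2 (eps *: v + c).

Lemma affine_cont_coord p s k : locsec D1 u1 p s ->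
  {for p, continuous (fun q => (eps *: s q + c) 0 k)}.
Proof.
move=> ls; have h := contD (contM (cont_cst eps p) (locsec_cont (k := k) ls)) (cont_cst (c 0 k) p).
have e : (fun q => (eps *: s q + c) 0 k) = (fun q => eps * s q 0 k + c 0 k).
  by apply/funext => q; rewrite !mxE.
by rewrite e; exact: h.
Qed.

Lemma affine_near p s : locsec D1 u1 p s ->
  \forall q \near p, D2 (eps *: s q + c) /\ F q = u2 (eps *: s q + c).
Proof.
move=> [sn _ _]; apply: filterS sn => q [Ds us].
by split; [exact: FD|rewrite -Fu// us].
Qed.

Lemma affine_cont : continuous F.
Proof.
move=> p; have [v Dv uv] := curve_surj hY1 p; have [s _ ls] := locsec_ex hY1 Dv.
rewrite uv in ls; have an := affine_near ls.
have Dn : \forall q \near p, D2 (eps *: s q + c) by apply: filterS an => q [].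
have h := u_cont dL2 hY2 (fun k => affine_cont_coord (k := k) ls) Dn.
rewrite /continuous_at (nbhs_singleton an).2.
apply: cvg_trans h; apply: near_eq_cvg.
by apply: filterS an => q [_ ->].
Qed.

(** The two sides differ by a continuous function with values in the discrete group [L2], which is 0
    at [p]. *)
Lemma affine_sec p s1 s2 : locsec D1 u1 p s1 -> locsec D2 u2 (F p) s2 ->
  s2 (F p) = eps *: s1 p + c -> \forall q \near p, s2 (F q) = eps *: s1 q + c.
Proof.
move=> l1 l2 e; have an := affine_near l1; have [sn2 _ _] := l2.
have sn2' := @affine_cont p _ sn2.
have h : \forall q \near p, s2 (F q) - (eps *: s1 q + c) = s2 (F p) - (eps *: s1 p + c).
  apply: (discrete_near dL2) => [k|].
    have cs : {for p, continuous (fun q => s2 (F q) 0 k)}.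
      apply: (@continuous_comp _ _ _ F (fun y => s2 y 0 k)); first exact: affine_cont.
      exact: (locsec_cont (k := k) l2).
    have h := contB cs (affine_cont_coord (k := k) l1).
    have e' : (fun q => (s2 (F q) - (eps *: s1 q + c)) 0 k) =
      (fun q => s2 (F q) 0 k - (eps *: s1 q + c) 0 k).
      by apply/funext => q; rewrite !mxE.
    by rewrite e'; exact: h.
  apply: filterS2 an sn2' => q [Dq uq] [Dq' uq'].
  by apply/(curve_eq hY2) => //; rewrite uq' uq.
by apply: filterS h => q; rewrite e subrr => /eqP; rewrite subr_eq0 => /eqP.
Qed.

Lemma affine_secs p : exists s1 s2, [/\ locsec D1 u1 p s1, locsec D2 u2 (F p) s2 &
  s2 (F p) = eps *: s1 p + c].
Proof.
have [v Dv uv] := curve_surj hY1 p; have [s sv ls] := locsec_ex hY1 Dv.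
have [s2 sv2 ls2] := locsec_ex hY2 (FD Dv).
rewrite uv in sv ls; have Fp := Fu Dv; rewrite uv in Fp.
by exists s, s2; rewrite Fp sv2 sv.
Qed.

Lemma affine_hol : holomorphic_map F.
Proof.
have key p i j : rs_dom Y1 i p -> rs_dom Y2 j (F p) ->
    exists d, der (rs_chart Y1 i) (fun q => rs_chart Y2 j (F q)) p d.
  move=> ip jp; have [s1 [s2 [l1 l2 e]]] := affine_secs p.
  have an := affine_sec l1 l2 e.
  (* A coordinate of the lift with nonzero derivative replaces the chart of the target; in this
     coordinate [F] is affine. *)
  have [_ _ /(_ j jp)[k [d2 d20 [h2 _]]]] := l2.
  have [_ /(_ i ip k)[d1 [h1 _]] _] := l1.
  have hs : der (rs_chart Y1 i) (fun q => s2 (F q) 0 k) p (eps * d1 + 0).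
    apply: der_ext (derD (derZ eps h1) (der_cst _ (c 0 k) p)).
    by apply: filterS an => q ->; rewrite !mxE.
  have := der_comp (@affine_cont p) hs (der_inv d20 h2).
  by eexists; eassumption.
split; first exact: affine_cont.
move=> i j p ip jp; have [d hd] := key p i j ip jp; exists d.
apply/hderP => //; split => //.
have jn := @affine_cont p _ (dom_nbhs jp).
by apply: filterS2 (dom_nbhs ip) jn => q iq jq; exact: key.
Qed.

Lemma affine_pb (hF : holomorphic_map F) k :
  pb hF (dz dL2 hY2 k) = eps *: dz dL1 hY1 k.
Proof.
apply: diff_eq_prim => p; have [s1 [s2 [l1 l2 e]]] := affine_secs p.
have an := affine_sec l1 l2 e.
exists (fun q => s2 (F q) 0 k); first exact: pb_prim (dzP dL2 hY2 k l2).
have h := prim_at_cst (c 0 k) (prim_atZ eps (dzP dL1 hY1 k l1)).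
by apply: prim_at_ext h; apply: filterS an => q ->; rewrite !mxE.
Qed.

End AffineMap.

(** * Lattices and the period lattice *)

Section Lattice.
Variable R : realType.
Local Notation C := R[i].
Local Notation V := 'rV[R[i]]_2.
Variable L : set V.
Hypothesis hL : is_lattice L.

Definition lb : 'I_4 -> V := projT1 (cid hL).

Lemma lbP : (forall v, exists! c : 'rV[R]_4, v = \sum_(k < 4) (c 0 k)%:C *: lb k) /\
  (forall v, L v <-> exists n : 'I_4 -> int, v = \sum_(k < 4) lb k *~ n k).
Proof. by rewrite /lb; case: cid. Qed.

Definition co (v : V) : 'rV[R]_4 := projT1 (cid (lbP.1 v)).

Lemma coP v : v = \sum_(k < 4) (co v 0 k)%:C *: lb k.
Proof. by have [] := projT2 (cid (lbP.1 v)). Qed.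

Lemma co_unique v (c : 'rV[R]_4) : v = \sum_(k < 4) (c 0 k)%:C *: lb k -> co v = c.
Proof. by have [_ h] := projT2 (cid (lbP.1 v)); exact: h. Qed.

Lemma co_lin (a : R) v w : co (a%:C *: v + w) = a *: co v + co w.
Proof.
apply: co_unique; rewrite {1}(coP v) {1}(coP w) scaler_sumr -big_split/=.
by apply: eq_bigr => k _; rewrite scalerA -scalerDl !mxE rmorphD rmorphM.
Qed.

Lemma co0 : co 0 = 0.
Proof.
apply: co_unique; rewrite big1// => k _.
by rewrite mxE scale0r.
Qed.

Lemma coD v w : co (v + w) = co v + co w.
Proof. by have := co_lin 1 v w; rewrite !scale1r. Qed.

Lemma coZ (a : R) v : co (a%:C *: v) = a *: co v.
Proof. by have := co_lin a v 0; rewrite co0 !addr0. Qed.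

Lemma scale_intC (v : V) (n : int) : (n%:~R : R)%:C *: v = v *~ n.
Proof. by rewrite rmorph_int scaler_int. Qed.

Lemma L_co v : L v <-> exists n : 'I_4 -> int, co v = \row_k (n k)%:~R.
Proof.
rewrite lbP.2; split=> [[n ->]|[n nE]].
  exists n; apply: co_unique; apply: eq_bigr => k _.
  by rewrite mxE scale_intC.
exists n; rewrite {1}(coP v) nE; apply: eq_bigr => k _.
by rewrite mxE scale_intC.
Qed.

Definition ev (j : 'I_2) : V := delta_mx 0 j.

Lemma V_real (v : V) : v = ((complex.Re (v 0 0))%:C *: ev 0 + (complex.Im (v 0 0))%:C *: ('i *: ev 0)) +
  ((complex.Re (v 0 1))%:C *: ev 1 + (complex.Im (v 0 1))%:C *: ('i *: ev 1)).
Proof.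
have cE (z : C) (e : V) : z *: e = (complex.Re z)%:C *: e + (complex.Im z)%:C *: ('i *: e).
  by rewrite scalerA -scalerDl [_ * 'i]mulrC -complexE.
rewrite -!cE {1}(row_sum_delta v) !big_ord_recl big_ord0 addr0.
have -> : lift ord0 ord0 = 1 :> 'I_2 by exact: val_inj.
exact: erefl.
Qed.

Lemma co_real v : co v = (complex.Re (v 0 0) *: co (ev 0) + complex.Im (v 0 0) *: co ('i *: ev 0)) +
  (complex.Re (v 0 1) *: co (ev 1) + complex.Im (v 0 1) *: co ('i *: ev 1)).
Proof.
have h (a b c d : R) A B E F : co ((a%:C *: A + b%:C *: B) + (c%:C *: E + d%:C *: F)) =
  (a *: co A + b *: co B) + (c *: co E + d *: co F) by rewrite !coD !coZ.
rewrite -h; exact: (congr1 co (V_real v)).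
Qed.

Lemma L_subgroup : is_subgroup L.
Proof.
split; first by apply/L_co; exists (fun=> 0); rewrite co0; apply/rowP => k; rewrite !mxE.
move=> v w /L_co[n nE] /L_co[m mE]; apply/L_co; exists (fun k => n k - m k).
have -> : v - w = (-1 : R)%:C *: w + v by rewrite rmorphN rmorph1 scaleN1r addrC.
by rewrite co_lin nE mE; apply/rowP => k; rewrite !mxE rmorphB /=; ring.
Qed.

(** The coordinates in a lattice basis are real linear, so they are below 1 on a small neighbourhood
    of 0; at lattice points they are integers. *)
Lemma lattice_discrete : discrete_subgroup L.
Proof.
split; first exact: L_subgroup.
pose K k := `|co (ev 0) 0 k| + `|co ('i *: ev 0) 0 k| + (`|co (ev 1) 0 k| + `|co ('i *: ev 1) 0 k|).
pose S := \sum_k K k.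
have K0 k : 0 <= K k by rewrite !addr_ge0.
have KS k : K k <= S by rewrite /S (bigD1 k)//= lerDl sumr_ge0.
have S0 : 0 <= S by rewrite sumr_ge0.
have e0 : 0 < (S + 1)^-1 by rewrite invr_gt0; lra.
exists (S + 1)^-1 => // l Ll le; have /L_co[n nE] := Ll.
suff n0 k : n k = 0.
  rewrite (coP l) big1// => k _.
  by rewrite nE mxE n0 rmorph0 scale0r.
have b k' : `|complex.Re (l 0 k')| <= (S + 1)^-1 /\ `|complex.Im (l 0 k')| <= (S + 1)^-1.
  by split; apply: le_trans (ltW (le k')); [exact: Re_ab|exact: Im_ab].
have [b1 b2] := b 0; have [b3 b4] := b 1.
have h : `|co l 0 k| <= (S + 1)^-1 * K k.
  rewrite co_real !mxE /K !mulrDr.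
  apply: le_trans (ler_normD _ _) _; apply: lerD; apply: le_trans (ler_normD _ _) _;
    apply: lerD; rewrite normrM ler_wpM2r//.
have h2 : `|co l 0 k| < 1.
  apply: le_lt_trans h _; rewrite mulrC ltr_pdivrMr; last by lra.
  by have := KS k; lra.
move: h2; rewrite nE mxE -intr_norm -(mulr1z 1) ltr_int => h2.
by apply/eqP; rewrite -normr_eq0 eq_le normr_ge0 andbT -ltzD1.
Qed.

End Lattice.

(** * Lattice extensions of finite order *)

Section Extension.
Variable R : realType.
Local Notation V := 'rV[R[i]]_2.

Lemma subgroup_sum (L : set V) (T : finType) (F : T -> V) : is_subgroup L ->
  (forall t, L (F t)) -> L (\sum_t F t).
Proof.
move=> [L0 LB] h; elim/big_ind: _ => // x y Lx Ly.
by rewrite -[y]opprK; apply: (LB) => //; rewrite -sub0r; exact: LB.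
Qed.

(* Translation by v permutes the cosets, so d v is the sum of all
   differences between representatives. *)
Lemma extension_exponent (L L' : set V) (d : nat) : is_subgroup L ->
  is_extension_of_order L L' d -> forall v, L' v -> L (v *+ d).
Proof.
move=> sL [[L'0 L'B] LL' [r [rL' rP]]] v L'v.
have [L0 LB] := sL.
have L'D a b : L' a -> L' b -> L' (a + b).
  by move=> ha hb; rewrite -[b]opprK; apply: (L'B) => //; rewrite -sub0r; exact: L'B.
have h k : exists k', L (r k + v - r k').
  by have [k' [h _]] := rP _ (L'D _ _ (rL' k) L'v); exists k'.
have [sg sgP] := choice h.
have sgi : injective sg.
  move=> k k' e; have [m [_ mu]] := rP _ (rL' k).
  have e1 : m = k by apply: mu; rewrite subrr.
  rewrite -e1; apply: mu.
  have -> : r k - r k' = (r k + v - r (sg k)) - (r k' + v - r (sg k)).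
    by rewrite opprB addrA subrK opprD addrACA subrr addr0.
  by apply: LB => //; rewrite {1}e.
have := subgroup_sum sL sgP.
have -> : \sum_k (r k + v - r (sg k)) = v *+ d.
  rewrite sumrB big_split/= sumr_const card_ord.
  have -> : \sum_k r (sg k) = \sum_k r k by rewrite [RHS](reindex_inj sgi).
  by rewrite addrAC subrr add0r.
by [].
Qed.

(** Multiplication by [d] maps L' into L and enlarges coordinates only by the factor [d]. *)
Lemma extension_discrete (L L' : set V) (d : nat) : (0 < d)%N -> discrete_subgroup L ->
  is_extension_of_order L L' d -> discrete_subgroup L'.
Proof.
move=> d0 [sL [e e0 eP]] ext; split; first by case: ext.
have dR : (0 : R) < d%:R by rewrite ltr0n.
exists (e / d%:R); first by rewrite divr_gt0.
move=> l L'l le; have h := extension_exponent sL ext L'l.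
have : l *+ d = 0.
  apply: eP => // k; rewrite mulmxnE -[_ *+ d]mulr_natl abM.
  have -> : ab (d%:R : R[i]) = d%:R by rewrite -(rmorph_nat (real_complex R) d) abC normr_nat.
  by have := le k; rewrite ltr_pdivlMr// mulrC.
rewrite -scaler_nat => /eqP; rewrite scaler_eq0 pnatr_eq0 -[d == 0]negbK -lt0n d0 /=.
by move=> /eqP.
Qed.

End Extension.

(** * The coordinate differentials are a basis on a curve of genus 2 *)

Section Genus2.
Variables (R : realType) (L D : set 'rV[R[i]]_2) (Y : riemannSurface R) (u : 'rV[R[i]]_2 -> Y).
Local Notation C := R[i].
Local Notation V := 'rV[R[i]]_2.
Hypothesis dL : discrete_subgroup L.
Hypothesis hY : is_curve_in_torus L D u.
Hypothesis genus2 : has_genus Y 2.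
Local Notation dz := (dz dL hY).

(* If a nonzero linear form vanished on the curve, a coordinate differential
   would have no zero, and every differential would be a multiple of it. *)
Lemma dz_indep (a : 'I_2 -> C) : a 0 *: dz 0 + a 1 *: dz 1 = 0 -> forall k, a k = 0.
Proof.
move=> az; apply: contrapT => /existsNP[k0 /eqP ak0].
have [k kP] : exists k : 'I_2, forall p i s, rs_dom Y i p -> locsec D u p s -> dz k i p != 0.
  (* For this index, a zero of [dz k] is by the relation a zero of both coordinate differentials,
     against the immersion. *)
  exists (if a 0 == 0 then 0 else 1) => p i s ip ls; apply/negP => /eqP dk.
  have [_ _ /(_ i ip)[m [d d0 hd]]] := ls.
  have dm : dz m i p = d by exact: hder_unique ip (dzP dL hY m ls ip) hd.
  have e : a 0 * dz 0 i p + a 1 * dz 1 i p = 0.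
    by have := congr1 (fun w : differential Y => w i p) az.
  move: d0; rewrite -dm.
  have both : dz 0 i p = 0 /\ dz 1 i p = 0.
    move: dk e; have [a0|a0] := eqVneq (a 0) 0.
      move=> -> ; rewrite mulr0 add0r => /eqP; rewrite mulf_eq0 => /orP[/eqP a1|/eqP ->//].
      exfalso; move: ak0.
      by have [->|->] := ord2P k0; rewrite ?a0 ?a1 eqxx.
    by move=> ->; rewrite mulr0 addr0 => /eqP; rewrite mulf_eq0 (negPf a0) => /eqP ->.
  by have [->|->] := ord2P m; rewrite ?both.1 ?both.2 eqxx.
have dz0 p i : rs_dom Y i p -> dz k i p != 0.
  move=> ip; have [v Dv uv] := curve_surj hY p; have [s _ ls] := locsec_ex hY Dv.
  by apply: (kP p i s ip); rewrite -uv.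
have [p0 _] := @rs_nonempty _ Y.
have mult w : exists c : C, w = c *: dz k.
  pose h p := w (projT1 (cid (rs_cover p))) p / dz k (projT1 (cid (rs_cover p))) p.
  have hE i p : rs_dom Y i p -> h p = w i p / dz k i p.
    rewrite /h; case: cid => j /= jp ip.
    have [d [d0 h1 h2]] := chart_change ip jp.
    rewrite (diff_trans w ip jp h1) (diff_trans (dz k) ip jp h1).
    by rewrite invfM mulrACA divff// mulr1.
  (* The ratio of [w] and the zero-free [dz k] is a holomorphic function on a compact surface. *)
  have hc : forall p q, h p = h q.
    apply: hol_const => p; have [i ip] := rs_cover p; exists i => //.
    have [d1 h1] := diff_hol w ip; have [d2 h2] := diff_hol (dz k) ip.
    have [d3 h3] := hderV ip (dz0 p i ip) h2.
    have h4 := hderM ip h1 h3.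
    eexists; apply: hder_ext h4.
    by apply: filterS (dom_nbhs ip) => q iq; rewrite (hE i).
  exists (h p0); apply: diff_eq => i p ip.
  by rewrite diffZE (hc p0 p) (hE i p ip) divfK// dz0.
have [b bP] := genus2.
have [c0 b0] := mult (b 0); have [c1 b1] := mult (b 1).
have sum2 (c : 'rV[C]_2) : \sum_(k < 2) c 0 k *: b k = c 0 0 *: b 0 + c 0 1 *: b 1.
  by rewrite !big_ord_recl big_ord0 addr0; congr (_ + c 0 _ *: b _); exact: val_inj.
have [z [zP zu]] := bP 0.
have u0 (c : 'rV[C]_2) : c 0 0 *: b 0 + c 0 1 *: b 1 = 0 -> c = 0.
  move=> ce; have e1 := zu c; have e2 := zu 0.
  rewrite -e1; last by rewrite sum2.
  by rewrite e2// sum2 !mxE !scale0r addr0.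
(* Two basis forms proportional to one form satisfy c1 b0 - c0 b1 = 0, so c0 = 0 and b0 = 0, which
   is impossible. *)
have r1 : \row_(k < 2) (if k == 0 then c1 else - c0) = 0.
  apply: u0; rewrite !mxE /= b0 b1 !scalerA -scalerDl.
  have -> : c1 * c0 + - c0 * c1 = 0 by ring.
  exact: scale0r.
have c00 : c0 = 0.
  have := congr1 (fun m : 'rV[C]_2 => m 0 1) r1; rewrite !mxE /= => /eqP.
  by rewrite oppr_eq0 => /eqP.
have r2 : \row_(k < 2) (if k == 0 then 1 else 0 : C) = 0.
  by apply: u0; rewrite !mxE /= b0 c00 !scale0r scaler0 addr0.
have := congr1 (fun m : 'rV[C]_2 => m 0 0) r2; rewrite !mxE /= => /eqP.
by rewrite oner_eq0.
Qed.

Lemma dz_span w : exists a : 'I_2 -> C, w = a 0 *: dz 0 + a 1 *: dz 1.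
Proof.
have [b bP] := genus2.
have [M MP] : exists M : 'I_2 -> 'rV[C]_2, forall j, dz j = \sum_(k < 2) M j 0 k *: b k.
  have h j : exists c : 'rV[C]_2, dz j = \sum_(k < 2) c 0 k *: b k.
    by have [c [h _]] := bP (dz j); exists c.
  by have [M MP] := choice h; exists M.
pose A : 'M[C]_2 := \matrix_(i, j) M i 0 j.
pose B (c : 'rV[C]_2) := \sum_(k < 2) c 0 k *: b k.
have BA (x : 'rV[C]_2) : B (x *m A) = x 0 0 *: dz 0 + x 0 1 *: dz 1.
  have -> : x 0 0 *: dz 0 + x 0 1 *: dz 1 = \sum_(j < 2) x 0 j *: dz j.
    by rewrite !big_ord_recl big_ord0 addr0; congr (_ + x 0 _ *: dz _); exact: val_inj.
  under [RHS]eq_bigr => j _ do rewrite (MP j) scaler_sumr.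
  rewrite exchange_big /= /B; apply: eq_bigr => k _.
  rewrite !mxE scaler_suml; apply: eq_bigr => j _.
  by rewrite !mxE scalerA.
have Af : row_free A.
  apply: inj_row_free => x xA.
  have h : x 0 0 *: dz 0 + x 0 1 *: dz 1 = 0.
    by rewrite -BA xA /B big1// => k _; rewrite mxE scale0r.
  have z := dz_indep (a := fun k => x 0 k) h.
  by apply/rowP => k; rewrite z mxE.
have Au : A \in unitmx by rewrite -row_free_unit.
have [c [wE _]] := bP w.
exists (fun k => (c *m invmx A) 0 k).
by rewrite -BA mulmxKV.
Qed.

End Genus2.

(** * Periods of the coordinate differentials have finite index in the lattice *)

Section FiniteIndex.
Variables (R : realType) (L D : set 'rV[R[i]]_2) (Y : riemannSurface R) (u : 'rV[R[i]]_2 -> Y).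
Local Notation C := R[i].
Local Notation V := 'rV[R[i]]_2.
Hypothesis hL : is_lattice L.
Hypothesis hY : is_curve_in_torus L D u.
Let dL := lattice_discrete hL.
Local Notation dz := (dz dL hY).
Hypothesis indep : forall a : 'I_2 -> C, a 0 *: dz 0 + a 1 *: dz 1 = 0 -> forall k, a k = 0.
Local Notation vec l := (vec dL hY (linform_val l)).

Lemma real_functional (x : 'cV[R]_4) :
  (forall l : linform (differential Y), periods l -> (co hL (vec l) *m x) 0 0 = 0) -> x = 0.
Proof.
move=> xP; pose phi v := (co hL v *m x) 0 0.
have phiD v w : phi (v + w) = phi v + phi w by rewrite /phi coD mulmxDl mxE.
have phiZ (a : R) v : phi (a%:C *: v) = a * phi v by rewrite /phi coZ -scalemxAl mxE.
(* The coefficients of the complex linear form whose real part is [phi]. *)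
pose a (j : 'I_2) : C := phi (ev R j) -i* phi ('i *: ev R j).
have Rea (z : C) j : complex.Re (a j * z) =
    complex.Re z * phi (ev R j) + complex.Im z * phi ('i *: ev R j).
  by case: z => p q; rewrite /a /=; ring.
have phiE v : phi v = complex.Re (a 0 * v 0 0 + a 1 * v 0 1).
  have h (p q c d : R) A B E F : phi ((p%:C *: A + q%:C *: B) + (c%:C *: E + d%:C *: F)) =
    (p * phi A + q * phi B) + (c * phi E + d * phi F) by rewrite !phiD !phiZ.
  rewrite ReD !Rea -h; exact: (congr1 phi (V_real v)).
have w0 : a 0 *: dz 0 + a 1 *: dz 1 = 0.
  apply: periods_imaginary => l lp.
  have l0 : l 0 = 0.
    have e := linformP l 1 0 0; rewrite scaler0 addr0 mul1r in e.
    by apply: (addrI (l 0)); rewrite addr0.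
  have z1 : l (a 1 *: dz 1) = a 1 * l (dz 1).
    by have e := linformP l (a 1) (dz 1) 0; rewrite l0 !addr0 in e.
  rewrite linformP z1.
  have := phiE (vec l); rewrite !mxE => <-; exact: xP.
have a0 := indep w0.
have phi0 v : phi v = 0 by rewrite phiE !a0 !mul0r add0r.
apply/colP => k; rewrite mxE.
have e : co hL (lb hL k) = delta_mx 0 k.
  apply: co_unique; rewrite (bigD1 k)//= big1 ?addr0.
    by rewrite mxE !eqxx scale1r.
  by move=> j jk; rewrite mxE eqxx /= (negPf jk) scale0r.
have := phi0 (lb hL k); rewrite /phi e -rowE mxE; exact.
Qed.

Lemma vec_lin (T : finType) (F : T -> linform (differential Y)) (n : T -> int) :
  vec (\sum_t F t *~ n t) = \sum_t vec (F t) *~ n t.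
Proof.
have vD (l l' : linform (differential Y)) : vec (l + l') = vec l + vec l'.
  by apply/rowP => k; rewrite !mxE.
have v0 : vec (0 : linform (differential Y)) = 0 by apply/rowP => k; rewrite !mxE.
have vN (l : linform (differential Y)) : vec (- l) = - vec l by apply/rowP => k; rewrite !mxE.
have vMn (l : linform (differential Y)) m : vec (l *+ m) = vec l *+ m.
  by elim: m => [|m IH]; rewrite ?mulr0n// !mulrS vD IH.
have vMz (l : linform (differential Y)) m : vec (l *~ m) = vec l *~ m.
  by case: m => m; rewrite ?NegzE ?mulrNz ?vN -?pmulrn vMn.
elim/big_rec2: _ => // t x y _ <-; by rewrite vD vMz.
Qed.

(** Four periods with vectors independent over the reals are picked one by one. In lattice
    coordinates they form an integral matrix of nonzero determinant, and its adjugate shows that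
    this determinant times the lattice lies in their span. *)
Lemma period_finite_index : exists2 N : nat, (0 < N)%N &
  forall v, L v -> exists2 l : linform (differential Y), periods l & vec l = v *+ N.
Proof.
have free k : (k <= 4)%N -> exists f : 'I_k -> linform (differential Y),
    (forall i, periods (f i)) /\ row_free (\matrix_(i < k) co hL (vec (f i))).
  elim: k => [_|k IH k4].
    exists (fun=> 0); split; first by case.
    by apply: inj_row_free => v _; apply/rowP; case.
  have [f [fp ff]] := IH (ltnW k4).
  set A := \matrix_(i < k) _ in ff.
  (* Fewer than four rows leave a nonzero functional that kills them; by [real_functional] some
     period is not killed, and it is independent of the rows. *)
  have [x [x0 Ax]] : exists x : 'cV[R]_4, x != 0 /\ A *m x = 0.
    have h : cokermx A != 0.
      rewrite -mxrank_eq0 mxrank_coker (eqP ff) subn_eq0 -ltnNge//.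
    have [j jP] : exists j, col j (cokermx A) != 0.
      apply/not_existsP => h2; case/eqP: h; apply/matrixP => a b; rewrite mxE.
      have /negP/negbNE/eqP/colP/(_ a) := h2 b; by rewrite !mxE.
    exists (col j (cokermx A)); split => //.
    by rewrite colE mulmxA mulmx_coker mul0mx.
  have [l [lp lx]] : exists l : linform (differential Y), periods l /\ (co hL (vec l) *m x) 0 0 != 0.
    apply: contrapT => h; case/eqP: x0; apply: real_functional => l lp.
    by apply/eqP/negP => /negP n; apply: h; exists l.
  pose g (i : 'I_k.+1) := if unlift ord_max i is Some j then f j else l.
  exists g; split; first by move=> i; rewrite /g; case: unliftP.
  apply: inj_row_free => y yg.
  have ysum : \sum_(i < k) y 0 (lift ord_max i) *: co hL (vec (f i)) + y 0 ord_max *: co hL (vec l) = 0.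
    rewrite -[RHS]yg mulmx_sum_row big_ord_recr /=; congr (_ + _ *: _).
      apply: eq_bigr => i _; rewrite rowK.
      have e : widen_ord (leqnSn k) i = lift ord_max i by apply: val_inj; rewrite /= /bump leqNgt ltn_ord.
      by rewrite e /g liftK.
    by rewrite rowK /g unlift_none.
  have Ar i : co hL (vec (f i)) = row i A by rewrite rowK.
  have yl : y 0 ord_max = 0.
    have e := congr1 (fun m : 'rV_4 => (m *m x) 0 0) ysum.
    rewrite mulmxDl mulmx_suml -scalemxAl mul0mx big1 ?add0r in e; last first.
      by move=> i _; rewrite -scalemxAl Ar -row_mul Ax row0 scaler0.
    move: e; rewrite [LHS]mxE [RHS]mxE => /eqP; rewrite mulf_eq0 (negPf lx) orbF.
    by move=> /eqP.
  have y0 : \row_i y 0 (lift ord_max i) = 0.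
    apply: (row_free_inj ff); rewrite mul0mx mulmx_sum_row.
    rewrite yl scale0r addr0 in ysum; rewrite -[RHS]ysum.
    by apply: eq_bigr => i _; rewrite mxE Ar.
  apply/rowP => i; rewrite mxE; case: (unliftP ord_max i) => [j ->|->] //.
  by have := congr1 (fun m : 'rV_k => m 0 j) y0; rewrite !mxE.
have [f [fp ff]] := free 4 (leqnn 4).
have [n nE] : exists n : 'I_4 -> 'I_4 -> int, forall i, co hL (vec (f i)) = \row_k (n i k)%:~R.
  have h i : exists m : 'I_4 -> int, co hL (vec (f i)) = \row_k (m k)%:~R.
    by apply/L_co; exact: period_vec.
  by have [n nE] := choice h; exists n.
pose B : 'M[int]_4 := \matrix_(i, k) n i k.
have B0 : \det B != 0.
  have : \det (map_mx intr B : 'M[R]_4) != 0.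
    rewrite -unitfE -[_ \is a _]/(_ \in unitmx) -row_free_unit.
    have -> // : map_mx intr B = \matrix_(i < 4) co hL (vec (f i)) :> 'M[R]_4.
    by apply/matrixP => i k; rewrite !mxE nE mxE.
  by rewrite det_map_mx intr_eq0.
have key v : L v -> exists2 l : linform (differential Y), periods l & vec l = v *~ \det B.
  move=> /(L_co hL)[m mE].
  pose c : 'rV[int]_4 := (\row_k m k) *m \adj B.
  exists (\sum_i f i *~ c 0 i); first by apply: period_sum => t; exact: periodMz.
  have coinj v1 v2 : co hL v1 = co hL v2 -> v1 = v2.
    by move=> e; rewrite (coP hL v1) (coP hL v2) e.
  rewrite vec_lin; apply: coinj; rewrite -scale_intC coZ mE.
  have coS (T : finType) (F : T -> V) : co hL (\sum_t F t) = \sum_t co hL (F t).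
    by elim/big_rec2: _ => [|t x y _ <-]; rewrite ?co0 ?coD.
  rewrite coS.
  have e : c *m B = \det B *: \row_k m k by rewrite -mulmxA mul_adj_mx mul_mx_scalar.
  transitivity (map_mx intr (c *m B) : 'rV[R]_4).
    rewrite map_mxM mulmx_sum_row; apply: eq_bigr => i _.
    have -> : map_mx intr c 0 i = (c 0 i)%:~R :> R by rewrite mxE.
    rewrite -scale_intC coZ nE; congr (_ *: _).
    by apply/rowP => k; rewrite !mxE.
  by rewrite e; apply/rowP => k; rewrite !mxE rmorphM.
exists `|\det B|%N; first by rewrite absz_gt0.
move=> v /key[l lp]; case: (\det B) => N lv.
  by exists l.
exists (- l); first exact: periodN.
have -> : vec (- l) = - vec l by apply/rowP => k; rewrite !mxE.
by rewrite lv NegzE mulrNz opprK.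
Qed.

End FiniteIndex.

(** * The isogeny attached to a pair of involutions *)

Section LinearMaps.
Variables (K : comNzRingType) (U W : lmodType K) (f : U -> W).
Hypothesis h : forall a u v, f (a *: u + v) = a *: f u + f v.

Lemma lin0 : f 0 = 0.
Proof.
have e := h 1 0 0; rewrite !scale1r addr0 in e.
by apply: (addrI (f 0)); rewrite addr0.
Qed.

Lemma linD u v : f (u + v) = f u + f v.
Proof. by have := h 1 u v; rewrite !scale1r. Qed.

Lemma linZ a u : f (a *: u) = a *: f u.
Proof. by have := h a u 0; rewrite lin0 !addr0. Qed.

Lemma linN u : f (- u) = - f u.
Proof. by rewrite -scaleN1r linZ scaleN1r. Qed.

Lemma linMn u n : f (u *+ n) = f u *+ n.
Proof. by elim: n => [|n IH]; rewrite ?mulr0n ?lin0// !mulrS linD IH. Qed.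

Lemma lin_sum (I : Type) (r : seq I) (P : pred I) (F : I -> U) :
  f (\sum_(i <- r | P i) F i) = \sum_(i <- r | P i) f (F i).
Proof. by apply: (big_morph f linD lin0). Qed.

End LinearMaps.

Section PullbackForms.
Variables (R : realType) (Y Z : riemannSurface R) (f : Y -> Z) (hf : holomorphic_map f).

Lemma lcomp_ex (l : linform (differential Y)) : exists m : linform (differential Z),
  forall u, m u = l (pb hf u).
Proof. by apply: linform_ex => a w w'; rewrite pb_linear linformP. Qed.

(** The map that [f] induces on Jacobians, lifted to the universal covers: the transpose of the
    pullback. *)
Definition lcomp l := projT1 (cid (lcomp_ex l)).

Lemma lcompE l u : lcomp l u = l (pb hf u).
Proof. by rewrite /lcomp; case: cid. Qed.

Lemma lcomp_period l : periods l -> periods (lcomp l).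
Proof.
move=> /periodsP[p h]; apply/periodsP; exists (f p).
have := conn_map hf h; congr (conn _ _ _).
by apply/funext => u; rewrite lcompE.
Qed.

End PullbackForms.

Section Involution.
Variables (R : realType) (Y Z : riemannSurface R) (s : Y -> Y) (q : Y -> Z).
Hypothesis s2 : forall p, s (s p) = p.
Hypothesis hs : holomorphic_map s.
Hypothesis quot : is_quotient_by s q.
Variable hq : holomorphic_map q.

Lemma pb_invol w : pb hs (pb hs w) = w.
Proof.
apply: diff_eq_prim => p; have [g gP] := prim_ex w p.
have gp := nbhs_singleton gP; exists g; last exact: gp.
have g1 : prim_at w g (s (s p)) by rewrite s2.
apply: prim_at_ext (pb_prim hs (pb_prim hs g1)).
by apply: filterE => x; rewrite s2.
Qed.

Lemma quot_pb_inj u : pb hq u = 0 -> u = 0.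
Proof.
have -> : hq = quot_hol quot by exact: Prop_irrelevance.
exact: (pb_inj (n := 2) isT s2 hs (quot := quot)).
Qed.

Lemma quot_pb_inv u : pb hs (pb hq u) = pb hq u.
Proof.
have -> : hq = quot_hol quot by exact: Prop_irrelevance.
exact: (pb_quot_inv (n := 2) isT s2 hs quot).
Qed.

Lemma invol_descent w : exists u, pb hq u = w + pb hs w.
Proof.
have -> : hq = quot_hol quot by exact: Prop_irrelevance.
apply: (descent (n := 2) isT s2 (hs := hs) quot).
by rewrite (linD (pb_linear hs)) pb_invol addrC.
Qed.

(* A loop in the quotient lifts to a path from p to p or to s p; adding its
   image under s closes it up. *)
Lemma invol_period (l m : linform (differential Y)) : periods (lcomp hq l) ->
  (forall w, m w = l (w + pb hs w)) -> periods m.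
Proof.
move=> /periodsP[z hz] mE; have [_ surj _] := quot; have [p pz] := surj z.
have [p' [J [p'z hJ JE]]] := conn_lift (n := 2) isT s2 hs quot hz pz.
have JE' u : J (pb hq u) = l (pb hq u).
  rewrite -lcompE -JE; congr (J (pb _ u)); exact: Prop_irrelevance.
have hJs := conn_map hs hJ.
(* The symmetrised form comes from the quotient, so [l] integrates it along the lifted path [J]; the
   second term is the integral of [w] along the image of that path under [s]. *)
have mJ : (m : differential Y -> R[i]) = fun w => J w + J (pb hs w).
  apply/funext => w; rewrite mE; have [u uE] := invol_descent w.
  rewrite -uE -JE' uE; have := conn_linear hJ 1 w (pb hs w).
  by rewrite scale1r mul1r.
apply/periodsP; exists p; rewrite mJ.
have pp' : q p = q p' by rewrite pz p'z.
have [k kE] := (quot_fiber (n := 2) isT s2 quot _ _).1 pp'.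
have [e|e] : p' = p \/ p' = s p.
  rewrite kE; elim: k {kE} => [|k [IH|IH]]; [by left|right|left]; rewrite iterS IH//.
  rewrite e in hJ hJs; exact: (conn_trans hJ (conn_base p hJs)).
by rewrite e s2 in hJs; rewrite e in hJ; exact: (conn_trans hJ hJs).
Qed.

End Involution.

Section Isogeny.
Variables (R : realType) (L D : set 'rV[R[i]]_2) (Y Q Q' : riemannSurface R).
Variables (u : 'rV[R[i]]_2 -> Y) (s s' : Y -> Y) (q : Y -> Q) (q' : Y -> Q') (d : nat).
Local Notation C := R[i].
Local Notation V := 'rV[R[i]]_2.
Local Notation Om := (differential Y).
Local Notation J X := (linform (differential X)).
Hypothesis hL : is_lattice L.
Hypothesis hY : is_curve_in_torus L D u.
Local Notation dz := (dz (lattice_discrete hL) hY).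
Local Notation vec := (vec (lattice_discrete hL) hY).
Hypothesis s2 : forall p, s (s p) = p.
Hypothesis s'2 : forall p, s' (s' p) = p.
Hypothesis hs : holomorphic_map s.
Hypothesis hs' : holomorphic_map s'.
Hypothesis quot : is_quotient_by s q.
Hypothesis quot' : is_quotient_by s' q'.
Local Notation hq := (quot_hol quot).
Local Notation hq' := (quot_hol quot').
Local Notation S := (pb hs).
Local Notation S' := (pb hs').
Definition T w : Om := S (S' w).
Hypothesis d0 : (0 < d)%N.
Hypothesis Td : forall w, iter d T w = w.
Hypothesis Sdz : forall k, S (dz k) = - dz k.
Hypothesis S'dz : forall k, S' (dz k) = - dz k.
Hypothesis indep : forall a : 'I_2 -> C, a 0 *: dz 0 + a 1 *: dz 1 = 0 -> forall k, a k = 0.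
Hypothesis T_inv : forall w, T w = w -> exists a : 'I_2 -> C, w = a 0 *: dz 0 + a 1 *: dz 1.

Definition translates k w : Om := iter k T w.
Definition trace w : Om := \sum_(k < d) translates k w.
(** Chosen so that (1 - T) applied to it is d w minus the trace of w. *)
Definition cotrace w : Om := \sum_(k < d) \sum_(j < k) translates j w.

Lemma translates_lin k a w w' : translates k (a *: w + w') = a *: translates k w + translates k w'.
Proof. by elim: k => // k IH; rewrite /translates !iterS -!/(translates _ _) IH /T !pb_linear. Qed.

Lemma trace_lin a w w' : trace (a *: w + w') = a *: trace w + trace w'.
Proof.
rewrite /trace scaler_sumr -big_split; apply: eq_bigr => k _; exact: translates_lin.
Qed.

Lemma cotrace_lin a w w' : cotrace (a *: w + w') = a *: cotrace w + cotrace w'.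
Proof.
rewrite /cotrace scaler_sumr -big_split; apply: eq_bigr => k _ /=.
rewrite scaler_sumr -big_split; apply: eq_bigr => j _; exact: translates_lin.
Qed.

Lemma T_lin a w w' : T (a *: w + w') = a *: T w + T w'.
Proof. by rewrite /T !pb_linear. Qed.

Lemma translatesS k w : T (translates k w) = translates k.+1 w.
Proof. by []. Qed.

Lemma trace_T w : T (trace w) = trace w.
Proof.
rewrite /trace (lin_sum T_lin).
under eq_bigr => k _ do rewrite translatesS.
case: d d0 Td => // m _ Tm; rewrite big_ord_recr [RHS]big_ord_recl /= addrC; congr (_ + _).
exact: Tm.
Qed.

(** The sign is such that (1 + S) of this plus (1 + S') of the cotrace leaves (1 - T) of the
    cotrace. *)
Definition proj w : Om := - S' (cotrace w).

Lemma proj_lin a w w' : proj (a *: w + w') = a *: proj w + proj w'.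
Proof. by rewrite /proj cotrace_lin pb_linear opprD scalerN. Qed.

(* Sum of 1 - T^k = (1 - T) (1 + T + ... + T^(k-1)) over k < d, with
   1 - T = (1 + S') - (1 + S) S'. *)
Lemma decomposition w : w *+ d =
  trace w + (proj w + S (proj w)) + (cotrace w + S' (cotrace w)).
Proof.
have e : cotrace w - T (cotrace w) = w *+ d - trace w.
  rewrite /cotrace (lin_sum T_lin) -sumrB /trace -[d in w *+ d]card_ord -sumr_const -sumrB.
  apply: eq_bigr => k _; rewrite (lin_sum T_lin) -sumrB.
  elim: (k : nat) => [|m IH]; first by rewrite big_ord0 subrr.
  by rewrite big_ord_recr /= IH translatesS addrA subrK.
rewrite {1}/proj (linN (pb_linear hs)).
have -> : trace w + (- S' (cotrace w) - S (S' (cotrace w))) + (cotrace w + S' (cotrace w)) =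
  trace w + (cotrace w - T (cotrace w)).
  rewrite -addrA; congr (_ + _).
  have h (x b c : Om) : (- x - b) + (c + x) = c - b by rewrite addrC addrA addrK.
  exact: h.
by rewrite e addrC subrK.
Qed.

Lemma S_invol w : S (S w) = w. Proof. exact: pb_invol. Qed.
Lemma S'_invol w : S' (S' w) = w. Proof. exact: pb_invol. Qed.

(** The dihedral relation between the rotation [T] and the reflection [S]. *)
Lemma TST w : T (S (T w)) = S w.
Proof. by rewrite /T !S_invol S'_invol. Qed.

Lemma translates_S k w : translates k (S (translates k w)) = S w.
Proof.
elim: k => // k IH.
rewrite -[in RHS]IH /translates iterSr.
by congr (iter k _ _); exact: TST.
Qed.

Lemma S_translates k w : (k <= d)%N -> S (translates k w) = translates (d - k) (S w).
Proof.
move=> kd; rewrite -(translates_S k w) /translates -iterD subnK//.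
Qed.

Lemma S_trace w : S (trace w) = trace (S w).
Proof.
(* [S] sends the k-th translate to the translate of index d - k, whereas reversing the sum gives d -
   1 - k. The additional [T], which the trace absorbs, makes up for the difference. *)
rewrite -[RHS]trace_T /trace (lin_sum (pb_linear hs)) (lin_sum T_lin).
rewrite [RHS](reindex_inj rev_ord_inj); apply: eq_bigr => k _.
rewrite S_translates; last exact: ltnW.
by rewrite translatesS -subSn ?subSS// ltnW.
Qed.

(* T-invariant forms come from the plane, where S is -1. *)
Lemma S_T_inv w : S w = w -> T w = w -> w = 0.
Proof.
move=> Sw /T_inv[a wE]; apply/eqP; have := Sw.
rewrite {1}wE (linD (pb_linear hs)) !(linZ (pb_linear hs)) !Sdz !scalerN -opprD -wE.
move=> /eqP; rewrite eq_sym -subr_eq0 opprK -mulr2n -scaler_nat scaler_eq0 pnatr_eq0.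
by [].
Qed.

Lemma trace_S_inv w : S w = w -> trace w = 0.
Proof. by move=> Sw; apply: S_T_inv; rewrite ?trace_T// S_trace Sw. Qed.

(** Here T w = S w, so [S w] and [w] have the same trace, which is then invariant under both [S] and
    [T]. *)
Lemma trace_S'_inv w : S' w = w -> trace w = 0.
Proof.
move=> Sw; have e : T w = S w by rewrite /T Sw.
have h : trace (S w) = trace w.
  rewrite -e /trace -[RHS]/(trace w) -[RHS]trace_T /trace (lin_sum T_lin).
  by apply: eq_bigr => k _; rewrite /translates -iterSr iterS.
by apply: S_T_inv; rewrite ?trace_T// S_trace h.
Qed.

Lemma inv_S w : S (w + S w) = w + S w.
Proof. by rewrite (linD (pb_linear hs)) S_invol addrC. Qed.

Lemma inv_S' w : S' (w + S' w) = w + S' w.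
Proof. by rewrite (linD (pb_linear hs')) S'_invol addrC. Qed.

Lemma S_S'_inv w : S w = w -> S' w = w -> w = 0.
Proof. by move=> h h'; apply: S_T_inv; rewrite // /T h'. Qed.

(** The trace vanishes, so the [S']-part is a difference of [S]-invariant forms. Being invariant
    under both involutions, it is 0. *)
Lemma decomp_S w : S w = w ->
  proj w + S (proj w) = w *+ d /\ cotrace w + S' (cotrace w) = 0.
Proof.
move=> Sw; have := decomposition w; rewrite trace_S_inv// add0r => e.
suff h : cotrace w + S' (cotrace w) = 0 by rewrite e h addr0.
apply: S_S'_inv; last exact: inv_S'.
have -> : cotrace w + S' (cotrace w) = w *+ d - (proj w + S (proj w)).
  by rewrite e addrAC subrr add0r.
by rewrite (linD (pb_linear hs)) (linN (pb_linear hs)) inv_S (linMn (pb_linear hs)) Sw.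
Qed.

Lemma decomp_S' w : S' w = w ->
  proj w + S (proj w) = 0 /\ cotrace w + S' (cotrace w) = w *+ d.
Proof.
move=> Sw; have := decomposition w; rewrite trace_S'_inv// add0r => e.
suff h : proj w + S (proj w) = 0 by rewrite e h add0r.
apply: S_S'_inv; first exact: inv_S.
have -> : proj w + S (proj w) = w *+ d - (cotrace w + S' (cotrace w)).
  by rewrite e addrK.
by rewrite (linD (pb_linear hs')) (linN (pb_linear hs')) inv_S' (linMn (pb_linear hs')) Sw.
Qed.

Lemma Tdz k : T (dz k) = dz k.
Proof. by rewrite /T S'dz (linN (pb_linear hs)) Sdz opprK. Qed.

(** [T] fixes [dz k], so trace and cotrace are multiples of it, and both involutions act on these by
    -1. *)
Lemma decomp_dz k : [/\ trace (dz k) = dz k *+ d, proj (dz k) + S (proj (dz k)) = 0 &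
  cotrace (dz k) + S' (cotrace (dz k)) = 0].
Proof.
have tz j : translates j (dz k) = dz k.
  by elim: j => // j IH; rewrite -translatesS IH Tdz.
have [m mE] : exists m, cotrace (dz k) = dz k *+ m.
  exists (\sum_(j < d) j)%N; rewrite /cotrace -sumrMnr; apply: eq_bigr => j _.
  by under eq_bigr => i _ do rewrite tz; rewrite sumr_const card_ord.
split.
- by rewrite /trace; under eq_bigr => i _ do rewrite tz; rewrite sumr_const card_ord.
- rewrite /proj mE (linMn (pb_linear hs')) S'dz mulNrn opprK.
  by rewrite (linMn (pb_linear hs)) Sdz mulNrn subrr.
- by rewrite mE (linMn (pb_linear hs')) S'dz mulNrn subrr.
Qed.

Lemma dz_coef_inj (a b : 'I_2 -> C) :
  a 0 *: dz 0 + a 1 *: dz 1 = b 0 *: dz 0 + b 1 *: dz 1 -> forall k, a k = b k.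
Proof.
move=> e k; have h : (fun j => a j - b j) 0 *: dz 0 + (fun j => a j - b j) 1 *: dz 1 = 0.
  by rewrite !scalerBl addrACA -opprD e subrr.
have /eqP := indep (a := fun j => a j - b j) h k; rewrite subr_eq0 => /eqP; exact.
Qed.

Lemma isogeny_surj (lam : V) (phi : J Q) (phi' : J Q') :
  exists v : J Y, [/\ vec v = lam, lcomp hq v = phi & lcomp hq' v = phi'].
Proof.
have [du duE] := choice (fun w => invol_descent s2 hs quot hq (proj w)).
have [du' du'E] := choice (fun w => invol_descent s'2 hs' quot' hq' (cotrace w)).
have [aa aaE] := choice (fun w => T_inv (trace_T w)).
have pb_inj1 := quot_pb_inj s2 hs quot (hq := hq).
have pb_inj2 := quot_pb_inj s'2 hs' quot' (hq := hq').
have duL a w w' : du (a *: w + w') = a *: du w + du w'.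
  apply/eqP; rewrite -subr_eq0; apply/eqP; apply: pb_inj1.
  rewrite (linD (pb_linear hq)) (linN (pb_linear hq)) pb_linear !duE proj_lin pb_linear.
  by rewrite scalerDr addrACA subrr.
have du'L a w w' : du' (a *: w + w') = a *: du' w + du' w'.
  apply/eqP; rewrite -subr_eq0; apply/eqP; apply: pb_inj2.
  rewrite (linD (pb_linear hq')) (linN (pb_linear hq')) pb_linear !du'E cotrace_lin pb_linear.
  by rewrite scalerDr addrACA subrr.
have aaL a w w' k : aa (a *: w + w') k = a * aa w k + aa w' k.
  apply: (dz_coef_inj (b := fun k => a * aa w k + aa w' k)).
  by rewrite -aaE trace_lin [in LHS]aaE [in LHS](aaE w') scalerDr !scalerA !scalerDl addrACA.
have dC0 : (d%:R : C) != 0 by rewrite pnatr_eq0 -lt0n.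
(* The decomposition of [w *+ d] dictates the inverse: [aa w] are the coefficients of its trace,
   while [du w] and [du' w] are the forms on the two quotients whose pullbacks are the other two
   terms. *)
have [v vE] : exists v : J Y, forall w,
    v w = d%:R^-1 * ((aa w 0 * lam 0 0 + aa w 1 * lam 0 1) + (phi (du w) + phi' (du' w))).
  apply: linform_ex => a w w'; rewrite !aaL duL du'L !linformP; ring.
have duI w w0 : proj w + S (proj w) = pb hq w0 -> du w = w0.
  move=> e; apply/eqP; rewrite -subr_eq0; apply/eqP; apply: pb_inj1.
  by rewrite (linD (pb_linear hq)) (linN (pb_linear hq)) duE e subrr.
have du'I w w0 : cotrace w + S' (cotrace w) = pb hq' w0 -> du' w = w0.
  move=> e; apply/eqP; rewrite -subr_eq0; apply/eqP; apply: pb_inj2.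
  by rewrite (linD (pb_linear hq')) (linN (pb_linear hq')) du'E e subrr.
have aa0 w : trace w = 0 -> forall k, aa w k = 0 by move=> e; apply: indep; rewrite -aaE.
have phi0 : phi 0 = 0 := lin0 (fun a w w' => linformP phi a w w').
have phi'0 : phi' 0 = 0 := lin0 (fun a w w' => linformP phi' a w w').
have cancel (x : C) : d%:R^-1 * (d%:R * x) = x by rewrite mulrA mulVf ?mul1r.
exists v; split.
- apply/rowP => k; rewrite mxE vE.
  have [h1 h2 h3] := decomp_dz k.
  have -> : du (dz k) = 0 by apply: duI; rewrite h2 (lin0 (pb_linear hq)).
  have -> : du' (dz k) = 0 by apply: du'I; rewrite h3 (lin0 (pb_linear hq')).
  have aE j : aa (dz k) j = (if j == k then d%:R else 0).
    apply: (dz_coef_inj (b := fun j => if j == k then d%:R else 0)).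
    rewrite -aaE h1 -scaler_nat.
    by have [->|->] := ord2P k; rewrite /= ?eqxx ?scale0r ?addr0 ?add0r.
  rewrite phi0 phi'0 !addr0 -[RHS]cancel; congr (_ * _).
  rewrite !aE; by have [->|->] := ord2P k; rewrite /= ?mul0r ?addr0 ?add0r.
- apply: linform_eq => w; rewrite lcompE vE.
  have Sw := quot_pb_inv s2 hs quot hq w; have [h1 h2] := decomp_S Sw.
  rewrite !(aa0 _ (trace_S_inv Sw)) !mul0r !add0r.
  have -> : du' (pb hq w) = 0 by apply: du'I; rewrite h2 (lin0 (pb_linear hq')).
  have -> : du (pb hq w) = d%:R *: w.
    by apply: duI; rewrite h1 (linZ (pb_linear hq)) scaler_nat.
  by rewrite phi'0 addr0 (linZ (fun a w w' => linformP phi a w w')) cancel.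
- apply: linform_eq => w; rewrite lcompE vE.
  have Sw := quot_pb_inv s'2 hs' quot' hq' w; have [h1 h2] := decomp_S' Sw.
  rewrite !(aa0 _ (trace_S'_inv Sw)) !mul0r !add0r.
  have -> : du (pb hq' w) = 0 by apply: duI; rewrite h1 (lin0 (pb_linear hq)).
  have -> : du' (pb hq' w) = d%:R *: w.
    by apply: du'I; rewrite h2 (linZ (pb_linear hq')) scaler_nat.
  by rewrite phi0 add0r (linZ (fun a w w' => linformP phi' a w w')) cancel.
Qed.

Lemma period_translates (m : J Y) k : periods m ->
  exists2 l : J Y, periods l & forall w, l w = m (translates k w).
Proof.
elim: k m => [|k IH] m hm; first by exists m.
have [l lp lE] := IH (lcomp hs' (lcomp hs m)) (lcomp_period hs' (lcomp_period hs hm)).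
by exists l => // w; rewrite lE !lcompE.
Qed.

Lemma period_trace (m : J Y) : periods m ->
  exists2 l : J Y, periods l & forall w, l w = m (trace w).
Proof.
move=> hm; have [l lP] := choice (fun k : 'I_d =>
  let: ex_intro2 l h1 h2 := period_translates k hm in ex_intro _ l (conj h1 h2)).
exists (\sum_k l k); first by apply: period_sum => k; have [] := lP k.
move=> w; rewrite /trace (lin_sum (fun a w w' => linformP m a w w')).
elim/big_rec2: _ => [|k x y _ <-]; first exact: linform0E.
by rewrite linformDE (lP k).2.
Qed.

Lemma period_cotrace (m : J Y) : periods m ->
  exists2 l : J Y, periods l & forall w, l w = m (cotrace w).
Proof.
move=> hm; have [l lP] := choice (fun k =>
  let: ex_intro2 l h1 h2 := period_translates k hm in ex_intro _ l (conj h1 h2)).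
exists (\sum_(k < d) \sum_(j < k) l j).
  by apply: period_sum => k; apply: period_sum => j; have [] := lP j.
have add I (r : seq I) (F : I -> J Y) (G : I -> Om) w :
    (forall i, F i w = m (G i)) -> (\sum_(i <- r) F i) w = m (\sum_(i <- r) G i).
  move=> h; rewrite (lin_sum (fun a w w' => linformP m a w w')).
  by elim/big_rec2: _ => [|k x y _ <-]; [exact: linform0E|rewrite linformDE h].
move=> w; apply: (add) => k; apply: (add) => j; exact: (lP j).2.
Qed.

Lemma isogeny_kernel : exists2 M : nat, (0 < M)%N & forall v : J Y,
  L (vec v) -> periods (lcomp hq v) -> periods (lcomp hq' v) -> periods (v *+ M).
Proof.
have [N N0 NP] := period_finite_index indep.
(* The factor [d] comes from the decomposition of forms, and [N] from the index of the periods of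
   the coordinate differentials in the lattice. *)
exists (N * d)%N => [|v Lv pq pq']; first by rewrite muln_gt0 N0.
have lv := fun a w w' => linformP v a w w'.
have half (z : Y -> Y) (hz : holomorphic_map z) : exists l : J Y, forall w, l w = v (w + pb hz w).
  by apply: linform_ex => a w w'; rewrite pb_linear addrACA -scalerDr linformP.
have [l1 l1E] := half s hs; have [l2 l2E] := half s' hs'.
have p1 : periods l1 := invol_period s2 quot pq l1E.
have p2 : periods l2 := invol_period s'2 quot' pq' l2E.
have [m2 m2p m2E] := period_cotrace p2.
have [m1 m1p m1E] := period_cotrace (lcomp_period hs' p1).
have [l0 l0p l0E] := NP _ Lv.
have [m0 m0p m0E] := period_trace l0p.
(* [v] is applied to the decomposition. On traces N v agrees with the period [l0]; the other terms
   are [l1] of [proj w] and [l2] of the cotrace, and the minus sign before [m1] is that of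
   [proj]. *)
have -> : v *+ (N * d) = m0 + (m2 - m1) *+ N.
  apply: linform_eq => w.
  have Mn (l : J Y) k : (l *+ k) w = l w *+ k.
    by elim: k => [|k IH]; rewrite ?mulr0n ?mulrS ?linform0E// linformDE IH.
  have l1v := fun a w w' => linformP l1 a w w'.
  rewrite linformDE !Mn linformDE linformNE m0E m1E m2E lcompE l2E.
  have -> : l1 (S' (cotrace w)) = - l1 (proj w) by rewrite /proj (linN l1v) opprK.
  rewrite opprK l1E mulnC mulrnA -(linMn lv) decomposition !(linD lv) !mulrnDl.
  have -> : v (trace w) *+ N = l0 (trace w).
    have [a aE] := T_inv (trace_T w).
    have l0v := fun a w w' => linformP l0 a w w'.
    rewrite aE !(linD lv, linD l0v) !(linZ lv, linZ l0v).
    have dzk k : l0 (dz k) = v (dz k) *+ N.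
      have := congr1 (fun m : V => m 0 k) l0E; rewrite mxE mulmxnE mxE; exact.
    by rewrite !dzk mulrnDl !scalerMnr.
  rewrite -[LHS]addrA; congr (_ + _); exact: addrC.
by apply: periodD => //; apply: periodMn; exact: periodB.
Qed.

Definition isogeny_map (v : J Y) : V * (J Q * J Q') := (vec v, (lcomp hq v, lcomp hq' v)).

Lemma isogeny_map_linear a v w :
  isogeny_map (a *: v + w) = a *: isogeny_map v + isogeny_map w.
Proof.
congr (_, (_, _)).
- by apply/rowP => k; rewrite !mxE.
- by apply: linform_eq => w'; rewrite linformDE linformZE !lcompE.
- by apply: linform_eq => w'; rewrite linformDE linformZE !lcompE.
Qed.

HB.instance Definition _ := GRing.isLinear.Build C (J Y) (V * (J Q * J Q'))%type *:%R
  isogeny_map isogeny_map_linear.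

Theorem dihedral_isogeny : isogenous (curve_jacobian Y)
  (torus_prod (ComplexTorus L) (torus_prod (curve_jacobian Q) (curve_jacobian Q'))).
Proof.
exists (isogeny_map : {linear _ -> _}); split.
- move=> v hv; split; first exact: period_vec.
  by split; exact: lcomp_period.
- move=> [lam [phi phi']]; have [v [v1 v2 v3]] := isogeny_surj lam phi phi'.
  have h1 : L (vec v - lam) by rewrite v1 subrr; exact: (L_subgroup hL).1.
  have h2 : periods (lcomp hq v - phi) by rewrite v2 subrr; exact: period0.
  have h3 : periods (lcomp hq' v - phi') by rewrite v3 subrr; exact: period0.
  exists v; exact: (conj h1 (conj h2 h3)).
have [M M0 MP] := isogeny_kernel; have [r rP] := periods_saturation Y M0.
exists r => v [h1 [h2 h3]].
by apply: rP; exact: MP.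
Qed.

End Isogeny.

Lemma holomorphic_comp (R : realType) (X Y Z : riemannSurface R) (f : X -> Y) (g : Y -> Z) :
  holomorphic_map f -> holomorphic_map g -> holomorphic_map (g \o f).
Proof.
move=> hf hg; split.
  by move=> p; apply: (@continuous_comp _ _ _ f g); [exact: hf.1|exact: hg.1].
move=> i k p ip kp; have [j jp] := rs_cover (f p).
have [d1 h1] := holomorphic_hder hf ip jp; have [d2 h2] := holomorphic_hder hg jp kp.
exists (d2 * d1); apply/hderP => //; exact: hder_comp hf.1 h1 h2.
Qed.

Lemma pb_comp (R : realType) (X Y Z : riemannSurface R) (f : X -> Y) (g : Y -> Z)
    (hf : holomorphic_map f) (hg : holomorphic_map g) (hgf : holomorphic_map (g \o f)) w :
  pb hgf w = pb hf (pb hg w).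
Proof.
apply: diff_eq_prim => p; have [h hP] := prim_ex w (g (f p)).
have h0 := nbhs_singleton hP; exists (fun x => h (g (f x))).
  exact: (pb_prim hgf h0).
exact: (pb_prim hf (pb_prim hg h0)).
Qed.

Lemma affine_map_ex (R : realType) (L1 D1 L2 D2 : set 'rV[R[i]]_2) (Y1 Y2 : riemannSurface R)
    (u1 : 'rV[R[i]]_2 -> Y1) (u2 : 'rV[R[i]]_2 -> Y2) (eps : R[i]) (c : 'rV[R[i]]_2) :
  is_curve_in_torus L1 D1 u1 -> is_curve_in_torus L2 D2 u2 ->
  (forall v, D1 v -> D2 (eps *: v + c)) -> (forall l, L1 l -> L2 (eps *: l)) ->
  exists F : Y1 -> Y2, forall v, D1 v -> F (u1 v) = u2 (eps *: v + c).
Proof.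
move=> h1 h2 DD LL; have h p : exists y, forall v, D1 v -> u1 v = p -> u2 (eps *: v + c) = y.
  have [v Dv uv] := curve_surj h1 p; exists (u2 (eps *: v + c)) => w Dw uw.
  apply/(curve_eq h2) => //; [exact: DD|exact: DD|].
  rewrite opprD addrACA subrr addr0 -scalerBr; apply: LL.
  by apply/(curve_eq h1) => //; rewrite uw.
have [F FP] := choice h.
by exists F => v Dv; rewrite (FP (u1 v) v).
Qed.

(** * The covering of the genus 2 curve *)

Section Geometry.
Variables (R : realType) (d : nat) (L L' D : set 'rV[R[i]]_2) (x : 'rV[R[i]]_2).
Local Notation C := R[i].
Local Notation V := 'rV[R[i]]_2.
Variables (H Y : riemannSurface R) (uH : V -> H) (uY : V -> Y).
Hypothesis d0 : (0 < d)%N.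
Hypothesis hL : is_lattice L.
Hypothesis hX : is_extension_of_order L L' d.
Hypothesis hx : forall v, L' v <-> exists k : int, L (v - x *~ k).
Hypothesis hH : is_curve_in_torus L' D uH.
Hypothesis hY : is_curve_in_torus L D uY.
Hypothesis genus2 : has_genus H 2.
Hypothesis DL' : forall v l, D v -> L' l -> D (v + l).
Let sL := L_subgroup hL.
Let dL := lattice_discrete hL.
Let dL' := extension_discrete d0 dL hX.
Local Notation dzY := (dz dL hY).

Lemma subgroupB v w : L v -> L w -> L (v - w). Proof. exact: sL.2. Qed.
Lemma latticeN v : L v -> L (- v). Proof. by move=> h; rewrite -sub0r; apply: subgroupB; first exact: sL.1. Qed.
Lemma LL' v : L v -> L' v. Proof. by case: hX => _ h _; exact: h. Qed.
Lemma L'N v : L' v -> L' (- v).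
Proof. by case: hX => [[h0 hB] _ _] h; rewrite -sub0r; exact: hB. Qed.

Lemma L'x : L' x.
Proof. by apply/hx; exists 1; rewrite mulr1z subrr; exact: sL.1. Qed.

(** The order of the group L' / L kills the class of [x]. *)
Lemma Lxd : L (x *+ d).
Proof. exact: extension_exponent sL hX _ L'x. Qed.

Lemma proj_ex : exists pi : Y -> H, holomorphic_map pi /\ forall v, D v -> pi (uY v) = uH v.
Proof.
have DD v : D v -> D (1 *: v + 0) by rewrite scale1r addr0.
have [pi piE] := affine_map_ex hY hH DD (fun l Ll => eq_ind_r L' (LL' Ll) (scale1r l)).
have hp := affine_hol dL' hY hH DD piE.
exists pi; split; first exact: hp.
by move=> v Dv; rewrite piE// scale1r addr0.
Qed.

Definition to_genus2 : Y -> H := projT1 (cid proj_ex).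

Lemma to_genus2_hol : holomorphic_map to_genus2.
Proof. by rewrite /to_genus2; case: cid => ? /= []. Qed.

Lemma to_genus2E v : D v -> to_genus2 (uY v) = uH v.
Proof. by rewrite /to_genus2; case: cid => ? /= [_ h]; exact: h. Qed.

Lemma pb_to_genus2 k : pb to_genus2_hol (dz dL' hH k) = dzY k.
Proof.
have DD v : D v -> D (1 *: v + 0) by rewrite scale1r addr0.
have piE v : D v -> to_genus2 (uY v) = uH (1 *: v + 0).
  by move=> Dv; rewrite to_genus2E// scale1r addr0.
by rewrite (affine_pb dL dL' hY hH DD piE) scale1r.
Qed.

Section Deck.
Variable t : Y -> Y.
Hypothesis ht : holomorphic_map t.
Hypothesis tE : forall v, D v -> D (v - x) /\ t (uY v) = uY (v - x).

Lemma deck_iter k v : D v -> D (v - x *+ k) /\ iter k t (uY v) = uY (v - x *+ k).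
Proof.
move=> Dv; elim: k => [|k [IH1 IH2]]; first by rewrite mulr0n subr0.
have [h1 h2] := tE IH1.
by rewrite iterS IH2 h2 mulrSr opprD addrA.
Qed.

Lemma deck_order p : iter d t p = p.
Proof.
have [v Dv <-] := curve_surj hY p; have [h1 h2] := deck_iter d Dv.
rewrite h2; apply/(curve_eq hY) => //.
by rewrite addrAC subrr add0r; apply: latticeN; exact: Lxd.
Qed.

Lemma deck_quotient : is_quotient_by t to_genus2.
Proof.
split; first exact: to_genus2_hol.
  by move=> z; have [v Dv <-] := curve_surj hH z; exists (uY v); exact: to_genus2E.
move=> p q; have [v Dv pv] := curve_surj hY p; have [w Dw qw] := curve_surj hY q.
rewrite -pv -qw !to_genus2E//; split.
  (* [t] subtracts [x]: when v - w is k x modulo L with k nonnegative, iterating [t] leads from v to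
     w, and for negative k from w to v. *)
  move=> /(curve_eq hH Dv Dw)/hx[[k|k] h].
    exists k; left; have [h1 ->] := deck_iter k Dv; apply/(curve_eq hY) => //.
    have e := latticeN h; rewrite !opprB addrCA in e.
    by rewrite opprB; exact: e.
  exists k.+1; right; have [h1 ->] := deck_iter k.+1 Dw; apply/(curve_eq hY) => //.
  rewrite NegzE mulrNz opprK -addrA [- w + _]addrC in h.
  by rewrite opprB; exact: h.
have key a k : D a -> L' (x *+ k) -> uH a = uH (a - x *+ k).
  move=> Da h; apply/(curve_eq hH) => //; first exact: (deck_iter k Da).1.
  by rewrite opprB addrCA subrr addr0.
have L'xk k : L' (x *+ k).
  by apply/hx; exists k; rewrite pmulrn subrr; exact: sL.1.
move=> [k [h|h]].
  rewrite (key v k Dv (L'xk k)) -to_genus2E; last exact: (deck_iter k Dv).1.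
  by rewrite -(deck_iter k Dv).2 -h to_genus2E.
rewrite (key w k Dw (L'xk k)) -(to_genus2E (deck_iter k Dw).1).
by rewrite -(deck_iter k Dw).2 -h to_genus2E.
Qed.

(** The form descends to [H], where it is a combination of the coordinate differentials, and these
    pull back to those of [Y]. *)
Lemma deck_invariant w : pb ht w = w ->
  exists a : 'I_2 -> C, w = a 0 *: dzY 0 + a 1 *: dzY 1.
Proof.
move=> tw; have [y yE] := descent d0 deck_order (hs := ht) deck_quotient tw.
have [a aE] := dz_span dL' hH genus2 y; exists a; rewrite -yE.
have -> : quot_hol deck_quotient = to_genus2_hol by exact: Prop_irrelevance.
by rewrite aE pb_linear (linZ (pb_linear _)) !pb_to_genus2.
Qed.

Lemma deck_indep (a : 'I_2 -> C) : a 0 *: dzY 0 + a 1 *: dzY 1 = 0 -> forall k, a k = 0.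
Proof.
move=> h; apply: (dz_indep genus2 (dL := dL') (hY := hH)).
apply: (pb_inj d0 deck_order ht (quot := deck_quotient)).
have -> : quot_hol deck_quotient = to_genus2_hol by exact: Prop_irrelevance.
by rewrite pb_linear (linZ (pb_linear _)) !pb_to_genus2.
Qed.

End Deck.

(** Stated for every [d]: the odd case is deduced from it by presenting the second quotient on the
    same surface as the first. *)
Lemma even_isogeny (s s' : Y -> Y) (Q Q' : riemannSurface R) (q : Y -> Q) (q' : Y -> Q') :
  restricts_to D uY (fun v => - v) s -> is_quotient_by s q ->
  restricts_to D uY (fun v => - v - x) s' -> is_quotient_by s' q' ->
  isogenous (curve_jacobian Y)
    (torus_prod (ComplexTorus L) (torus_prod (curve_jacobian Q) (curve_jacobian Q'))).
Proof.
move=> sE quot s'E quot'.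
have s2 p : s (s p) = p.
  have [v Dv <-] := curve_surj hY p; have [h1 ->] := sE v Dv.
  by have [_ ->] := sE _ h1; rewrite opprK.
have s'2 p : s' (s' p) = p.
  have [v Dv <-] := curve_surj hY p; have [h1 ->] := s'E v Dv.
  by have [_ ->] := s'E _ h1; rewrite opprD !opprK addrK.
have D1 v : D v -> D (-1 *: v + 0) by rewrite scaleN1r addr0 => /sE[].
have u1 v : D v -> s (uY v) = uY (-1 *: v + 0) by rewrite scaleN1r addr0 => /sE[].
have D2 v : D v -> D (-1 *: v - x) by rewrite scaleN1r => /s'E[].
have u2 v : D v -> s' (uY v) = uY (-1 *: v - x) by rewrite scaleN1r => /s'E[].
have hs := affine_hol dL hY hY D1 u1.
have hs' := affine_hol dL hY hY D2 u2.
have ht := holomorphic_comp hs hs'.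
have tE v : D v -> D (v - x) /\ (s' \o s) (uY v) = uY (v - x).
  move=> Dv; have [h1 e1] := sE v Dv; have [h2 e2] := s'E _ h1.
  by rewrite opprK in h2 e2; rewrite /= e1 e2.
(* Pullback reverses composition, so S S' is the pullback by s' o s, which is v -> v - x. *)
have TE w : T hs hs' w = pb ht w by rewrite /T (pb_comp hs hs' ht).
apply: (dihedral_isogeny (hL := hL) (hY := hY) s2 s'2 (hs := hs) (hs' := hs') quot quot' d0).
- move=> w; apply: diff_eq_prim => p; have [g gP] := prim_ex w p.
  have gp := nbhs_singleton gP; exists g; last exact: gp.
  have it k y : prim_at w g (iter k (s' \o s) y) ->
      prim_at (iter k (T hs hs') w) (fun z => g (iter k (s' \o s) z)) y.
    elim: k y => [//|k IH] y; rewrite iterSr => /IH h.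
    have h' := pb_prim ht h; rewrite -TE in h'.
    apply: prim_at_ext h'; apply: filterE => z; by rewrite iterSr.
  have h := it d p; rewrite (deck_order tE) in h.
  apply: prim_at_ext (h gp); apply: filterE => z; by rewrite (deck_order tE).
- by move=> k; rewrite (affine_pb dL dL hY hY D1 u1) scaleN1r.
- by move=> k; rewrite (affine_pb dL dL hY hY D2 u2) scaleN1r.
- exact: (deck_indep ht tE).
- by move=> w; rewrite TE; exact: (deck_invariant tE).
Qed.

Lemma odd_isogeny (s : Y -> Y) (Q : riemannSurface R) (q : Y -> Q) : odd d ->
  restricts_to D uY (fun v => - v) s -> is_quotient_by s q ->
  isogenous (curve_jacobian Y)
    (torus_prod (ComplexTorus L) (torus_prod (curve_jacobian Q) (curve_jacobian Q))).
Proof.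
move=> dodd sE quot; pose y := x *+ (d.+1)./2.
have y2 : y + y = x + x *+ d.
  rewrite -mulrnDr addnn -mulrS; congr (_ *+ _).
  by rewrite -[in RHS](odd_double_half d.+1) /= dodd.
have L'y : L' y.
  by apply/hx; exists (d.+1)./2; rewrite /y pmulrn subrr; exact: sL.1.
have transl z : L' z -> exists t : Y -> Y, holomorphic_map t /\
    forall v, D v -> D (v + z) /\ t (uY v) = uY (v + z).
  move=> L'z; have DD v : D v -> D (1 *: v + z) by rewrite scale1r => Dv; exact: DL'.
  have LL l : L l -> L (1 *: l) by rewrite scale1r.
  have [t tE] := affine_map_ex hY hY DD LL.
  have ht := affine_hol dL hY hY DD tE.
  exists t; split; first exact: ht.
  by move=> v Dv; rewrite tE// scale1r; split => //; exact: DL'.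
have [t [ht tE]] := transl y L'y.
have [t' [_ t'E]] := transl (- y) (L'N L'y).
have tK p : t' (t p) = p.
  have [v Dv <-] := curve_surj hY p; have [h1 ->] := tE v Dv.
  by rewrite (t'E _ h1).2 addrK.
have t'K p : t (t' p) = p.
  have [v Dv <-] := curve_surj hY p; have [h1 ->] := t'E v Dv.
  by rewrite (tE _ h1).2 subrK.
have D2 v : D v -> D (-1 *: v - x).
  by rewrite scaleN1r => /sE[Dv _]; apply: DL' => //; apply: L'N; exact: L'x.
have LL l : L l -> L (-1 *: l) by rewrite scaleN1r => /latticeN.
have [s' s'u] := affine_map_ex hY hY D2 LL.
have s'E : restricts_to D uY (fun v => - v - x) s'.
  by move=> v Dv; have h := D2 v Dv; rewrite s'u// -scaleN1r.
have ts' p : t (s' p) = s (t p).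
  have [v Dv <-] := curve_surj hY p; have [h1 ->] := s'E v Dv; have [h2 ->] := tE v Dv.
  have [h3 ->] := tE _ h1; have [h4 ->] := sE _ h2; apply/(curve_eq hY) => //.
  (* The two lifts differ by 2 y - x = d x, an element of L; so translation by [y] intertwines [s']
     with [s] on the curve. *)
  have -> : - v - x + y - - (v + y) = x *+ d; last exact: Lxd.
  rewrite opprK [v + y]addrC addrA -[_ + y + y]addrA y2.
  by rewrite addrAC -[- v - x + v]addrAC addNr sub0r addrA addNr add0r.
have ts'k k p : t (iter k s' p) = iter k s (t p).
  by elim: k => // k IH; rewrite !iterS ts' IH.
apply: (even_isogeny sE quot s'E (q' := q \o t)).
have [hq surj fib] := quot; split; first exact: holomorphic_comp.
  by move=> z; have [p pz] := surj z; exists (t' p); rewrite /= t'K.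
have ti := can_inj tK.
(* Since [t] is a bijection carrying the orbits of [s'] to those of [s], the fibres of [q \o t] are
   the orbits of [s']. *)
move=> p p'; rewrite /= fib; split=> -[k h]; exists k.
  by case: h; rewrite -ts'k => /ti; [left|right].
by rewrite -!ts'k; case: h => ->; [left|right].
Qed.

End Geometry.

Theorem theorem0p1 (R : realType) (d : nat)
  (* the abelian surface A = V / L with its polarization of type (1, d) *)
  (L : set 'rV[R[i]]_2) (E : 'rV[R[i]]_2 -> 'rV[R[i]]_2 -> R)
  (hd : (1 <= d)%N)
  (hL : is_lattice L)
  (hE : is_riemann_form E)
  (htype : has_type E L 1 d)
  (* the group X = L' / L, cyclic with generator x *)
  (L' : set 'rV[R[i]]_2) (x : 'rV[R[i]]_2)
  (hX : is_extension_of_order L L' d)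
  (hx : forall v, L' v <-> exists k : int, L (v - x *~ k))
  (* the decomposition of V and the bundles of characteristic 0 *)
  (V1 V2 : set 'rV[R[i]]_2) (chi : 'rV[R[i]]_2 -> R[i])
  (hV : is_isotropic_decomposition E V1 V2)
  (hVL : decomposes V1 V2 L)
  (hVL' : decomposes V1 V2 L')
  (hchi : is_semicharacter0 E V1 V2 chi)
  (hK : L' `<=` lb_kernel L (appell_humbert E chi))
  (* the smooth genus 2 curve H = div(th) in V / L' *)
  (th : 'rV[R[i]]_2 -> R[i])
  (hth : lb_section L' (appell_humbert E chi) th)
  (hth0 : exists v, th v != 0)
  (H : riemannSurface R) (uH : 'rV[R[i]]_2 -> H)
  (hsmooth : smooth_divisor th)
  (hH : is_curve_in_torus L' [set v | th v = 0] uH)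
  (hgenus : has_genus H 2)
  (* its preimage C in A = V / L *)
  (C : riemannSurface R) (uC : 'rV[R[i]]_2 -> C)
  (hC : is_curve_in_torus L [set v | th v = 0] uC) :
  (odd d ->
     forall (s : C -> C) (Q : riemannSurface R) (q : C -> Q),
       restricts_to [set v | th v = 0] uC (fun v => - v) s ->
       is_quotient_by s q ->
       isogenous (curve_jacobian C)
         (torus_prod (ComplexTorus L)
            (torus_prod (curve_jacobian Q) (curve_jacobian Q)))) /\
  (~~ odd d ->
     forall (s s' : C -> C) (Q Q' : riemannSurface R) (q : C -> Q) (q' : C -> Q'),
       restricts_to [set v | th v = 0] uC (fun v => - v) s ->
       is_quotient_by s q ->
       restricts_to [set v | th v = 0] uC (fun v => - v - x) s' ->
       is_quotient_by s' q' ->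
       isogenous (curve_jacobian C)
         (torus_prod (ComplexTorus L)
            (torus_prod (curve_jacobian Q) (curve_jacobian Q')))).
Proof.
have [_ thq] := hth.
have DL' v l : [set v | th v = 0] v -> L' l -> [set v | th v = 0] (v + l).
  by move=> /= tv L'l; rewrite thq// tv mulr0.
split=> [dodd s Q q sE quot|_ s s' Q Q' q q' sE quot s'E quot'].
  exact: (odd_isogeny hd hL hX hx hH hC hgenus DL' dodd sE quot).
exact: (even_isogeny hd hL hX hx hH hC hgenus sE quot s'E quot').
Qed.
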